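(* Fix any increasing sequence of finite intervals $(I_n)_{n\in\mathbb N}=([-a_n,b_n])_{n\in\mathbb N}$ in $\mathbb Z$ containing $0$ with $a_n\to\infty$ and $b_n$ strictly increasing. For each $n\in\mathbb N$, let $\boldsymbol o_n'$ be, conditionally on $V'_{I_n}(\mathbf B)$, uniformly distributed on $V'_{I_n}(\mathbf B)\cap[0,b_n]$ and independent of $\overline{\mathbf B}\sqcap I_n$ (including its marks). Then for all bounded measurable $g:\mathcal G_*\to\mathbb R_{\ge0}$ depending only on vertices at some bounded distance to the root, one has $$\frac{1}{\#(V'_{I_n}(\mathbf B)\cap[0,b_n])}\sum_{v\in V'_{I_n}(\mathbf B)\cap[0,b_n]} g[\overline{\mathbf B}\sqcap I_n,v]\to\mathbb E^{\square}[g],\qquad\mathbb P\text{-a.s.}$$ as $n\to\infty$. In particular, $\mathbb P([\overline{\mathbf B}\sqcap I_n,\boldsymbol o_n']\in\cdot)\to\mathbb P^{\square}$ as $n\to\infty$ in the sense of local weak convergence.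
   Context: Doeblin graph. Let $(\Omega,\mathcal F,\mathbb P)$ be a probability space, $S$ a countable set, $\Xi$ a complete separable metric space, $h:S\times\Xi\to S$ a measurable map, and $\xi=(\xi_t)_{t\in\mathbb Z}$ a stationary and ergodic sequence of $\Xi$-valued random variables. The Doeblin graph $\mathbf G$ has vertex set $\mathbb Z\times S$ and a directed edge from each $(t,x)$ to $f_+(t,x):=(t+1,h(x,\xi_t))$. For $s\ge t$, $F^{(t,x)}_s\in S$ is defined by $(s,F^{(t,x)}_s)=f_+^{\,s-t}(t,x)$. A state $x$ is positive recurrent if $\mathbb E[\inf\{s>0:F^{(0,x)}_s=x\}]<\infty$. Bridge graph. Fix a positive recurrent state $x^*\in S$ (assumed to exist). The bridge graph $\mathbf B$ is the subgraph of $\mathbf G$ with vertex set $V(\mathbf B)=\bigcup_{t\in\mathbb Z}\{(s,F^{(t,x^* )}_s):s\ge t\}$ and, from each vertex $v$, the edge to $f_+(v)$. Put $V_t(\mathbf B)=\{(s,y)\in V(\mathbf B):s=t\}$ and $\mathbf B_t=\{y\in S:(t,y)\in V(\mathbf B)\}$. $\overline{\mathbf B}$ is $\mathbf B$ with spine added, i.e. together with edges from $(t,x^* )$ to $(t+1,x^* )$ for all $t\in\mathbb Z$. These graphs are viewed as networks: each vertex $(t,y)$ carries the mark $(y,\xi_t)$, and the direction of each edge is recorded by edge marks. For a finite interval $I\subseteq\mathbb Z$, $V'_I(\mathbf B)=\bigcup_{t\in I}\{(s,F^{(t,x^* )}_s):t\le s\le\sup I\}$, and $\overline{\mathbf B}\sqcap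 I$ is the subgraph of $\overline{\mathbf B}$ induced by $V'_I(\mathbf B)$. For an interval $J$, $V'_I(\mathbf B)\cap J$ denotes the vertices of $V'_I(\mathbf B)$ whose time coordinate lies in $J$. Networks. A network is a (nonempty, locally finite, connected) graph $\Gamma$ with marks, in a complete separable metric space, on vertices and on pairs (vertex, incident edge); all mark spaces are regarded as embedded in one fixed uncountable complete separable metric space. $[\Gamma,o]$ is the class of the network rooted at $o$ up to root- and mark-preserving isomorphism; $\mathcal G_*$ is the set of such classes, metrized by $d([\Gamma_1,o_1],[\Gamma_2,o_2])=1/(1+\alpha)$, where $\alpha$ is the supremum of $r>0$ such that there is a rooted isomorphism of the balls of graph radius $\lfloor r\rfloor$ around the roots for which corresponding marks are at distance less than $1/r$. Local weak convergence is weak convergence of probability measures on $\mathcal G_*$. The function $g$ depends only on vertices at bounded distance to the root if for some $N$, $g[\Gamma,o]$ is determined by the (marked, rooted) ball of radius $N$ around $o$. The measure $\mathbb P^{\square}$ on $\mathcal G_*$ is $\mathbb P^{\square}(A)=\frac{1}{\mathbb E[\#\mathbf B_0]}\mathbb E\big[\sum_{w\in V_0(\mathbf B)}1_{\{[\overline{\mathbf B},w]\in A\}}\big]$, and $\mathbb E^{\square}$ is expectation under it. *)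

(* Defs.v *)
(* Real and measure-theoretic notions are those of MathComp-Analysis, over an
   arbitrary [R : realType]. *)
From HB Require Import structures.
From mathcomp Require Import all_boot all_order all_algebra generic_quotient finmap.
From mathcomp Require Import all_classical all_reals all_analysis.

Set Implicit Arguments.
Unset Strict Implicit.
Unset Printing Implicit Defensive.
Import Order.TTheory GRing.Theory Num.Theory.
Import numFieldTopology.Exports.
Local Open Scope classical_set_scope.
Local Open Scope ring_scope.
Local Open Scope quotient_scope.

(* The library's measurable types are pointed, whence the base point; the spaces
   it is used for are nonempty anyway. *)
#[short(type="completeMetricType")]
HB.structure Definition CompleteMetric (R : numDomainType) :=
  {T of Metric R T & CompletePseudoMetric R T}.

Definition separable (T : topologicalType) :=
  exists2 D : set T, countable D & dense D.

Definition borel (T : ptopologicalType) := g_sigma_algebraType (@open T).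
HB.instance Definition _ (T : ptopologicalType) := Measurable.on (borel T).

(* Weak convergence of probability measures. As in the library's [integral], the
   arguments are set functions, so that measures need not be bundled. *)
Definition weak_cvg (R : realType) (T : ptopologicalType)
    (mu_ : nat -> set (borel T) -> \bar R) (mu : set (borel T) -> \bar R) :=
  forall f : T -> R, continuous f -> (exists C, forall x, `|f x| <= C) ->
    (\int[mu_ n]_x (f x)%:E)%E @[n --> \oo] --> (\int[mu]_x (f x)%:E)%E.

(* Sequences indexed by the integers *)

Definition shift (X : Type) (e : int -> X) : int -> X := fun t => e (t + 1).

Definition path_sigma (X : ptopologicalType) : set (set (int -> X)) :=
  <<s \bigcup_t preimage_set_system setT (fun e : int -> X => e t)
        (@measurable _ (borel X)) >>.

Definition stationary (R : realType) (d : measure_display)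
    (Omega : measurableType d) (P : probability Omega R) (X : ptopologicalType)
    (xi : int -> Omega -> X) :=
  forall A, path_sigma A ->
    P [set w | A (shift (xi^~ w))] = P [set w | A (xi^~ w)].

Definition ergodic (R : realType) (d : measure_display)
    (Omega : measurableType d) (P : probability Omega R) (X : ptopologicalType)
    (xi : int -> Omega -> X) :=
  forall A, path_sigma A -> @shift X @^-1` A = A ->
    P [set w | A (xi^~ w)] = 0%E \/ P [set w | A (xi^~ w)] = 1%E.

(* Networks *)

(* A simple graph on a subset of [V]; [emark G v w] is the mark of the pair
   (vertex [v], edge [{v, w}]), and is meaningful only when [adj G v w]. *)
Record network (V M : Type) := Network {
  vertices : set V;
  adj : V -> V -> Prop;
  vmark : V -> M;
  emark : V -> V -> M }.

Definition induced (V M : Type) (G : network V M) (A : set V) : network V M :=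
  Network (vertices G `&` A) (fun v w => [/\ A v, A w & adj G v w])
    (vmark G) (emark G).

Definition netball (V M : Type) (G : network V M) (o : V) (n : nat) : set V :=
  iter n (fun A => A `|` [set w | exists2 v, A v & adj G v w]) [set o].

Record is_network (V M : Type) (G : network V M) : Prop := IsNetwork {
  network_nonempty : vertices G !=set0;
  network_adjV : forall v w, adj G v w -> vertices G v;
  network_sym : forall v w, adj G v w -> adj G w v;
  network_irr : forall v, ~ adj G v v;
  network_locfin : forall v, vertices G v -> finite_set [set w | adj G v w];
  network_conn : forall v w, vertices G v -> vertices G w ->
    exists n, netball G v n w }.

Definition rooted (V M : Type) := (network V M * V)%type.

Definition is_rooted_network (V M : Type) (X : rooted V M) :=
  is_network X.1 /\ vertices X.1 X.2.

Definition rball (V M : Type) (X : rooted V M) (n : nat) : rooted V M :=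
  (induced X.1 (netball X.1 X.2 n), X.2).

(* Rooted graph isomorphism with corresponding marks related by [r] *)
Definition rooted_iso (M : Type) (r : M -> M -> Prop) (V V' : Type)
    (X : rooted V M) (Y : rooted V' M) :=
  exists phi : V -> V',
    [/\ set_bij (vertices X.1) (vertices Y.1) phi,
        phi X.2 = Y.2,
        forall v w, vertices X.1 v -> vertices X.1 w ->
          adj X.1 v w <-> adj Y.1 (phi v) (phi w),
        forall v, vertices X.1 v -> r (vmark X.1 v) (vmark Y.1 (phi v)) &
        forall v w, vertices X.1 v -> vertices X.1 w -> adj X.1 v w ->
          r (emark X.1 v w) (emark Y.1 (phi v) (phi w))].

(* The space of classes of rooted networks. A network is countable, so each class
   has representatives whose vertices are natural numbers. *)

Record natnet (M : Type) := NatNet {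
  natnet_val :> rooted nat M;
  natnetP : is_rooted_network natnet_val }.

HB.instance Definition _ (M : Type) := gen_eqMixin (natnet M).
HB.instance Definition _ (M : Type) := gen_choiceMixin (natnet M).

Definition natnet_iso (M : Type) : rel (natnet M) :=
  fun X Y => `[< rooted_iso eq X Y >].

Lemma natnet_iso_refl (M : Type) : reflexive (@natnet_iso M).
Proof.
move=> X; apply/asboolP; exists id; split => //.
by split=> // v Xv; exists v.
Qed.

Lemma natnet_iso_trans (M : Type) : transitive (@natnet_iso M).
Proof.
move=> Y X Z /asboolP[f [[f1 f2 f3] fr fa fv fe]].
move=> /asboolP[g [[g1 g2 g3] gr ga gv ge]].
apply/asboolP; exists (g \o f); split => /=.
- split=> [v Xv||z Zz]; first exact/g1/f1.
    by move=> v w vX wX /g2 e; apply: f2 => //; apply: e; rewrite inE;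
      apply: f1; rewrite -inE.
  by have [y Yy <-] := g3 _ Zz; have [x Xx <-] := f3 _ Yy; exists x.
- by rewrite fr.
- move=> v w Xv Xw; split=> [/fa|] => [/(_ Xv Xw)/ga|/ga].
    by apply; exact: f1.
  by move=> /(_ (f1 _ Xv) (f1 _ Xw))/fa; apply.
- by move=> v Xv; rewrite fv// gv//; exact: f1.
- move=> v w Xv Xw vw; rewrite fe// ge//; try exact: f1.
  by apply/fa.
Qed.

Lemma natnet_iso_symW (M : Type) (X Y : natnet M) :
  natnet_iso X Y -> natnet_iso Y X.
Proof.
move=> /asboolP[f [[f1 f2 f3] fr fa fv fe]]; apply/asboolP.
have [_ Xr] := natnetP X.
move: X Y f f1 f2 f3 fr fa fv fe Xr => [X _] [Y _] /= f f1 f2 f3 fr fa fv fe Xr.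
pose g y := xget 0%N [set x | vertices X.1 x /\ f x = y].
have gP y : vertices Y.1 y -> vertices X.1 (g y) /\ f (g y) = y.
  move=> /f3[x Xx fxy]; rewrite /g.
  by case: xgetP => [z -> //|/(_ x)[]].
have gf x : vertices X.1 x -> g (f x) = x.
  move=> Xx; have [gX fg] := gP _ (f1 _ Xx).
  by apply: f2; rewrite ?inE.
exists g; split.
- split=> [y /gP[]//|y y' /set_mem/gP[_ e] /set_mem/gP[_ e'] E|x Xx].
    by rewrite -e E e'.
  by exists (f x); [exact: f1|exact: gf].
- by rewrite -fr gf.
- move=> v w /gP[Xv ev] /gP[Xw ew].
  by rewrite -{1}ev -{1}ew; split=> /fa; apply.
- by move=> v /gP[Xv ev]; rewrite fv// ev.
- move=> v w /gP[Xv ev] /gP[Xw ew] vw.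
  by rewrite fe ?ev ?ew//; apply/fa; rewrite ?ev ?ew.
Qed.

Lemma natnet_iso_sym (M : Type) : symmetric (@natnet_iso M).
Proof. by move=> X Y; apply/idP/idP; exact: natnet_iso_symW. Qed.

Canonical natnet_equiv (M : Type) :=
  EquivRel (@natnet_iso M) (@natnet_iso_refl M) (@natnet_iso_sym M)
    (@natnet_iso_trans M).

Definition Gstar (R : realType) (M : completeMetricType R) :=
  {eq_quot (natnet_equiv M)}.

HB.instance Definition _ (R : realType) (M : completeMetricType R) :=
  Choice.on (Gstar M).
HB.instance Definition _ (R : realType) (M : completeMetricType R) :=
  EqQuotient.on (Gstar M).

Definition single_network (M : pointedType) : network nat M :=
  Network [set 0%N] (fun _ _ => False) (fun=> point) (fun _ _ => point).

Lemma single_networkP (M : pointedType) :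
  is_rooted_network (single_network M, 0%N).
Proof.
split=> //; split => /=; first by exists 0%N.
- by [].
- by [].
- by move=> v [].
- by move=> v _; apply: (sub_finite_set (B := set0)) => //; exact: finite_set0.
- by move=> v w -> ->; exists 0%N.
Qed.

HB.instance Definition _ (R : realType) (M : completeMetricType R) :=
  isPointed.Build (Gstar M)
    (\pi_(Gstar M) (NatNet (single_networkP M))).

(* The class [Gamma, o]; it is [point] if the rooted graph is not a network, that
   is, if it is not isomorphic to any element of [natnet M]. *)
Definition netclass (R : realType) (M : completeMetricType R) (V : Type)
    (X : rooted V M) : Gstar M :=
  xget point [set c : Gstar M | rooted_iso eq (repr c : natnet M) X].

Definition net_alpha (R : realType) (M : completeMetricType R) (V V' : Type)
    (X : rooted V M) (Y : rooted V' M) : \bar R :=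
  ereal_sup [set r%:E | r in [set r : R | 0 < r /\
    rooted_iso (fun m m' => mdist m m' < r^-1)
      (rball X (Num.truncn r)) (rball Y (Num.truncn r))]].

(* Equal to 0 when the supremum is [+oo] *)
Definition net_dist (R : realType) (M : completeMetricType R) (V V' : Type)
    (X : rooted V M) (Y : rooted V' M) : R :=
  fine ((1 + net_alpha X Y)^-1)%E.

Definition Gstar_dist (R : realType) (M : completeMetricType R)
    (c c' : Gstar M) : R :=
  net_dist (repr c : natnet M) (repr c' : natnet M).

(* The open sets of the metric [Gstar_dist] *)
Definition Gstar_open (R : realType) (M : completeMetricType R) :
    set (set (Gstar M)) :=
  [set U | forall c, U c ->
    exists2 e : R, 0 < e & forall c', Gstar_dist c c' < e -> U c'].

Lemma Gstar_openT (R : realType) (M : completeMetricType R) :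
  Gstar_open [set: Gstar M].
Proof. by move=> c _; exists 1. Qed.

Lemma Gstar_openI (R : realType) (M : completeMetricType R) :
  setI_closed (@Gstar_open R M).
Proof.
move=> U W Uo Wo c [/Uo[e e0 eU] /Wo[e' e'0 eW]].
exists (Num.min e e'); first by rewrite lt_min e0.
by move=> c'; rewrite lt_min => /andP[/eU ? /eW].
Qed.

Lemma Gstar_open_bigcup (R : realType) (M : completeMetricType R)
    (I : Type) (f : I -> set (Gstar M)) :
  (forall i, Gstar_open (f i)) -> Gstar_open (\bigcup_i f i).
Proof.
move=> fo c [i _ /fo[e e0 efi]]; exists e => // c' /efi fc'.
by exists i.
Qed.

HB.instance Definition _ (R : realType) (M : completeMetricType R) :=
  isOpenTopological.Build (Gstar M) (@Gstar_openT R M) (@Gstar_openI R M)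
    (@Gstar_open_bigcup R M).

Definition depends_on_bounded_distance (R : realType) (M : completeMetricType R)
    (g : Gstar M -> R) :=
  exists N, forall c c' : Gstar M,
    rooted_iso eq (rball (repr c : natnet M) N) (rball (repr c' : natnet M) N) -> g c = g c'.

(* The Doeblin graph and the bridge graph, for a realized driving sequence [e] *)

Section bridge.
Variables (S X : Type) (h : S * X -> S) (e : int -> X).

Definition fplus (v : int * S) : int * S := (v.1 + 1, h (v.2, e v.1)).

(* [flow (t, x) s] is F^{(t,x)}_s; it is used for [t <= s] only. *)
Definition flow (v : int * S) (s : int) : S := (iter `|s - v.1|%N fplus v).2.

Definition return_time (R : realType) (x : S) : \bar R :=
  ereal_inf [set (s%:~R)%:E | s in [set s : int | 0 < s /\ flow (0, x) s = x]].

Variable xstar : S.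

Definition bridge : set (int * S) :=
  \bigcup_t [set (s, flow (t, xstar) s) | s in [set s | t <= s]].

Definition bridge_level (t : int) : set (int * S) :=
  bridge `&` [set v | v.1 = t].

Definition bridge_states (t : int) : set S := [set y | bridge (t, y)].

(* V'_I(B) for the interval I = [lo, hi] *)
Definition bridge_window (lo hi : int) : set (int * S) :=
  \bigcup_(t in [set t | lo <= t <= hi])
    [set (s, flow (t, xstar) s) | s in [set s | t <= s <= hi]].

Definition spined_arc (v w : int * S) :=
  (bridge v /\ w = fplus v) \/
  (exists t, v = (t, xstar) /\ w = (t + 1, xstar)).

Variables (M : Type) (iv : S * X -> M) (ie : bool -> M).

(* The mark of the pair (v, {v, w}) tells whether the edge points away from v. *)
Definition spined_bridge : network (int * S) M :=
  Network bridge (fun v w => spined_arc v w \/ spined_arc w v)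
    (fun v => iv (v.2, e v.1)) (fun v w => ie `[< spined_arc v w >]).

Definition spined_window (lo hi : int) : network (int * S) M :=
  induced spined_bridge (bridge_window lo hi).

End bridge.

Section probability.
Variables (R : realType) (d : measure_display) (Omega : measurableType d).
Variable P : probability Omega R.

Section box.
Variables (S : choiceType) (X : Type) (h : S * X -> S) (xi : int -> Omega -> X).

Definition positive_recurrent (x : S) :=
  (\int[P]_w return_time h (xi^~ w) R x < +oo)%E.

Variables (xstar : S) (M : completeMetricType R).
Variables (iv : S * X -> M) (ie : bool -> M).

Definition mean_bridge_card : \bar R :=
  (\int[P]_w \esum_(y in bridge_states h (xi^~ w) xstar 0) 1)%E.

Definition Pbox (A : set (borel (Gstar M))) : \bar R :=
  (mean_bridge_card^-1 *
   \int[P]_w \esum_(v in bridge_level h (xi^~ w) xstar 0)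
     (\1_A (netclass (spined_bridge h (xi^~ w) xstar iv ie, v) : borel (Gstar M)))%:E)%E.

End box.

(* The sigma-algebra of labelled networks generated by the presence of each vertex
   and each edge and by their marks *)
Definition network_sigma (V : Type) (M : ptopologicalType) :
    set (set (network V M)) :=
  <<s [set E |
    [\/ exists v, E = [set G | vertices G v],
        exists v w, E = [set G | adj G v w],
        exists v (A : set (borel M)), measurable A /\
          E = [set G | vertices G v /\ A (vmark G v)] |
        exists v w (A : set (borel M)), measurable A /\
          E = [set G | adj G v w /\ A (emark G v w)]]] >>.

Definition uniform_pmf (V : choiceType) (A : set V) (v : V) : R :=
  \1_A v / #|` fset_set A|%:R.

(* Conditionally on the random set [W], the random vertex [o] is uniform on the
   part of [W] inside [D], and independent of the random network [G]. [W] takes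
   countably many values in the intended use, so that conditioning is elementary. *)
Record cond_uniform_indep (V : choiceType) (M : ptopologicalType)
    (W : Omega -> set V) (D : set V) (G : Omega -> network V M)
    (o : Omega -> V) : Prop := CondUniformIndep {
  cui_measurable : forall v, measurable (o @^-1` [set v]);
  cui_uniform : forall (W0 : set V) (v : V),
    P [set w | W w = W0 /\ o w = v] =
    (P [set w | W w = W0] * (uniform_pmf (W0 `&` D) v)%:E)%E;
  cui_indep : forall (W0 : set V) (v : V) (E : set (network V M)),
    network_sigma E ->
    (P [set w | [/\ W w = W0, o w = v & E (G w)]] * P [set w | W w = W0] =
     P [set w | W w = W0 /\ o w = v] * P [set w | W w = W0 /\ E (G w)])%E }.

End probability.

(* Main.v *)
(* For a driving sequence e let F(e) be the sum of g over the classes of the spined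
   bridge rooted at the vertices of its level 0, so that summing F over the shifts
   of e adds g over successive levels. By the last visit to xstar before time 0 and
   stationarity, the mean number of vertices of level 0 is at most the mean return
   time of xstar, hence finite, and Birkhoff's theorem, for g and for the constant 1,
   shows that the average of g over the bridge vertices between times 0 and b_n tends
   to E^box[g]. The window differs from this only near its ends: as level 0 is finite,
   finitely many starting times produce it, so for large n the window has the same
   vertices as the bridge between times 0 and b_n; and if g sees a ball of radius N,
   only the vertices in the N first and N last levels can have another value.

   For the weak convergence, the mean of the averages is the integral of g for the
   law of the rooted window. A nonnegative continuous function is the increasing
   limit of functions depending on bounded balls: finite patterns with marks in a
   countable dense set give a countable base of open sets of G_*, each determined by
   a ball, and one takes finite maxima of rational multiples of their indicators.
   This bounds the lower limit of the integrals, and the upper one by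
   complementation. *)
Require Import Defs.
From HB Require Import structures.
From mathcomp Require Import all_boot all_order all_algebra generic_quotient finmap.
From mathcomp Require Import all_classical all_reals all_analysis.
From mathcomp Require Import measurable_realfun zify ring lra.

Set Implicit Arguments.
Unset Strict Implicit.
Unset Printing Implicit Defensive.
Import Order.TTheory GRing.Theory Num.Theory.
Import numFieldTopology.Exports numFieldNormedType.Exports.
Local Open Scope classical_set_scope.
Local Open Scope ring_scope.
Local Open Scope quotient_scope.

(** * The pointwise ergodic theorem *)

Section birkhoff.
Context (R : realType) (d : measure_display) (T : measurableType d).
Variables (mu : probability T R) (theta : T -> T).
Hypothesis mtheta : measurable_fun setT theta.
Hypothesis theta_inv : forall A, measurable A -> mu (theta @^-1` A) = mu A.
Hypothesis theta_erg : forall A, measurable A -> theta @^-1` A = A ->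
  mu A = 0%E \/ mu A = 1%E.

Definition birkhoff_sum (f : T -> R) (n : nat) (x : T) : R :=
  \sum_(0 <= k < n) f (iter k theta x).

(* The maximum of the Birkhoff sums of lengths 0, ..., n *)
Fixpoint birkhoff_max (f : T -> R) (n : nat) (x : T) : R :=
  if n is n'.+1 then Num.max 0 (f x + birkhoff_max f n' (theta x)) else 0.

Lemma birkhoff_sumSl f n x :
  birkhoff_sum f n.+1 x = f x + birkhoff_sum f n (theta x).
Proof.
rewrite /birkhoff_sum big_nat_recl//; congr (_ + _).
by apply: eq_bigr => k _; rewrite -iterSr.
Qed.

Lemma birkhoff_max_ge0 f n x : 0 <= birkhoff_max f n x.
Proof. by case: n => //= n; rewrite le_max lexx. Qed.

Lemma birkhoff_max_incr f n x : birkhoff_max f n x <= birkhoff_max f n.+1 x.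
Proof.
elim: n x => [|n IH] x; first exact: birkhoff_max_ge0.
by rewrite /= -/(birkhoff_max f n.+1 _) ge_max !le_max lexx/= lerD2l IH orbT.
Qed.

Lemma birkhoff_sum_le_max f n x : birkhoff_sum f n x <= birkhoff_max f n x.
Proof.
elim: n x => [|n IH] x; first by rewrite /birkhoff_sum big_nil.
by rewrite birkhoff_sumSl /= le_max lerD2l IH orbT.
Qed.

Lemma measurable_iter n : measurable_fun setT (iter n theta).
Proof.
elim: n => [|n IH]; first exact: measurable_id.
exact: measurableT_comp mtheta IH.
Qed.

Lemma measurable_birkhoff_sum f n : measurable_fun setT f ->
  measurable_fun setT (birkhoff_sum f n).
Proof.
move=> mf; apply: measurable_sum => k.
exact: measurableT_comp mf (measurable_iter k).
Qed.

Lemma measurable_birkhoff_max f n : measurable_fun setT f ->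
  measurable_fun setT (birkhoff_max f n).
Proof.
move=> mf; elim: n => [|n IH] /=; first exact: measurable_cst.
apply: measurable_maxr; first exact: measurable_cst.
by apply: measurable_funD => //; exact: measurableT_comp.
Qed.

Lemma pushforward_theta A : measurable A -> pushforward mu theta A = mu A.
Proof. by move=> mA; rewrite /pushforward theta_inv. Qed.

Lemma integrable_comp_theta (f : T -> R) : mu.-integrable setT (EFin \o f) ->
  mu.-integrable setT (EFin \o (f \o theta)).
Proof.
move=> fi; have /integrableP[mf foo] := fi.
apply/integrableP; split; first exact: measurableT_comp mf mtheta.
rewrite (_ : (\int[mu]_x _)%E = (\int[mu]_(x in theta @^-1` setT)
   (((fun y => `|(f y)%:E|) \o theta) x))%E)//.
rewrite -ge0_integral_pushforward//.
  rewrite (eq_measure_integral mu)// => A mA _; exact: pushforward_theta.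
exact: measurableT_comp.
Qed.

Lemma integral_comp_theta (f : T -> R) : mu.-integrable setT (EFin \o f) ->
  (\int[mu]_x (f (theta x))%:E = \int[mu]_x (f x)%:E)%E.
Proof.
move=> fi; have fti := integrable_comp_theta fi.
have /integrableP[mf foo] := fi.
have := @integral_pushforward _ _ _ _ _ theta mtheta mu setT (EFin \o f).
rewrite preimage_setT => <-//.
apply: eq_measure_integral => A mA _; exact: pushforward_theta.
Qed.

Lemma integrable_birkhoff_max f n : mu.-integrable setT (EFin \o f) ->
  mu.-integrable setT (EFin \o birkhoff_max f n).
Proof.
move=> fi; have mf : measurable_fun setT f by apply/measurable_EFinP; exact: measurable_int fi.
elim: n => [|n IH]; first exact: integrable0.
have fMi := integrableD measurableT fi (integrable_comp_theta IH).
apply: le_integrable fMi => //.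
  by apply/measurable_EFinP; exact: measurable_birkhoff_max.
move=> x _ /=; rewrite lee_fin ger0_norm; last by rewrite le_max lexx.
by rewrite ge_max normr_ge0 ler_norm.
Qed.

Lemma maximal_ergodic f : mu.-integrable setT (EFin \o f) ->
  {ae mu, forall x, exists n, 0 < birkhoff_max f n x} ->
  (0 <= \int[mu]_x (f x)%:E)%E.
Proof.
move=> fi posx.
have mf : measurable_fun setT f by apply/measurable_EFinP; exact: measurable_int fi.
pose E n := [set x | 0 < birkhoff_max f n x].
have mE n : measurable (E n).
  rewrite (_ : E n = setT `&` birkhoff_max f n @^-1` `]0, +oo[%classic).
    by apply: measurable_birkhoff_max.
  by rewrite setTI; apply/seteqP; split => x; rewrite /E/= in_itv/= andbT.
pose fE n x := f x * \1_(E n) x.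
have mfE n : measurable_fun setT (fE n).
  by apply: measurable_funM => //; exact: measurable_indic.
have fEi n : mu.-integrable setT (EFin \o fE n).
  apply: le_integrable fi => //; first exact/measurable_EFinP.
  move=> x _; rewrite /= lee_fin /fE normrM ler_piMr// indicE.
  by case: (_ \in _); rewrite ?normr1 ?normr0.
have fE_ge0 n : (0 <= \int[mu]_x (fE n x)%:E)%E.
  case: n => [|n].
    apply: integral_ge0 => x _; rewrite lee_fin /fE indicE memNset ?mulr0//.
    by rewrite /E /= ltxx.
  have Mi k := integrable_birkhoff_max k fi.
  rewrite (_ : 0%E = \int[mu]_x (birkhoff_max f n x)%:E -
                  \int[mu]_x (birkhoff_max f n (theta x))%:E)%E; last first.
    rewrite integral_comp_theta// subee//.
    by apply: integrable_fin_num => //; exact: Mi.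
  have Mti := integrable_comp_theta (Mi n).
  apply: (@le_trans _ _ (\int[mu]_x (birkhoff_max f n.+1 x)%:E -
                  \int[mu]_x (birkhoff_max f n (theta x))%:E)%E).
    apply: leeB => //; apply: le_integral => //; try exact: Mi.
    by move=> x _; rewrite lee_fin birkhoff_max_incr.
  rewrite -integralB_EFin//.
  apply: le_integral => //.
    have := integrableB measurableT (Mi n.+1) Mti.
    by apply: eq_integrable => // x _; rewrite /= EFinB.
    exact: fEi.
  move=> x _; rewrite -EFinB lee_fin /fE indicE.
  have [xE|xE] := boolP (x \in E n.+1); last first.
    rewrite mulr0 subr_le0; apply: le_trans (birkhoff_max_ge0 f n (theta x)).
    by rewrite leNgt; apply: contra xE => ?; rewrite inE.
  rewrite mulr1; move: xE; rewrite inE /E /=.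
  by rewrite lt_max ltxx /= => /ltW/max_idPr ->; rewrite addrK.
have cvg_fE : (\int[mu]_x (fE n x)%:E @[n --> \oo] --> \int[mu]_x (f x)%:E)%E.
  have := @dominated_convergence _ _ _ mu setT measurableT
    (fun n => EFin \o fE n) (EFin \o f) (fun x => `|(f x)%:E|%E).
  case => //.
  - by move=> n; exact/measurable_EFinP.
  - exact/measurable_EFinP.
  - apply: filterS posx => x [n0 Mx] _.
    apply: cvg_near_cst; exists n0 => // n /= n0n.
    rewrite /fE indicE mem_set ?mulr1//=.
    rewrite /E/=; apply: lt_le_trans Mx _.
    by apply: (homo_leq (@lexx _ _) (@le_trans _ _) (fun k => birkhoff_max_incr f k x)).
  - exact: integrable_abse.
  - apply: aeW => x n _ /=; rewrite lee_fin /fE normrM ler_piMr// indicE.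
    by case: (_ \in _); rewrite ?normr1 ?normr0.
by apply: cvge_ge cvg_fE; apply: nearW.
Qed.

Lemma birkhoff_sum_bounded f : mu.-integrable setT (EFin \o f) ->
  (\int[mu]_x (f x)%:E < 0)%E ->
  {ae mu, forall x, exists K, forall n, birkhoff_sum f n x <= K}.
Proof.
move=> fi flt0.
have mf : measurable_fun setT f by apply/measurable_EFinP; exact: measurable_int fi.
pose A := [set x | exists K, forall n, birkhoff_sum f n x <= K].
have AE : A = \bigcup_(k : nat) \bigcap_(n : nat) [set x | birkhoff_sum f n x <= k%:R].
  apply/seteqP; split => x.
    move=> [K KP]; exists (Num.truncn `|K|).+1 => // n _ /=.
    rewrite (le_trans (KP n))// (le_trans (ler_norm _))//.
    by rewrite ltW// truncnS_gt.
  by move=> [k _ kP]; exists k%:R => n; apply: kP.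
have mA : measurable A.
  rewrite AE; apply: bigcup_measurable => k _; apply: bigcap_measurable => // n _.
  rewrite (_ : mkset _ = setT `&` birkhoff_sum f n @^-1` `]-oo, k%:R]%classic).
    by apply: measurable_birkhoff_sum.
  by rewrite setTI; apply/seteqP; split => x; rewrite /= in_itv.
have Ainv : theta @^-1` A = A.
  apply/seteqP; split => x [K KP].
    exists (Num.max 0 (f x + K)) => -[|n].
      by rewrite /birkhoff_sum big_nil le_max lexx.
    by rewrite birkhoff_sumSl le_max lerD2l KP orbT.
  by exists (K - f x) => n; rewrite lerBrDl -birkhoff_sumSl.
have [A0|A1] := theta_erg mA Ainv; last first.
  exists (~` A); split => //; first exact: measurableC.
  by have := probability_setC mu mA; rewrite A1 subee.
exfalso; have : (0 <= \int[mu]_x (f x)%:E)%E; last by rewrite leNgt flt0.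
apply: maximal_ergodic => //; exists A; split=> // x /= nx; apply: contrapT => nA.
apply: nx; apply: contrapT => /forallNP nM; apply: nA; exists 0 => n.
rewrite (le_trans (birkhoff_sum_le_max f n x))// leNgt; exact/negP.
Qed.

Lemma birkhoff_upper f (e : R) : mu.-integrable setT (EFin \o f) -> 0 < e ->
  {ae mu, forall x, \forall n \near \oo,
    birkhoff_sum f n x / n%:R <= fine (\int[mu]_x (f x)%:E) + e}.
Proof.
move=> fi e0; set c := fine _.
have cE : (\int[mu]_x (f x)%:E)%E = c%:E by rewrite fineK//; exact: integrable_fin_num.
pose h x := f x - (c + e / 2).
have ci : mu.-integrable setT (EFin \o cst (c + e / 2)).
  by apply: finite_measure_integrable_cst.
have hi : mu.-integrable setT (EFin \o h).
  have := integrableB measurableT fi ci.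
  by apply: eq_integrable => // x _; rewrite /= EFinB.
have hlt0 : (\int[mu]_x (h x)%:E < 0)%E.
  rewrite (_ : (\int[mu]_x _)%E = (\int[mu]_x ((f x)%:E - (cst (c + e / 2) x)%:E))%E)//.
  rewrite integralB_EFin// cE (integral_cst mu measurableT (c + e / 2)%:E).
  rewrite [X in (_ * X)%E]probability_setT mule1.
  by rewrite -EFinB lte_fin; lra.
apply: filterS (birkhoff_sum_bounded hi hlt0) => x [K KP].
near=> n; have n0 : 0 < n%:R :> R by rewrite ltr0n; near: n; exists 1%N.
rewrite ler_pdivrMr//.
have : birkhoff_sum h n x = birkhoff_sum f n x - (c + e / 2) * n%:R.
  rewrite /birkhoff_sum /h big_split/= sumrN; congr (_ - _).
  by rewrite sumr_const_nat subn0 mulr_natr.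
have := KP n => /[swap] ->; rewrite lerBlDr => /le_trans; apply.
suff : K <= e / 2 * n%:R by lra.
rewrite -ler_pdivrMl ?divr_gt0//.
near: n; exists (Num.truncn `|(e/2)^-1 * K|).+1 => // n /= kn.
rewrite (le_trans (ler_norm _))// ltW// (lt_le_trans (truncnS_gt _))//.
by rewrite ler_nat.
Unshelve. all: by end_near. Qed.

Theorem birkhoff f : mu.-integrable setT (EFin \o f) ->
  {ae mu, forall x, birkhoff_sum f n x / n%:R @[n --> \oo] -->
    fine (\int[mu]_x (f x)%:E)}.
Proof.
move=> fi; set c := fine _.
have fNi : mu.-integrable setT (EFin \o (\- f)).
  have := integrableN fi; apply: eq_integrable => // x _ /=; by rewrite EFinN.
have cN : fine (\int[mu]_x (- f x)%:E) = - c.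
  by rewrite (_ : (\int[mu]_x _)%E = (\int[mu]_x - (f x)%:E)%E)//
     integralN ?fineN//; exact: integrable_add_def.
have k0 (k : nat) : 0 < k.+1%:R^-1 :> R by rewrite invr_gt0 ltr0n.
have up : {ae mu, forall x, forall k : nat, \forall n \near \oo,
    birkhoff_sum f n x / n%:R <= c + k.+1%:R^-1}.
  by apply: ae_foralln => k; exact: birkhoff_upper.
have lo : {ae mu, forall x, forall k : nat, \forall n \near \oo,
    birkhoff_sum (\- f) n x / n%:R <= - c + k.+1%:R^-1}.
  by apply: ae_foralln => k; rewrite -cN; exact: birkhoff_upper.
apply: filterS2 up lo => x up lo.
apply/cvgrPdist_le => e e0.
have [k ke] : exists k : nat, k.+1%:R^-1 <= e.
  exists (Num.truncn e^-1); rewrite invf_ple ?posrE ?ltr0n//.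
  by rewrite ltW// truncnS_gt.
near=> n.
have u : birkhoff_sum f n x / n%:R <= c + k.+1%:R^-1 by near: n; exact: up.
have : birkhoff_sum (\- f) n x / n%:R <= - c + k.+1%:R^-1 by near: n; exact: lo.
rewrite /birkhoff_sum sumrN mulNr -/(birkhoff_sum f n x) => l.
move: l u ke; set q := _ / _; set r := _^-1 => l u ke.
rewrite ler_distlC; apply/andP; split; lra.
Unshelve. all: by end_near. Qed.

End birkhoff.

(** * Classes of rooted networks *)

Section rooted_isomorphisms.
Context {M : Type}.

Lemma rooted_iso_comp (r r' r'' : M -> M -> Prop) (V V' V'' : Type)
    (X : rooted V M) (Y : rooted V' M) (Z : rooted V'' M) :
  (forall a b c, r a b -> r' b c -> r'' a c) ->
  rooted_iso r X Y -> rooted_iso r' Y Z -> rooted_iso r'' X Z.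
Proof.
move=> rr [f [[f1 f2 f3] fr fa fv fe]] [g [[g1 g2 g3] gr ga gv ge]].
exists (g \o f); split => /=.
- split=> [v Xv||z Zz]; first exact/g1/f1.
    by move=> v w vX wX /g2 e; apply: f2 => //; apply: e; rewrite inE;
      apply: f1; rewrite -inE.
  by have [y Yy <-] := g3 _ Zz; have [x Xx <-] := f3 _ Yy; exists x.
- by rewrite fr.
- move=> v w Xv Xw; rewrite fa// ga//; exact: f1.
- by move=> v Xv; apply: rr (fv _ Xv) (gv _ _); exact: f1.
- move=> v w Xv Xw vw; apply: rr (fe _ _ Xv Xw vw) _.
  by apply: ge; [exact: f1..|apply/fa].
Qed.

Lemma rooted_iso_sym (r r' : M -> M -> Prop) (V V' : Type)
    (X : rooted V M) (Y : rooted V' M) :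
  (forall a b, r a b -> r' b a) -> vertices X.1 X.2 ->
  rooted_iso r X Y -> rooted_iso r' Y X.
Proof.
move=> rr Xo [f [[f1 f2 f3] fr fa fv fe]].
have /choice[g gP] : forall y, exists x, vertices Y.1 y ->
    vertices X.1 x /\ f x = y.
  move=> y; have [/f3[x Xx <-]|nYy] := pselect (vertices Y.1 y); first by exists x.
  by exists X.2.
have finj v w : vertices X.1 v -> vertices X.1 w -> f v = f w -> v = w.
  by move=> Xv Xw; apply: f2; rewrite inE.
have gf x : vertices X.1 x -> g (f x) = x.
  by move=> Xx; have [gX fg] := gP _ (f1 _ Xx); exact: finj.
exists g; split.
- split=> [y /gP[]//|y y' /set_mem/gP[_ e] /set_mem/gP[_ e'] E|x Xx].
    by rewrite -e E e'.
  by exists (f x); [exact: f1|exact: gf].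
- by rewrite -fr gf.
- move=> v w /gP[Xv ev] /gP[Xw ew].
  by rewrite -{1}ev -{1}ew; split=> /fa; apply.
- by move=> v /gP[Xv ev]; apply: rr; rewrite -{2}ev; exact: fv.
- move=> v w /gP[Xv ev] /gP[Xw ew] vw; apply: rr.
  by rewrite -{2}ev -{2}ew; apply: fe => //; apply/fa; rewrite ?ev ?ew.
Qed.

Lemma rooted_iso_refl (V : Type) (X : rooted V M) : rooted_iso eq X X.
Proof. by exists id; split => //; split=> // v Xv; exists v. Qed.

Lemma rooted_iso_eq_trans (V V' V'' : Type)
    (X : rooted V M) (Y : rooted V' M) (Z : rooted V'' M) :
  rooted_iso eq X Y -> rooted_iso eq Y Z -> rooted_iso eq X Z.
Proof. by apply: rooted_iso_comp => a b c -> ->. Qed.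

Lemma rooted_iso_eq_sym (V V' : Type) (X : rooted V M) (Y : rooted V' M) :
  vertices X.1 X.2 -> rooted_iso eq X Y -> rooted_iso eq Y X.
Proof. by apply: rooted_iso_sym => a b ->. Qed.

Definition adj_closed (V : Type) (X : rooted V M) :=
  vertices X.1 X.2 /\
  forall v w, adj X.1 v w -> vertices X.1 v /\ vertices X.1 w.

Lemma rooted_network_adj_closed (V : Type) (X : rooted V M) :
  is_rooted_network X -> adj_closed X.
Proof.
move=> [Xn Xo]; split=> // v w vw; split; first exact: network_adjV vw.
by apply: network_adjV (network_sym Xn vw).
Qed.

Lemma netballS (V : Type) (G : network V M) o n :
  netball G o n.+1 = netball G o n `|`
    [set w | exists2 v, netball G o n v & adj G v w].
Proof. by []. Qed.

Lemma netball_le (V : Type) (G : network V M) o m n : (m <= n)%N ->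
  netball G o m `<=` netball G o n.
Proof.
move=> /subnK <-; elim: (n - m)%N => // k IH v vm.
by rewrite addSn netballS; left; exact: IH.
Qed.

Lemma netball_root (V : Type) (G : network V M) o n : netball G o n o.
Proof. exact: (@netball_le _ _ _ 0%N). Qed.

Lemma netball_vertices (V : Type) (X : rooted V M) n : adj_closed X ->
  netball X.1 X.2 n `<=` vertices X.1.
Proof.
move=> [Xo Xa]; elim: n => [v -> //|n IH v].
by rewrite netballS => -[/IH//|[w _ /Xa[]]].
Qed.

Lemma netball_finite (V : Type) (X : rooted V M) n : is_rooted_network X ->
  finite_set (netball X.1 X.2 n).
Proof.
move=> Xn; elim: n => [|n IH]; first exact: finite_set1.
rewrite netballS finite_setU; split=> //.
rewrite (_ : mkset _ = \bigcup_(v in netball X.1 X.2 n) [set w | adj X.1 v w]).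
  apply: bigcup_finite => // v /(netball_vertices (rooted_network_adj_closed Xn)).
  by case: Xn => Xn _ /(network_locfin Xn).
by apply/seteqP; split => [w [v]|w [v]]; exists v.
Qed.

Lemma rball_adj_closed (V : Type) (X : rooted V M) n : adj_closed X ->
  adj_closed (rball X n).
Proof.
move=> [Xo Xa]; split; first by split=> //; exact: netball_root.
by move=> v w /= [vn wn /Xa[Xv Xw]].
Qed.

Lemma netball_iso (r : M -> M -> Prop) (V V' : Type) (X : rooted V M)
    (Y : rooted V' M) phi n v :
  adj_closed X -> adj_closed Y ->
  set_bij (vertices X.1) (vertices Y.1) phi -> phi X.2 = Y.2 ->
  (forall v w, vertices X.1 v -> vertices X.1 w ->
          adj X.1 v w <-> adj Y.1 (phi v) (phi w)) ->
  vertices X.1 v -> netball Y.1 Y.2 n (phi v) <-> netball X.1 X.2 n v.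
Proof.
move=> Xc Yc [f1 f2 f3] fr fa.
have finj a b : vertices X.1 a -> vertices X.1 b -> phi a = phi b -> a = b.
  by move=> Xa Xb; apply: f2; rewrite inE.
elim: n v => [|n IH] v Xv.
  rewrite /netball/= -fr; split=> [|->//].
  by apply: finj => //; exact: Xc.1.
rewrite !netballS; split=> [[/(IH _ Xv)|]|[/(IH _ Xv)|]]; first by left.
- move=> [w' w'n aw]; have [/f3[w Xw ew] _] := Yc.2 _ _ aw.
  move: w'n aw; rewrite -ew => /(IH _ Xw) wn /(fa _ _ Xw Xv) wv.
  by right; exists w.
- by left.
- move=> [w wn wv]; have [Xw _] := Xc.2 _ _ wv.
  by right; exists (phi w); [exact/IH|exact/fa].
Qed.

Lemma rooted_iso_rball (r : M -> M -> Prop) (V V' : Type) (X : rooted V M)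
    (Y : rooted V' M) n :
  adj_closed X -> adj_closed Y -> rooted_iso r X Y ->
  rooted_iso r (rball X n) (rball Y n).
Proof.
move=> Xc Yc [phi [phib fr fa fv fe]]; exists phi.
have ball v := @netball_iso r _ _ X Y phi n v Xc Yc phib fr fa.
have [f1 f2 f3] := phib.
split => /=.
- split=> [v [Xv vn]|v w /set_mem[Xv _] /set_mem[Xw _]|y [/f3[x Xx <-] xn]].
  + by split; [exact: f1|exact/ball].
  + by apply: f2; rewrite inE.
  + by exists x => //; split=> //; exact/ball.
- by [].
- move=> v w [Xv vn] [Xw wn]; split=> [[_ _ /(fa _ _ Xv Xw)]|[_ _ /(fa _ _ Xv Xw)]].
    by move=> ?; split=> //; exact/ball.
  by [].
- by move=> v [Xv _]; exact: fv.
- by move=> v w [Xv _] [Xw _] [_ _]; exact: fe.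
Qed.

Lemma netball_induced (V : Type) (G : network V M) (A : set V) o n :
  netball G o n `<=` A -> netball (Defs.induced G A) o n = netball G o n.
Proof.
elim: n => [//|n IH] nA; rewrite !netballS IH; last first.
  by apply: subset_trans nA; rewrite netballS; exact: subsetUl.
apply/seteqP; split => w [|[v vn]]; try by left.
  by case=> _ _ vw; right; exists v.
move=> vw; right; exists v => //; split=> //.
  by apply: nA; rewrite netballS; left.
by apply: nA; rewrite netballS; right; exists v.
Qed.

Lemma rball_induced (V : Type) (G : network V M) (A : set V) o n :
  netball G o n `<=` A ->
  rooted_iso eq (rball (Defs.induced G A, o) n) (rball (G, o) n).
Proof.
move=> nA; rewrite /rball/= netball_induced//.
exists id; split => //=.
- split=> [v [[]]//|v w _ _ //|v [Gv vn]]; exists v => //.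
  by split=> //; split=> //; exact: nA.
- move=> v w [[_ Av] vn] [[_ Aw] wn]; split=> [[_ _ []]|[_ _ vw]]//.
Qed.

Lemma rball_rball (V : Type) (X : rooted V M) m n : (m <= n)%N ->
  rooted_iso eq (rball (rball X n) m) (rball X m).
Proof.
by case: X => G o mn; apply: rball_induced; exact: netball_le.
Qed.

Lemma rooted_iso_rball_le (V V' : Type) (X : rooted V M) (Y : rooted V' M) m n :
  adj_closed X -> adj_closed Y -> (m <= n)%N ->
  rooted_iso eq (rball X n) (rball Y n) -> rooted_iso eq (rball X m) (rball Y m).
Proof.
move=> Xc Yc mn XY.
have Xnc := rball_adj_closed n Xc; have Ync := rball_adj_closed n Yc.
have Xmc := rball_adj_closed m Xnc.
apply: rooted_iso_eq_trans (rooted_iso_eq_sym Xmc.1 (rball_rball X mn)) _.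
apply: rooted_iso_eq_trans (rball_rball Y mn).
exact: rooted_iso_rball.
Qed.

Definition relabel (V V' : Type) (f : V -> V') (X : rooted V M) : rooted V' M :=
  (Network (f @` vertices X.1)
     (fun v w => exists a b, [/\ f a = v, f b = w & adj X.1 a b])
     (fun v => vmark X.1 (if pselect (exists a, f a = v) is left e then projT1 (cid e) else X.2))
     (fun v w => emark X.1
        (if pselect (exists a, f a = v) is left e then projT1 (cid e) else X.2)
        (if pselect (exists a, f a = w) is left e then projT1 (cid e) else X.2)),
   f X.2).

Lemma relabel_iso (V V' : Type) (f : V -> V') (X : rooted V M) :
  injective f -> rooted_iso eq (relabel f X) X.
Proof.
move=> finj; set g := fun v => if pselect (exists a, f a = v) is left e
  then projT1 (cid e) else X.2.
have gf a : g (f a) = a.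
  rewrite /g; case: pselect => [e|]; last by case; exists a.
  by apply: finj; case: cid.
exists g; split => //=.
- split=> [_ [a Xa <-]|_ _ /set_mem[a Xa <-] /set_mem[b Xb <-]|a Xa]; rewrite ?gf//.
    by move=> ->.
  by exists (f a); rewrite ?gf//; exists a.
- move=> _ _ [a Xa <-] [b Xb <-]; rewrite !gf; split=> [[a' [b' [/finj -> /finj ->]]]//|ab].
  by exists a, b.
Qed.

Lemma relabel_rooted_network (V V' : Type) (f : V -> V') (X : rooted V M) :
  injective f -> is_rooted_network X -> is_rooted_network (relabel f X).
Proof.
move=> finj [Xn Xo]; split; last by exists X.2.
split=> /=.
- by exists (f X.2); exists X.2.
- by move=> v w [a [b [<- _ ab]]]; exists a => //; exact: network_adjV ab.
- by move=> v w [a [b [<- <- ab]]]; exists b, a; split=> //; exact: network_sym.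
- by move=> v [a [b [<- /finj -> /(network_irr Xn)]]].
- move=> _ [a Xa <-].
  rewrite (_ : mkset _ = f @` [set w | adj X.1 a w]).
    by apply: finite_image; exact: network_locfin.
  apply/seteqP; split=> [w [a' [b [/finj -> <- ab]]]|_ [b ab <-]]; first by exists b.
  by exists a, b.
- move=> _ _ [a Xa <-] [b Xb <-]; have [n] := network_conn Xn Xa Xb.
  elim: n b {Xb} => [b ->|n IH b]; first by exists 0%N.
  rewrite netballS => -[/IH//|[c cn cb]].
  have [m mc] := IH _ cn; exists m.+1; rewrite netballS; right.
  by exists (f c) => //; exists c, b.
Qed.

End rooted_isomorphisms.

Section netclass_theory.
Context {R : realType} {M : completeMetricType R}.

Lemma repr_rooted_network (c : Gstar M) :
  is_rooted_network ((repr c : natnet M) : rooted nat M).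
Proof. exact: natnetP. Qed.

Lemma repr_adj_closed (c : Gstar M) : adj_closed ((repr c : natnet M) : rooted nat M).
Proof. exact/rooted_network_adj_closed/repr_rooted_network. Qed.

Lemma netclassP (V : Type) (X : rooted V M) (f : V -> nat) :
  injective f -> is_rooted_network X ->
  rooted_iso eq (repr (netclass X : Gstar M) : natnet M) X.
Proof.
move=> finj Xn; rewrite /netclass.
case: xgetP => [c -> //|]; move/(_ (\pi_(Gstar M) (NatNet (relabel_rooted_network finj Xn)))).
case; apply: rooted_iso_eq_trans (relabel_iso X finj).
apply: rooted_iso_eq_sym; first by case: (relabel_rooted_network finj Xn).
set Y := NatNet _.
have : natnet_iso Y (repr (\pi_(Gstar M) Y)).
  by apply/eqmodP; rewrite reprK.
by move/asboolP.
Qed.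

Lemma netclass_eq (V V' : Type) (X : rooted V M) (Y : rooted V' M) :
  vertices X.1 X.2 -> rooted_iso eq X Y -> netclass X = netclass Y :> Gstar M.
Proof.
move=> Xo XY; rewrite /netclass; congr xget; apply/seteqP; split=> c /= cX.
  exact: rooted_iso_eq_trans XY.
by apply: rooted_iso_eq_trans cX _; exact: rooted_iso_eq_sym.
Qed.

Lemma netclass_point (V : Type) (X : rooted V M) :
  ~ (exists c : Gstar M, rooted_iso eq (repr c : natnet M) X) ->
  netclass X = point :> Gstar M.
Proof. by move=> nX; rewrite /netclass; case: xgetP => // c _ cX; case: nX; exists c. Qed.

End netclass_theory.

(** * Measurability of the class of a random network *)

Section measurable_predicates.
Context (d : measure_display) (T : measurableType d).
Implicit Types P Q : T -> Prop.

Lemma measurable_pred_cst (Q : Prop) : measurable [set _ : T | Q].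
Proof.
have [q|nq] := pselect Q.
  by have -> : [set _ : T | Q] = setT by apply/seteqP; split.
by have -> : [set _ : T | Q] = set0 by apply/seteqP; split.
Qed.

Lemma measurable_pred_and P Q : measurable [set x | P x] ->
  measurable [set x | Q x] -> measurable [set x | P x /\ Q x].
Proof. exact: measurableI. Qed.

Lemma measurable_pred_or P Q : measurable [set x | P x] ->
  measurable [set x | Q x] -> measurable [set x | P x \/ Q x].
Proof. exact: measurableU. Qed.

Lemma measurable_pred_not P : measurable [set x | P x] ->
  measurable [set x | ~ P x].
Proof. exact: measurableC. Qed.

Lemma measurable_pred_imp P Q : measurable [set x | P x] ->
  measurable [set x | Q x] -> measurable [set x | P x -> Q x].
Proof.
move=> mP mQ; rewrite (_ : mkset _ = [set x | ~ P x \/ Q x]).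
  by apply: measurable_pred_or => //; exact: measurable_pred_not.
by apply: eq_set => x; rewrite -implyE.
Qed.

Lemma measurable_pred_iff P Q : measurable [set x | P x] ->
  measurable [set x | Q x] -> measurable [set x | P x <-> Q x].
Proof.
move=> mP mQ.
by apply: (measurable_pred_and (P := fun x => P x -> Q x)); exact: measurable_pred_imp.
Qed.

Lemma measurable_pred_exists (I : Type) (P : I -> T -> Prop) :
  countable [set: I] -> (forall i, measurable [set x | P i x]) ->
  measurable [set x | exists i, P i x].
Proof.
move=> Ic mP; rewrite (_ : mkset _ = \bigcup_i [set x | P i x]).
  exact: countable_bigcupT_measurable.
by apply/seteqP; split => [x [i Pi]|x [i _ Pi]]; exists i.
Qed.

Lemma measurable_pred_exists2 (I : Type) (P Q : I -> T -> Prop) :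
  countable [set: I] -> (forall i, measurable [set x | P i x]) ->
  (forall i, measurable [set x | Q i x]) ->
  measurable [set x | exists2 i, P i x & Q i x].
Proof.
move=> Ic mP mQ; rewrite (_ : mkset _ = [set x | exists i, P i x /\ Q i x]).
  by apply: measurable_pred_exists => // i; exact: measurable_pred_and.
by apply/seteqP; split => x [i]; [exists i|move=> []; exists i].
Qed.

Lemma measurable_pred_forall (I : Type) (P : I -> T -> Prop) :
  countable [set: I] -> (forall i, measurable [set x | P i x]) ->
  measurable [set x | forall i, P i x].
Proof.
move=> Ic mP; rewrite (_ : mkset _ = [set x | ~ exists i, ~ P i x]).
  apply: measurable_pred_not; apply: measurable_pred_exists => // i.
  exact: measurable_pred_not.
apply/seteqP; split => x /= => [xP [i]|nx i]; first by apply.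
by apply: contrapT => nP; apply: nx; exists i.
Qed.

End measurable_predicates.

Lemma separable_dense_seq (R : realType) (M : completeMetricType R) :
  separable M -> exists D : nat -> M,
    forall (m : M) (e : R), 0 < e -> exists i, mdist m (D i) < e.
Proof.
move=> [A Ac Ad].
have A0 m e : 0 < e -> exists2 a, A a & mdist m a < e.
  move=> e0; have := Ad (ball m e)^°; case.
  - by exists m; apply: nbhsx_ballx.
  - exact: open_interior.
  - move=> a [/interior_subset]; rewrite ballEmdist/= => ma Aa; by exists a.
have [/pfcard_geP [A0'|[f]]] := Ac.
  by have [a] := A0 point 1 ltr01; rewrite A0'.
exists f => m e /(A0 m)[a Aa ma].
by have [i _ ia] := 'surj_f Aa; exists i; rewrite ia.
Qed.

Lemma measurable_mball (R : realType) (M : completeMetricType R) (m : M) (e : R) :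
  @measurable _ (borel M) [set m' | mdist m m' < e].
Proof.
apply: sub_sigma_algebra; rewrite openE => x /= mx.
apply/nbhs_ballP; exists (e - mdist m x); first by rewrite /= subr_gt0.
move=> y; rewrite ballEmdist/= => xy.
by rewrite (le_lt_trans (metric_triangle _ x _))// -ltrBrDl.
Qed.

HB.instance Definition _ (V M : Type) := gen_eqMixin (network V M).
HB.instance Definition _ (V M : Type) := gen_choiceMixin (network V M).
HB.instance Definition _ (V : Type) (M : pointedType) :=
  isPointed.Build (network V M) (Network set0 (fun _ _ => False) (fun=> point) (fun _ _ => point)).

Definition network_gen (V : Type) (M : ptopologicalType) : set (set (network V M)) :=
  [set E |
    [\/ exists v, E = [set G | vertices G v],
        exists v w, E = [set G | adj G v w],
        exists v (A : set (borel M)), measurable A /\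
          E = [set G | vertices G v /\ A (vmark G v)] |
        exists v w (A : set (borel M)), measurable A /\
          E = [set G | adj G v w /\ A (emark G v w)]]].

Definition networkM (V : Type) (M : ptopologicalType) :=
  g_sigma_algebraType (@network_gen V M).
HB.instance Definition _ (V : Type) (M : ptopologicalType) := Measurable.on (networkM V M).

Section network_events.
Context (V : Type) (M : ptopologicalType).
Local Notation N := (networkM V M).

Lemma measurable_vertices v : measurable [set G : N | vertices G v].
Proof. by apply: sub_sigma_algebra; apply: Or41; exists v. Qed.

Lemma measurable_adj v w : measurable [set G : N | adj G v w].
Proof. by apply: sub_sigma_algebra; apply: Or42; exists v, w. Qed.

Lemma measurable_vmark v (A : set (borel M)) : measurable A ->
  measurable [set G : N | vertices G v /\ A (vmark G v)].
Proof. by move=> mA; apply: sub_sigma_algebra; apply: Or43; exists v, A. Qed.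

Lemma measurable_emark v w (A : set (borel M)) : measurable A ->
  measurable [set G : N | adj G v w /\ A (emark G v w)].
Proof. by move=> mA; apply: sub_sigma_algebra; apply: Or44; exists v, w, A. Qed.

Hypothesis V_countable : countable [set: V].

Lemma measurable_netball o n v : measurable [set G : N | netball G o n v].
Proof.
elim: n v => [|n IH] v; first exact: measurable_pred_cst.
apply: measurable_pred_or => //.
by apply: measurable_pred_exists2 => // w; exact: measurable_adj.
Qed.

End network_events.

(* Codes for finite rooted networks on a set of natural numbers, with marks in a
   dense sequence: radius, root, vertices, edges, and the indices of the marks of
   the vertices and of the (vertex, edge) pairs. *)
Definition pattern :=
  (nat * nat * seq nat * seq (nat * nat) * seq nat * seq (seq nat))%type.

Section patterns.
Context {R : realType} {M : completeMetricType R}.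
Variable D : nat -> M.
Hypothesis D_dense : forall (m : M) (e : R), 0 < e -> exists i, mdist m (D i) < e.
Implicit Types q : pattern.

Definition pat_radius q : nat := q.1.1.1.1.1.
Definition pat_root q : nat := q.1.1.1.1.2.
Definition pat_verts q : seq nat := q.1.1.1.2.
Definition pat_edges q : seq (nat * nat) := q.1.1.2.
Definition pat_vmark q (v : nat) : M := D (nth 0%N q.1.2 v).
Definition pat_emark q (v w : nat) : M := D (nth 0%N (nth [::] q.2 v) w).

Definition pat_net q : rooted nat M :=
  (Network [set v | v \in pat_verts q] (fun v w => (v, w) \in pat_edges q)
     (pat_vmark q) (pat_emark q), pat_root q).

Definition pat_tol q : R := ((pat_radius q).*2)%:R^-1.

Definition pat_match q (V : Type) (X : rooted V M) :=
  rooted_iso (fun m m' => mdist m m' < pat_tol q) (rball X (pat_radius q)) (pat_net q).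

Lemma pat_match_near q (V V' : Type) (X : rooted V M) (Y : rooted V' M) :
  vertices Y.1 Y.2 ->
  pat_match q X -> pat_match q Y ->
  rooted_iso (fun m m' => mdist m m' < (pat_radius q)%:R^-1)
    (rball X (pat_radius q)) (rball Y (pat_radius q)).
Proof.
move=> Yo qX qY.
have qY' : rooted_iso (fun m m' => mdist m m' < pat_tol q)
    (pat_net q) (rball Y (pat_radius q)).
  apply: rooted_iso_sym qY; first by move=> a b; rewrite metric_sym.
  by split=> //; exact: netball_root.
apply: rooted_iso_comp qX qY' => a b c ab bc.
rewrite (le_lt_trans (metric_triangle _ b _))//.
rewrite (_ : _^-1 = pat_tol q + pat_tol q) ?ltrD//.
by rewrite /pat_tol -muln2 natrM invfM -splitr.
Qed.

Lemma pat_match_ball q (V V' : Type) (X : rooted V M) (Y : rooted V' M) N :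
  adj_closed X -> adj_closed Y -> (pat_radius q <= N)%N ->
  rooted_iso eq (rball X N) (rball Y N) -> pat_match q X -> pat_match q Y.
Proof.
move=> Xc Yc qN /(rooted_iso_rball_le Xc Yc qN) XY.
have := rooted_iso_eq_sym (rball_adj_closed _ Xc).1 XY.
by apply: rooted_iso_comp => a b c ->.
Qed.

Lemma pat_match_iso q (V V' : Type) (X : rooted V M) (Y : rooted V' M) :
  adj_closed X -> adj_closed Y ->
  rooted_iso eq X Y -> pat_match q X <-> pat_match q Y.
Proof.
move=> Xc Yc XY; split; apply: pat_match_ball => //; apply: rooted_iso_rball => //.
exact: rooted_iso_eq_sym Xc.1 XY.
Qed.

Lemma pat_exists (X : rooted nat M) n : is_rooted_network X -> (0 < n)%N ->
  exists q, pat_radius q = n /\ pat_match q X.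
Proof.
move=> Xn n0; have Xc := rooted_network_adj_closed Xn.
have e0 : 0 < (n.*2)%:R^-1 :> R by rewrite invr_gt0 ltr0n double_gt0.
have /finite_seqP[s sE] := netball_finite n Xn.
have sv v : v \in s -> vertices X.1 v.
  by move=> vs; apply: (@netball_vertices _ _ _ n) => //; rewrite sE.
pose K := (\max_(v <- s) v).+1.
have sK v : v \in s -> (v < K)%N by move=> vs; rewrite ltnS; exact: leq_bigmax_seq.
have /choice[vi viP] : forall v, exists i, mdist (vmark X.1 v) (D i) < (n.*2)%:R^-1.
  by move=> v; exact: D_dense.
have /choice[ei eiP] : forall vw : nat * nat, exists i,
    mdist (emark X.1 vw.1 vw.2) (D i) < (n.*2)%:R^-1.
  by move=> v; exact: D_dense.
pose q : pattern := (n, X.2, s, [seq vw <- [seq (v, w) | v <- s, w <- s] | `[< adj X.1 vw.1 vw.2 >]],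
  mkseq vi K, mkseq (fun v => mkseq (fun w => ei (v, w)) K) K).
exists q; split=> //; exists id; split => //=.
- split=> [v [_ vn]|v w _ _ //|v vs]; first by move: vn; rewrite sE.
  by exists v => //; split; [exact: sv|rewrite sE].
- move=> v w [Xv vn] [Xw wn]; rewrite /pat_edges /= mem_filter; split=> [[_ _ vw]|/andP[/asboolP]//].
  apply/andP; split; first exact/asboolP.
  by apply/allpairsP; exists (v, w); rewrite /= sE in vn wn *; split.
- move=> v [Xv]; rewrite sE => /= vs.
  by rewrite /pat_vmark/= nth_mkseq ?sK//; exact: viP.
- move=> v w [Xv]; rewrite sE => /= vs [Xw ws] _.
  by rewrite /pat_emark/= !nth_mkseq ?sK//; exact: (eiP (v, w)).
Qed.

Lemma Gstar_open_near (U : set (Gstar M)) c : Gstar_open U -> U c ->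
  exists2 n, (0 < n)%N & forall c' : Gstar M,
    rooted_iso (fun m m' => mdist m m' < n%:R^-1)
      (rball (repr c : natnet M) n) (rball (repr c' : natnet M) n) -> U c'.
Proof.
move=> Uo /Uo[e e0 eU]; exists (Num.truncn e^-1).+1 => // c' cc'.
set n := (Num.truncn e^-1).+1 in cc' *.
have n0 : 0 < n%:R :> R by rewrite ltr0n.
apply: eU; rewrite /Gstar_dist /net_dist.
have : (n%:R%:E <= net_alpha (repr c : natnet M) (repr c' : natnet M))%E.
  apply: ereal_sup_ubound; exists n%:R => //; split => //=.
  by rewrite natrK.
case: (net_alpha _ _) => [r| |]//=.
rewrite lee_fin => nr; rewrite inver gt_eqF/=; last first.
    by rewrite ltr_wpDr// ltW// (lt_le_trans n0).
  rewrite invf_plt ?posrE//; last by rewrite ltr_wpDl// (lt_le_trans n0).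
  rewrite (lt_le_trans (truncnS_gt _))//.
  by rewrite (le_trans nr)// lerDr.
Qed.

Definition pat_set q : set (Gstar M) := [set c | pat_match q (repr c : natnet M)].

Lemma pat_set_open (U : set (Gstar M)) c : Gstar_open U -> U c ->
  exists q, pat_set q c /\ pat_set q `<=` U.
Proof.
move=> Uo Uc; have [n n0 nU] := Gstar_open_near Uo Uc.
have [q [qn qc]] := pat_exists (repr_rooted_network c) n0.
exists q; split=> // c' qc'; apply: nU; rewrite -qn.
by apply: pat_match_near => //; case: (repr_rooted_network c').
Qed.

Lemma open_pat_set (U : set (Gstar M)) : Gstar_open U ->
  U = \bigcup_(q in [set q | pat_set q `<=` U]) pat_set q.
Proof.
move=> Uo; apply/seteqP; split=> [c Uc|c [q qU]]; last exact: qU.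
by have [q [qc qU]] := pat_set_open Uo Uc; exists q.
Qed.

Section pattern_events.
Context (V : Type) (dec : nat -> V) (enc : V -> nat).
Hypothesis encK : cancel enc dec.

Let inj_enc : injective enc := can_inj encK.

Let V_countable : countable [set: V].
Proof. by apply/countable_injP; exists enc => v w _ _ /inj_enc. Qed.

Definition pat_event q (v : V) (psi : nat -> V) : set (networkM V M) :=
  [set G | [/\ forall i, i \in pat_verts q ->
        vertices G (psi i) /\ netball G v (pat_radius q) (psi i),
      forall x, vertices G x /\ netball G v (pat_radius q) x ->
        exists i, i \in pat_verts q /\ psi i = x,
      forall i j, i \in pat_verts q -> j \in pat_verts q ->
        (i, j) \in pat_edges q <-> adj G (psi i) (psi j),
      forall i, i \in pat_verts q ->
        vertices G (psi i) /\ mdist (pat_vmark q i) (vmark G (psi i)) < pat_tol q &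
      forall i j, i \in pat_verts q -> j \in pat_verts q ->
        (i, j) \in pat_edges q -> adj G (psi i) (psi j) /\
         mdist (pat_emark q i j) (emark G (psi i) (psi j)) < pat_tol q]].

Lemma measurable_pat_event q v psi : measurable (pat_event q v psi).
Proof.
have mb x : measurable [set G : networkM V M | vertices G x /\ netball G v (pat_radius q) x].
  apply: measurable_pred_and; first exact: measurable_vertices.
  exact: measurable_netball.
rewrite /pat_event.
rewrite (_ : mkset _ = [set G : networkM V M | (forall i, i \in pat_verts q ->
        vertices G (psi i) /\ netball G v (pat_radius q) (psi i)) /\
      (forall x, vertices G x /\ netball G v (pat_radius q) x ->
        exists i, i \in pat_verts q /\ psi i = x) /\
      (forall i j, i \in pat_verts q -> j \in pat_verts q ->
        (i, j) \in pat_edges q <-> adj G (psi i) (psi j)) /\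
      (forall i, i \in pat_verts q ->
        vertices G (psi i) /\ mdist (pat_vmark q i) (vmark G (psi i)) < pat_tol q) /\
      (forall i j, i \in pat_verts q -> j \in pat_verts q ->
        (i, j) \in pat_edges q -> adj G (psi i) (psi j) /\
         mdist (pat_emark q i j) (emark G (psi i) (psi j)) < pat_tol q)]); last first.
  by apply/seteqP; split=> G /=; [case|move=> [? [? [? []]]]].
have cn : countable [set: nat] by [].
repeat apply: measurable_pred_and.
- apply: measurable_pred_forall => // i; apply: measurable_pred_imp => //.
  exact: measurable_pred_cst.
- apply: measurable_pred_forall => // x; apply: measurable_pred_imp => //.
  exact: measurable_pred_cst.
- apply: measurable_pred_forall => // i; apply: measurable_pred_forall => // j.
  do 2 (apply: measurable_pred_imp; first exact: measurable_pred_cst).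
  by apply: measurable_pred_iff; [exact: measurable_pred_cst|exact: measurable_adj].
- apply: measurable_pred_forall => // i; apply: measurable_pred_imp.
    exact: measurable_pred_cst.
  exact: (measurable_vmark _ (measurable_mball _ _)).
- apply: measurable_pred_forall => // i; apply: measurable_pred_forall => // j.
  do 3 (apply: measurable_pred_imp; first exact: measurable_pred_cst).
  exact: (measurable_emark _ _ (measurable_mball _ _)).
Qed.

(* [nth 0 l i] is the code of the image of the vertex [i] of the pattern. *)
Definition pat_psi (l : seq nat) (i : nat) : V := dec (nth 0%N l i).

Definition pat_matched q (v : V) : set (networkM V M) :=
  [set G | exists l : seq nat, ({in pat_verts q &, injective (pat_psi l)} /\
     pat_root q \in pat_verts q /\ pat_psi l (pat_root q) = v) /\ pat_event q v (pat_psi l) G].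

Lemma measurable_pat_matched q v : measurable (pat_matched q v).
Proof.
apply: measurable_pred_exists => // l; apply: measurable_pred_and.
  exact: measurable_pred_cst.
exact: measurable_pat_event.
Qed.

Lemma pat_matchedP q v (G : network V M) : vertices G v ->
  pat_matched q v G <-> pat_match q (G, v).
Proof.
move=> Gv; split.
  move=> [l [[linj [ro lro]] [lf ls la lv le]]].
  have : rooted_iso (fun m m' => mdist m m' < pat_tol q) (pat_net q)
     (rball (G, v) (pat_radius q)).
    exists (pat_psi l); split => //=.
    - split=> [i /lf//|i j /set_mem iq /set_mem jq|x /ls[i [iq <-]]]; first exact: linj.
      by exists i.
    - move=> i j iq jq; split=> [ij|[_ _ ij]]; last exact/la.
      have [? ?] := lf _ iq; have [? ?] := lf _ jq.
      by split => //; apply/la.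
    - by move=> i /lv[].
    - by move=> i j iq jq /le[].
  by apply: rooted_iso_sym => //= a b; rewrite metric_sym.
move=> XQ; have rq : pat_root q \in pat_verts q.
  case: (XQ) => phi0 [[f1 _ _] /= <- _ _ _]; apply: f1.
  by split => //; exact: netball_root.
move: XQ => /rooted_iso_sym - /(_ (fun m m' => mdist m m' < pat_tol q)) [].
- by move=> a b; rewrite metric_sym.
- by split => //; exact: netball_root.
move=> phi [[/= f1 f2 f3] /= fr fa fv fe].
pose K := (\max_(i <- pat_verts q) i).+1.
pose l := mkseq (fun i => enc (phi i)) K.
have psiE i : i \in pat_verts q -> pat_psi l i = phi i.
  by move=> iq; rewrite /pat_psi nth_mkseq ?encK// ltnS; exact: leq_bigmax_seq.
exists l; split; [split; [|split]|split] => //.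
- by move=> i j iq jq; rewrite !psiE// => /f2; apply; rewrite inE.
- by rewrite psiE.
- by move=> i iq; rewrite psiE//; exact: f1.
- by move=> x /f3[i iq ix]; exists i; rewrite psiE.
- move=> i j iq jq; rewrite !psiE//; rewrite fa//; split=> [[]//|ij].
  by have [_ ?] := f1 _ iq; have [_ ?] := f1 _ jq.
- by move=> i iq; rewrite psiE//; split; [have [] := f1 _ iq|exact: fv].
- move=> i j iq jq ij; rewrite !psiE//; split; last exact: fe.
  by have /fa[] := ij.
Qed.

(* A weak form of measurability of the map to [Gstar M], on the rooted networks
   only: elsewhere [netclass] has the junk value [point]. *)
Definition net_measurable (A : set (Gstar M)) := forall v : V,
  exists2 E : set (networkM V M), measurable E & forall G : network V M,
    is_rooted_network (G, v) -> E G <-> A (netclass (G, v)).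

Lemma net_measurable_pat_set q : net_measurable (pat_set q).
Proof.
move=> v; exists (pat_matched q v); first exact: measurable_pat_matched.
move=> G Gn; have [_ Gv] := Gn; rewrite (pat_matchedP _ Gv) /pat_set /=.
have Gc := rooted_network_adj_closed Gn.
apply: pat_match_iso => //; first exact: repr_adj_closed.
apply: rooted_iso_eq_sym; first by case: (repr_rooted_network (netclass (G, v) : Gstar M)).
exact: netclassP inj_enc Gn.
Qed.

Lemma net_measurable_sigma : sigma_algebra setT net_measurable.
Proof.
split.
- by move=> v; exists set0.
- move=> A mA v; have [E mE EA] := mA v; exists (~` E); first exact: measurableC.
  by move=> G Gn; split=> [nE|[_ nA]]; [split=> // /(EA _ Gn)|move=> /(EA _ Gn)].
- move=> A mA v; have /choice[E EP] : forall n, exists E : set (networkM V M),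
     measurable E /\ forall G : network V M,
     is_rooted_network (G, v) -> E G <-> A n (netclass (G, v)).
    by move=> n; have [E mE EA] := mA n v; exists E.
  exists (\bigcup_n E n); first by apply: bigcupT_measurable => n; case: (EP n).
  by move=> G Gn; split=> -[n _ /((EP n).2 _ Gn)]; exists n.
Qed.

Lemma net_measurable_bigcup (I : Type) (P : set I) (F : I -> set (Gstar M)) :
  countable [set: I] -> (forall i, P i -> net_measurable (F i)) ->
  net_measurable (\bigcup_(i in P) F i).
Proof.
move=> Ic mF v; have /choice[E EP] : forall i, exists E : set (networkM V M),
   measurable E /\ (P i -> forall G : network V M,
   is_rooted_network (G, v) -> E G <-> F i (netclass (G, v))).
  move=> i; have [Pi|nPi] := pselect (P i); last by exists set0.
  by have [E mE EA] := mF i Pi v; exists E.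
exists [set G | exists i, P i /\ E i G].
  apply: measurable_pred_exists => // i; apply: measurable_pred_and.
    exact: measurable_pred_cst.
  by case: (EP i).
move=> G Gn; split=> [[i [Pi EG]]|[i Pi FG]]; exists i => //.
  by apply/((EP i).2 Pi _ Gn).
by split=> //; apply/((EP i).2 Pi _ Gn).
Qed.

Lemma net_measurable_borel (A : set (borel (Gstar M))) : measurable A ->
  net_measurable A.
Proof.
apply: smallest_sub; first exact: net_measurable_sigma.
move=> U Uo; rewrite (open_pat_set Uo); apply: net_measurable_bigcup.
  exact: countableP.
by move=> q _; exact: net_measurable_pat_set.
Qed.

End pattern_events.
End patterns.

(** * The bridge *)

Section connectivity.
Context {V M : Type} (G : network V M).

Lemma netball_step u n v w : netball G u n v -> adj G v w -> netball G u n.+1 w.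
Proof. by move=> uv vw; rewrite netballS; right; exists v. Qed.

Lemma netball_trans u n v m w :
  netball G u n v -> netball G v m w -> netball G u (n + m)%N w.
Proof.
move=> uv; elim: m w => [|m IH] w; first by move=> ->; rewrite addn0.
rewrite addnS netballS => -[/IH|[x /IH ux xw]]; first by rewrite netballS; left.
exact: netball_step ux xw.
Qed.

Lemma netball_sym u n v : (forall v w, adj G v w -> adj G w v) ->
  netball G u n v -> exists m, netball G v m u.
Proof.
move=> Gsym; elim: n v => [v ->|n IH v]; first by exists 0%N.
rewrite netballS => -[/IH//|[w /IH[m wu] wv]]; exists (1 + m)%N.
by apply: netball_trans wu; apply: netball_step (Gsym _ _ wv); exact: netball_root.
Qed.

End connectivity.

Section flow_theory.
Variables (S : choiceType) (X : Type) (h : S * X -> S).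
Implicit Types (e : int -> X) (v : int * S) (lo hi s t r : int).

Lemma iter_fplus1 e k v : (iter k (fplus h e) v).1 = v.1 + k%:Z.
Proof. by elim: k => [|k IH] /=; [lia|rewrite IH; lia]. Qed.

Lemma iter_fplus e k v : iter k (fplus h e) v = (v.1 + k%:Z, flow h e v (v.1 + k%:Z)).
Proof.
rewrite /flow (_ : `|_|%N = k); last lia.
by rewrite -(iter_fplus1 e) -surjective_pairing.
Qed.

Lemma flow_root e t x : flow h e (t, x) t = x.
Proof. by rewrite /flow /= subrr. Qed.

Lemma flow_addn e v k s : s = v.1 + k%:Z -> flow h e v s = (iter k (fplus h e) v).2.
Proof. by move=> ->; rewrite iter_fplus. Qed.

Lemma flowS e v s : v.1 <= s -> flow h e v (s + 1) = h (flow h e v s, e s).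
Proof.
move=> vs; rewrite (@flow_addn e v `|s - v.1|.+1); last lia.
rewrite iterS iter_fplus /fplus /=.
by rewrite (_ : v.1 + _ = s)//; lia.
Qed.

Lemma flow_trans e v r s : v.1 <= r <= s ->
  flow h e (r, flow h e v r) s = flow h e v s.
Proof.
move=> /andP[vr rs]; rewrite (@flow_addn e v (`|s - r|%N + `|r - v.1|%N)%N s); last lia.
rewrite iterD (iter_fplus _ `|r - v.1|%N) (_ : v.1 + `|r - v.1|%N%:Z = r); last lia.
by rewrite (@flow_addn e _ `|s - r|%N)//=; lia.
Qed.

Lemma flow_shift e t x s : t <= s ->
  flow h (Defs.shift e) (t, x) s = flow h e (t + 1, x) (s + 1).
Proof.
move=> ts; rewrite (_ : s = t + `|s - t|%N%:Z); last lia.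
elim: `|s - t|%N => [|k IH]; first by rewrite !addr0 !flow_root.
rewrite (_ : t + k.+1%:Z = t + k%:Z + 1); last lia.
rewrite flowS/=; last lia.
by rewrite IH [RHS]flowS//=; lia.
Qed.

Lemma flow_iter_shift e k t x s : t <= s ->
  flow h (iter k (@Defs.shift X) e) (t, x) s = flow h e (t + k%:Z, x) (s + k%:Z).
Proof.
elim: k t s => [|k IH] t s ts; first by rewrite !addr0.
rewrite iterS flow_shift// IH ?lerD2r// -!addrA.
by rewrite (_ : 1 + k%:Z = k.+1%:Z)//; lia.
Qed.

Variable xstar : S.
Notation bridge e := (bridge h e xstar).
Notation window e := (bridge_window h e xstar).

Lemma bridgeP e v : bridge e v <-> exists2 t, t <= v.1 & flow h e (t, xstar) v.1 = v.2.
Proof.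
split=> [[t _ [s ts <-]]|[t tv vE]]; first by exists t.
by exists t => //; exists v.1 => //=; rewrite vE -surjective_pairing.
Qed.

Lemma windowP e lo hi v : window e lo hi v <-> exists t,
  [/\ lo <= t, t <= v.1, v.1 <= hi & flow h e (t, xstar) v.1 = v.2].
Proof.
split=> [[t /= /andP[lt th] [s /= /andP[ts sh] <-]]|[t [lt tv vh vE]]].
  by exists t; split.
exists t => /=; first by rewrite lt/=; lia.
by exists v.1 => /=; [rewrite tv|rewrite vE -surjective_pairing].
Qed.

Lemma window_bridge e lo hi : window e lo hi `<=` bridge e.
Proof. by move=> v /windowP[t [_ tv _ vE]]; apply/bridgeP; exists t. Qed.

Lemma bridge_star e t : bridge e (t, xstar).
Proof. by apply/bridgeP; exists t => //=; rewrite flow_root. Qed.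

Lemma window_star e lo hi t : lo <= t <= hi -> window e lo hi (t, xstar).
Proof. by move=> /andP[lt th]; apply/windowP; exists t; split=> //=; rewrite flow_root. Qed.

Lemma bridge_fplus e v : bridge e v -> bridge e (fplus h e v).
Proof.
move=> /bridgeP[t tv vE]; apply/bridgeP; exists t => /=; first lia.
by rewrite flowS//= vE.
Qed.

Lemma bridge_shift e s y : bridge (Defs.shift e) (s, y) <-> bridge e (s + 1, y).
Proof.
rewrite !bridgeP /=; split=> -[t ts tE].
  by exists (t + 1); [lia|rewrite -flow_shift].
exists (t - 1); first lia.
by rewrite flow_shift; [rewrite (_ : t - 1 + 1 = t)//; lia|lia].
Qed.

Lemma finite_int_itv (lo hi : int) : finite_set [set t | lo <= t <= hi].
Proof.
apply: (@sub_finite_set _ _ ((fun k : nat => lo + k%:Z) @` `I_(`|hi - lo|%N.+1))).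
  by move=> t /= /andP[lt th]; exists (`|t - lo|%N) => /=; lia.
exact: finite_image.
Qed.

Lemma window_finite e lo hi : finite_set (window e lo hi).
Proof.
apply: bigcup_finite; first exact: finite_int_itv.
move=> t _; apply: finite_image.
by apply: (@sub_finite_set _ _ _ _ (finite_int_itv t hi)).
Qed.

(* Finitely many starting times exhaust [B_0], hence every later level. *)
Lemma bridge_window_ge0 e : finite_set (bridge_states h e xstar 0) ->
  exists K : nat, forall lo hi v, lo <= - K%:Z -> 0 <= v.1 <= hi -> bridge e v ->
    window e lo hi v.
Proof.
move=> /finite_seqP[ys ysE].
have /choice[f fP] : forall y, exists t : int, y \in ys ->
    t <= 0 /\ flow h e (t, xstar) 0 = y.
  move=> y; have [yys|] := boolP (y \in ys); last by exists 0.
  have : bridge_states h e xstar 0 y by rewrite ysE.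
  by move=> /bridgeP[t t0 tE]; exists t.
exists (\max_(y <- ys) `|f y|)%N => lo hi v loK /andP[v0 vhi] /bridgeP[t tv vE].
apply/windowP; have [t0|t0] := leP 0 t; first by exists t; split=> //; lia.
pose y := flow h e (t, xstar) 0.
have yys : y \in ys.
  have : bridge_states h e xstar 0 y by apply/bridgeP; exists t => //=; lia.
  by rewrite ysE.
have [fy0 fyE] := fP _ yys; exists (f y); split=> //; last 2 first.
- lia.
- by rewrite -(@flow_trans _ _ 0) ?fyE/= ?fy0// /y flow_trans//=; lia.
have : (`|f y| <= \max_(y <- ys) `|f y|)%N by apply: leq_bigmax_seq.
by lia.
Qed.

(* Each point of [B_0] is reached by the path from the last visit to [xstar]. *)
Lemma bridge_states_last_visit e : bridge_states h e xstar 0 `<=`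
  (fun k : nat => flow h e (- k%:Z, xstar) 0) @`
    [set k : nat | forall s, - k%:Z < s <= 0 -> flow h e (- k%:Z, xstar) s <> xstar].
Proof.
move=> y /bridgeP[t /= t0 tE].
have [k kE] : exists k : nat, t = - k%:Z by exists `|t|%N; lia.
elim/ltn_ind: k t t0 tE kE => k IH t t0 tE kE.
have [nr|] := pselect (forall s, - k%:Z < s <= 0 -> flow h e (- k%:Z, xstar) s <> xstar).
  by exists k => //=; rewrite -kE.
move/existsNP => [s /not_implyP[/andP[ks s0] /contrapT sE]].
apply: (IH `|s|%N _ s) => //; [lia| |lia].
by rewrite -tE -{1}sE kE flow_trans//=; apply/andP; split; lia.
Qed.

Variables (M : Type) (iv : S * X -> M) (ie : bool -> M).
Notation SB e := (spined_bridge h e xstar iv ie).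
Notation SW e := (spined_window h e xstar iv ie).

Lemma spined_arc_bridge e v w : spined_arc h e xstar v w -> bridge e v /\ bridge e w.
Proof.
case=> [[bv ->]|[t [-> ->]]]; first by split=> //; exact: bridge_fplus.
by split; exact: bridge_star.
Qed.

Lemma spined_arc_time e v w : spined_arc h e xstar v w -> w.1 = v.1 + 1.
Proof. by case=> [[bv ->]|[t [-> ->]]]. Qed.

Lemma spined_bridge_adj e v w : adj (SB e) v w -> bridge e v /\ bridge e w.
Proof. by case=> /spined_arc_bridge[]. Qed.

Lemma spined_bridge_sym e v w : adj (SB e) v w -> adj (SB e) w v.
Proof. by case; [right|left]. Qed.

Lemma spined_bridge_time e v w n : netball (SB e) v n w ->
  v.1 - n%:Z <= w.1 <= v.1 + n%:Z.
Proof.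
elim: n w => [w ->|n IH w]; first by lia.
by rewrite netballS => -[/IH|[u /IH + [/spined_arc_time|/spined_arc_time]]]; lia.
Qed.

(* Every vertex is joined to the spine, and the spine is connected. *)
Lemma spine_connected (G : network (int * S) M) e (I : set int) :
  (forall v w, adj G v w -> adj G w v) ->
  (forall v, vertices G v -> exists2 t, I t &
     [/\ t <= v.1, flow h e (t, xstar) v.1 = v.2 & forall s, t <= s -> s < v.1 ->
       adj G (s, flow h e (t, xstar) s) (s + 1, flow h e (t, xstar) (s + 1))]) ->
  (forall t t' s, I t -> I t' -> t <= s -> s < t' -> adj G (s, xstar) (s + 1, xstar)) ->
  forall v w, vertices G v -> vertices G w -> exists n, netball G v n w.
Proof.
move=> Gsym Gv GI.
have star v : vertices G v -> exists2 t, I t & exists n, netball G (t, xstar) n v.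
  move=> /Gv[t It [tv vE vadj]]; exists t => //.
  have : forall k : nat, t + k%:Z <= v.1 ->
      netball G (t, xstar) k (t + k%:Z, flow h e (t, xstar) (t + k%:Z)).
    elim=> [_|k IH kv]; first by rewrite addr0 flow_root.
    rewrite (_ : t + k.+1%:Z = t + k%:Z + 1); last lia.
    by apply: netball_step (IH _) (vadj _ _ _); lia.
  move=> /(_ `|v.1 - t|%N); rewrite (_ : t + _ = v.1); last lia.
  by rewrite lexx vE -surjective_pairing => /(_ isT); exists `|v.1 - t|%N.
have spine t t' : I t -> I t' -> t <= t' -> exists n, netball G (t, xstar) n (t', xstar).
  move=> It It' tt'; exists `|t' - t|%N.
  have : forall k : nat, t + k%:Z <= t' -> netball G (t, xstar) k (t + k%:Z, xstar).
    elim=> [_|k IH kv]; first by rewrite addr0.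
    rewrite (_ : t + k.+1%:Z = t + k%:Z + 1); last lia.
    by apply: netball_step (IH _) (GI _ _ _ It It' _ _); lia.
  move=> /(_ `|t' - t|%N); rewrite (_ : t + _ = t'); last lia.
  by rewrite lexx; apply.
move=> v w /star[t It [n tv]] /star[t' It' [m tw]].
have [n' vt] := netball_sym Gsym tv.
have [l tt'] : exists l, netball G (t, xstar) l (t', xstar).
  have [/spine|/ltW/spine] := leP t t'; first by apply.
  by move=> /(_ It' It)[l /(netball_sym Gsym)].
by exists (n' + l + m)%N; apply: netball_trans tw; exact: netball_trans tt'.
Qed.

Lemma spined_bridge_networkP e v : bridge e v ->
  (forall u, bridge e u -> finite_set [set w | adj (SB e) u w]) ->
  is_rooted_network (SB e, v).
Proof.
move=> bv locfin; split=> //; split=> //=.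
- by exists v.
- by move=> u w /spined_bridge_adj[].
- exact: spined_bridge_sym.
- by move=> u; case=> /spined_arc_time; lia.
- apply: (@spine_connected (SB e) e setT) => //.
  + exact: spined_bridge_sym.
  + move=> u /bridgeP[t tu uE]; exists t => //; split=> // s ts su.
    left; left; split; first by apply/bridgeP; exists t.
    by rewrite /fplus/= flowS.
  + by move=> t t' s _ _ _ _; left; right; exists s.
Qed.

Lemma spined_bridge_locfin e : (forall s, finite_set (bridge_states h e xstar s)) ->
  forall u, finite_set [set w | adj (SB e) u w].
Proof.
move=> fin u.
apply: (@sub_finite_set _ _ ([set fplus h e u; (u.1 + 1, xstar)] `|`
  (pair (u.1 - 1)) @` bridge_states h e xstar (u.1 - 1))).
  move=> w /= [[[_ ->]|[t [-> ->]]]|a]; [by left; left|by left; right|].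
  right; have [bw _] := spined_arc_bridge a; have -> : u.1 - 1 = w.1.
    by have := spined_arc_time a; lia.
  by exists w.2; [rewrite /bridge_states/= -surjective_pairing|rewrite -surjective_pairing].
rewrite finite_setU; split; first by rewrite finite_setU; split; exact: finite_set1.
exact: finite_image.
Qed.

Lemma spined_bridge_network e v : bridge e v ->
  (forall s, finite_set (bridge_states h e xstar s)) -> is_rooted_network (SB e, v).
Proof. by move=> bv fin; apply: spined_bridge_networkP => // u _; exact: spined_bridge_locfin. Qed.

Lemma spined_window_network e lo hi v : window e lo hi v ->
  is_rooted_network (SW e lo hi, v).
Proof.
move=> bv; have Wv : vertices (SW e lo hi) v by split=> //; exact: window_bridge bv.
split=> //; split=> //=.
- by exists v.
- by move=> u w [Wu _ _]; split=> //; exact: window_bridge Wu.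
- by move=> u w [Wu Ww uw]; split=> //; exact: spined_bridge_sym.
- by move=> u [_ _ []] /spined_arc_time; lia.
- move=> u _; apply: (@sub_finite_set _ _ _ _ (window_finite e lo hi)).
  by move=> w [].
- apply: (@spine_connected (SW e lo hi) e [set t | lo <= t <= hi]).
  + by move=> u w [Wu Ww uw]; split=> //; exact: spined_bridge_sym.
  + move=> u [_ /windowP[t [lt tu uh uE]]]; exists t => /=; first lia.
    split=> // s ts su; split.
    * by apply/windowP; exists t; split=> //=; lia.
    * by apply/windowP; exists t; split=> //=; lia.
    left; left; split; first by apply/bridgeP; exists t.
    by rewrite /fplus/= flowS.
  + move=> t t' s /= It It' ts st'; split; try by apply: window_star; lia.
    by left; right; exists s.
Qed.

Definition time_shift v : int * S := (v.1 + 1, v.2).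

Lemma spined_arc_shift e v w : spined_arc h (Defs.shift e) xstar v w <->
  spined_arc h e xstar (time_shift v) (time_shift w).
Proof.
case: v w => [s y] [s' y']; rewrite /spined_arc /time_shift /=.
split=> [[[/bridge_shift bv [-> ->]]|[t [[-> ->] [-> ->]]]]|].
- by left.
- by right; exists (t + 1).
case=> [[bv [s'E y'E]]|[t [[st ->] [s't ->]]]]; [left|right].
  by split; [exact/bridge_shift|rewrite /fplus /= y'E; congr pair; lia].
by exists s; split=> //; congr pair; lia.
Qed.

Lemma spined_bridge_shift e v : rooted_iso eq (SB (Defs.shift e), v) (SB e, time_shift v).
Proof.
exists time_shift; split => //=.
- split=> [[s y] /bridge_shift//|[s y] [s' y'] _ _ [ss' ->]|[s y] bv].
    by congr pair; lia.
  exists (s - 1, y); last by rewrite /time_shift/=; congr pair; lia.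
  by apply/bridge_shift; rewrite (_ : s - 1 + 1 = s)//; lia.
- by move=> v' w' _ _; rewrite !spined_arc_shift.
- move=> v' w' _ _ _; congr ie; apply: asbool_equiv_eq; exact: spined_arc_shift.
Qed.

Lemma bridge_iter_shift e k s y :
  bridge (iter k (@Defs.shift X) e) (s, y) <-> bridge e (s + k%:Z, y).
Proof.
elim: k s => [|k IH] s; first by rewrite addr0.
rewrite iterS bridge_shift IH (_ : s + 1 + k%:Z = s + k.+1%:Z)//; lia.
Qed.

Lemma spined_bridge_iter_shift e k v :
  rooted_iso eq (SB (iter k (@Defs.shift X) e), v) (SB e, (v.1 + k%:Z, v.2)).
Proof.
elim: k v => [|k IH] v.
  by rewrite addr0 -surjective_pairing; exact: rooted_iso_refl.
rewrite iterS; apply: rooted_iso_eq_trans (spined_bridge_shift _ _) _.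
by have := IH (time_shift v); rewrite /= (_ : v.1 + 1 + k%:Z = v.1 + k.+1%:Z)//; lia.
Qed.

Lemma spined_window_rball e lo hi v (N : nat) : N%:Z <= v.1 <= hi - N%:Z ->
  (forall w, 0 <= w.1 <= hi -> bridge e w -> window e lo hi w) -> bridge e v ->
  rooted_iso eq (rball (SW e lo hi, v) N) (rball (SB e, v) N).
Proof.
move=> vN full bv; apply: rball_induced => w wN.
have whi : 0 <= w.1 <= hi.
  move: vN (spined_bridge_time wN) {full} => /andP[? ?] /andP[? ?]; lia.
apply: full => //.
have SBc : adj_closed (SB e, v) by split=> // u u'; exact: spined_bridge_adj.
exact: (netball_vertices SBc wN).
Qed.

End flow_theory.

Definition path_gen (X : ptopologicalType) : set (set (int -> X)) :=
  \bigcup_t preimage_set_system setT (fun e : int -> X => e t)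
    (@measurable _ (borel X)).

Definition traj (X : ptopologicalType) := g_sigma_algebraType (@path_gen X).
HB.instance Definition _ (X : ptopologicalType) := Measurable.on (traj X).

Section path_space.
Context (X : ptopologicalType).

Lemma measurable_coord (t : int) : measurable_fun setT (fun e : traj X => e t : borel X).
Proof.
move=> _ A mA; rewrite setTI; apply: sub_sigma_algebra.
by exists t => //; exists A => //; rewrite setTI.
Qed.

Lemma measurable_path (d : measure_display) (T : measurableType d) (f : T -> traj X) :
  (forall t, measurable_fun setT (fun w => f w t : borel X)) -> measurable_fun setT f.
Proof.
move=> mf; apply: (@measurability _ _ T (traj X) setT f (@path_gen X)) => //.
move=> _ [_ [t _ [A mA <-]] <-].
have := mf t measurableT _ mA; rewrite !setTI; exact.
Qed.

Lemma measurable_shift : measurable_fun setT (@Defs.shift X : traj X -> traj X).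
Proof. by apply: measurable_path => t; exact: measurable_coord. Qed.

End path_space.

Section network_valued.
Context (V : Type) (M : ptopologicalType).

Lemma measurable_networkM (d : measure_display) (T : measurableType d)
    (G : T -> networkM V M) :
  (forall v, measurable [set w | vertices (G w) v]) ->
  (forall v u, measurable [set w | adj (G w) v u]) ->
  (forall v (A : set (borel M)), measurable A ->
     measurable [set w | vertices (G w) v /\ A (vmark (G w) v)]) ->
  (forall v u (A : set (borel M)), measurable A ->
     measurable [set w | adj (G w) v u /\ A (emark (G w) v u)]) ->
  measurable_fun setT G.
Proof.
move=> mv ma mvm mem; apply: (@measurability _ _ T (networkM V M) setT G (@network_gen V M)) => //.
move=> _ [E [[v ->]|[v [w ->]]|[v [A [mA ->]]]|[v [w [A [mA ->]]]]] <-]; rewrite setTI.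
- exact: mv.
- exact: ma.
- exact: mvm.
- exact: mem.
Qed.

End network_valued.

Section bridge_events.
Context (R : realType) (X : ptopologicalType) (dS : measure_display) (S : measurableType dS).
Hypothesis S_countable : countable [set: S].
Hypothesis S_discrete : forall A : set S, measurable A.
Variables (h : S * borel X -> S) (xstar : S).
Hypothesis h_measurable : measurable_fun setT h.

Lemma countable_int_prod : countable [set: int * S].
Proof.
have /countable_injP[f finj] := S_countable.
apply/countable_injP; exists (fun v : int * S => @choice.pickle (int * nat)%type (v.1, f v.2)).
move=> [s y] [s' y'] _ _ /(pcan_inj choice.pickleK)[-> /finj -> //]; by rewrite inE.
Qed.

Lemma measurable_sectionP (T : Type) (f : S * borel X -> T) (y : S)
    (B : set T) : measurable (f @^-1` B) ->
  forall t, measurable [set e : traj X | B (f (y, e t))].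
Proof.
move=> mB t.
have mp : measurable_fun setT (fun e : traj X => (y, e t : borel X)).
  by apply/measurable_fun_pairP; split; [exact: measurable_cst|exact: measurable_coord].
by have := mp measurableT _ mB; rewrite setTI.
Qed.

Lemma measurable_h y z t : measurable [set e : traj X | h (y, e t) = z].
Proof.
apply: (@measurable_sectionP _ h y [set z]).
by have := h_measurable measurableT (S_discrete [set z]); rewrite setTI.
Qed.

Lemma measurable_flow (t s : int) x y : t <= s ->
  measurable [set e : traj X | flow h e (t, x) s = y].
Proof.
move=> ts; rewrite (_ : s = t + `|s - t|%N%:Z); last lia.
elim: `|s - t|%N y => [|k IH] y.
  by under eq_set => e do rewrite addr0 flow_root; exact: measurable_pred_cst.
rewrite (_ : t + k.+1%:Z = t + k%:Z + 1); last lia.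
rewrite (_ : mkset _ = [set e : traj X | exists2 z, flow h e (t, x) (t + k%:Z) = z &
    h (z, e (t + k%:Z)) = y]).
  by apply: measurable_pred_exists2 => // z; exact: measurable_h.
apply/seteqP; split => e /=; first by rewrite flowS/=; [exists (flow h e (t, x) (t + k%:Z))|lia].
by move=> [z <-]; rewrite flowS//=; lia.
Qed.

Lemma measurable_bridge v : measurable [set e : traj X | bridge h e xstar v].
Proof.
rewrite (_ : mkset _ = [set e : traj X | exists2 t, t <= v.1 & flow h e (t, xstar) v.1 = v.2]).
  rewrite (_ : mkset _ = [set e : traj X | exists t : int, t <= v.1 /\ flow h e (t, xstar) v.1 = v.2]).
    apply: measurable_pred_exists; first exact: countableP.
    move=> t; have [tv|tv] := boolP (t <= v.1).
      apply: measurable_pred_and; first exact: measurable_pred_cst.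
      exact: measurable_flow.
    rewrite (_ : mkset _ = set0)//; by apply/seteqP; split => e //= [].
  by apply/seteqP; split => e /= [t]; [exists t|move=> []; exists t].
by apply/seteqP; split => e /= /bridgeP.
Qed.

Lemma measurable_window lo hi v :
  measurable [set e : traj X | bridge_window h e xstar lo hi v].
Proof.
rewrite (_ : mkset _ = [set e : traj X | exists t,
  (lo <= t /\ t <= v.1 /\ v.1 <= hi) /\ (t <= v.1 -> flow h e (t, xstar) v.1 = v.2)]).
  apply: measurable_pred_exists; first exact: countableP.
  move=> t; apply: measurable_pred_and; first exact: measurable_pred_cst.
  have [tv|tv] := boolP (t <= v.1).
    by apply: measurable_pred_imp; [exact: measurable_pred_cst|exact: measurable_flow].
  by rewrite (_ : mkset _ = setT)//; apply/seteqP; split.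
apply/seteqP; split => e /=.
  by move=> /windowP[t [lt tv vh vE]]; exists t.
by move=> [t [[lt [tv vh]] vE]]; apply/windowP; exists t; split=> //; exact: vE.
Qed.

Context (M : ptopologicalType) (iv : S * borel X -> borel M) (ie : bool -> M).
Hypothesis iv_measurable : measurable_fun setT iv.

Notation SB e := (spined_bridge h e xstar (iv : S * borel X -> M) ie).
Notation SW e := (spined_window h e xstar (iv : S * borel X -> M) ie).

Lemma measurable_fplus v w : measurable [set e : traj X | w = fplus h e v].
Proof.
rewrite (_ : mkset _ = [set e : traj X | w.1 = v.1 + 1 /\ h (v.2, e v.1) = w.2]).
  by apply: measurable_pred_and; [exact: measurable_pred_cst|exact: measurable_h].
apply/seteqP; split => e /=; first by move=> ->.
by case: w => s y /= [-> <-].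
Qed.

Lemma measurable_spined_arc v w : measurable [set e : traj X | spined_arc h e xstar v w].
Proof.
apply: measurable_pred_or; last exact: measurable_pred_cst.
by apply: measurable_pred_and; [exact: measurable_bridge|exact: measurable_fplus].
Qed.

Lemma measurable_spined_adj v w : measurable [set e : traj X | adj (SB e) v w].
Proof. by apply: measurable_pred_or; exact: measurable_spined_arc. Qed.

Lemma measurable_iv v (A : set (borel M)) : measurable A ->
  measurable [set e : traj X | A (vmark (SB e) v)].
Proof.
move=> mA; apply: (@measurable_sectionP _ iv v.2 A).
by have := iv_measurable measurableT mA; rewrite setTI.
Qed.

Lemma measurable_ie v w (A : set (borel M)) :
  measurable [set e : traj X | A (emark (SB e) v w)].
Proof.
rewrite (_ : mkset _ = [set e : traj X | (spined_arc h e xstar v w /\ A (ie true)) \/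
   (~ spined_arc h e xstar v w /\ A (ie false))]).
  have ma := measurable_spined_arc v w.
  apply: measurable_pred_or; apply: measurable_pred_and => //; try exact: measurable_pred_cst.
  exact: measurable_pred_not.
apply/seteqP; split => e /=.
  by case: asboolP => a; [left|right].
by case=> -[a]; [rewrite asboolT|rewrite asboolF].
Qed.

Lemma measurable_spined_bridge :
  measurable_fun setT (fun e : traj X => SB e : networkM (int * S) M).
Proof.
apply: measurable_networkM => /=.
- exact: measurable_bridge.
- exact: measurable_spined_adj.
- move=> v A mA; apply: measurable_pred_and; [exact: measurable_bridge|exact: measurable_iv].
- move=> v u A mA; apply: measurable_pred_and; [exact: measurable_spined_adj|exact: measurable_ie].
Qed.

Lemma measurable_spined_window lo hi :
  measurable_fun setT (fun e : traj X => SW e lo hi : networkM (int * S) M).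
Proof.
have mv v : measurable [set e : traj X | vertices (SW e lo hi) v].
  by apply: measurable_pred_and; [exact: measurable_bridge|exact: measurable_window].
have ma v w : measurable [set e : traj X | adj (SW e lo hi) v w].
  rewrite (_ : mkset _ = [set e : traj X | (bridge_window h e xstar lo hi v /\
    bridge_window h e xstar lo hi w) /\ adj (SB e) v w]).
    apply: measurable_pred_and; last exact: measurable_spined_adj.
    by apply: measurable_pred_and; exact: measurable_window.
  by apply/seteqP; split => e /=; [case|move=> [[]]].
apply: measurable_networkM => //.
- by move=> v A mA; apply: measurable_pred_and => //; exact: measurable_iv.
- by move=> v u A mA; apply: measurable_pred_and => //; exact: measurable_ie.
Qed.

Lemma measurable_spined_bridge_network v :
  measurable [set e : traj X | is_rooted_network (SB e, v)].
Proof.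
have Vc := countable_int_prod; have /countable_injP[enc encI] := Vc.
have enc_inj : injective enc by move=> a b; apply: encI; rewrite inE.
rewrite (_ : mkset _ = [set e : traj X | bridge h e xstar v /\ forall u, bridge h e xstar u ->
   exists l : seq nat, forall w, adj (SB e) u w -> enc w \in l]).
  apply: measurable_pred_and; first exact: measurable_bridge.
  apply: measurable_pred_forall => // u; apply: measurable_pred_imp; first exact: measurable_bridge.
  apply: measurable_pred_exists => // l; apply: measurable_pred_forall => // w.
  apply: measurable_pred_imp; first exact: measurable_spined_adj.
  exact: measurable_pred_cst.
apply/seteqP; split => e /=.
  move=> [eN ev]; split=> // u bu.
  have /finite_seqP[s sE] := network_locfin eN bu.
  exists (map enc s) => w uw; apply: map_f.
  by have : [set w | adj (SB e) u w] w by []; rewrite sE.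
move=> [bv fin]; apply: spined_bridge_networkP => // u bu.
have [l lP] := fin _ bu.
apply: (@sub_finite_set _ _ (enc @^-1` [set` l])); first by move=> w /lP.
by apply: finite_preimage; [move=> a b _ _ /enc_inj|exact: finite_seq].
Qed.

End bridge_events.

Section countable_sums.
Context (R : realType) (S : choiceType) (x0 : S).
Hypothesis S_countable : countable [set: S].

Lemma countable_enum : exists (I : set nat) (dec : nat -> S), set_bij I [set: S] dec.
Proof.
have /countable_injP[f finj] := S_countable.
pose dec i := xget x0 [set y | f y = i].
have decK y : dec (f y) = y.
  rewrite /dec; case: xgetP => [z _ /= fzy|/(_ y)[]//].
  by apply: finj; rewrite ?inE.
exists (range f), dec; split=> //.
- by move=> _ _ /set_mem[y _ <-] /set_mem[z _ <-]; rewrite !decK => ->.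
- by move=> y _; exists (f y).
Qed.

Lemma measurable_esum (d : measure_display) (T : measurableType d)
    (f : S -> T -> \bar R) :
  (forall y x, 0 <= f y x)%E -> (forall y, measurable_fun setT (f y)) ->
  measurable_fun setT (fun x => \esum_(y in [set: S]) f y x)%E.
Proof.
move=> f0 mf; have [I [dec decb]] := countable_enum.
rewrite (_ : (fun x => _) = (fun x => \sum_(i <oo | i \in I) f (dec i) x)%E).
  by apply: ge0_emeasurable_sum.
apply/funext => x; rewrite (reindex_esum I _ dec)// nneseries_esum//.
by rewrite set_mem_set.
Qed.

Lemma integral_esum (d : measure_display) (T : measurableType d)
    (mu : {measure set T -> \bar R}) (f : S -> T -> \bar R) :
  (forall y x, 0 <= f y x)%E -> (forall y, measurable_fun setT (f y)) ->
  (\int[mu]_x (\esum_(y in [set: S]) f y x) = \esum_(y in [set: S]) \int[mu]_x f y x)%E.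
Proof.
move=> f0 mf; have [I [dec decb]] := countable_enum.
pose F i := if i \in I then f (dec i) else cst 0%E.
rewrite (reindex_esum I _ dec)//.
rewrite -(set_mem_set I) -nneseries_esum; last by move=> n _; exact: integral_ge0.
transitivity (\int[mu]_x \sum_(i <oo) F i x)%E.
  apply: eq_integral => x _; rewrite (reindex_esum I _ dec)//.
  rewrite -{1}(set_mem_set I) -nneseries_esum// [LHS]eseries_mkcond.
  by apply: eq_eseriesr => i _; rewrite /F; case: ifP.
rewrite integral_nneseries//; last 2 first.
- by rewrite /F => n; case: ifP => // _; exact: measurable_cst.
- by rewrite /F => n x _; case: ifP.
rewrite [RHS]eseries_mkcond; apply: eq_eseriesr => i _; rewrite /F; case: ifP => //= _.
by rewrite integral0.
Qed.

Lemma esum1_lty_finite (A : set S) : (\esum_(y in A) (1 : \bar R) < +oo)%E -> finite_set A.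
Proof.
move=> Aoo; apply: contrapT => /infinite_set_fset Ainf.
suff : (\esum_(y in A) (1 : \bar R) = +oo)%E by move=> E; rewrite E in Aoo.
apply/eqyP => r r0; have [B BA Bn] := Ainf (Num.truncn r).+1.
apply: esum_ge; exists [set` B]; first by split=> //; exact: finite_fset.
rewrite fsbig_finite//= set_fsetK sumEFin lee_fin.
have <- : #|` B|%:R = \sum_(i <- B) (1 : R) by rewrite card_fset_sum1 natr_sum.
by rewrite (le_trans (ltW (truncnS_gt r)))// ler_nat.
Qed.

Lemma finite_esum1 (A : set S) : finite_set A ->
  (\esum_(y in A) (1 : \bar R) = (#|` fset_set A|%:R)%:E)%E.
Proof.
move=> fA; rewrite esum_fset// fsbig_finite//= sumEFin.
by rewrite card_fset_sum1 natr_sum.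
Qed.

Lemma esum1_image_le (T : choiceType) (A : set T) (f : T -> S) :
  (\esum_(y in f @` A) (1 : \bar R) <= \esum_(x in A) 1)%E.
Proof.
have [->|/set0P[a Aa]] := eqVneq A set0; first by rewrite image_set0 !esum_set0.
have /choice[g gP] : forall y, exists x, (f @` A) y -> A x /\ f x = y.
  move=> y; have [[x Ax <-]|ny] := pselect ((f @` A) y); first by exists x.
  by exists a.
have ginj : set_inj (f @` A) g.
  by move=> y z /set_mem/gP[_ ey] /set_mem/gP[_ ez] E; rewrite -ey E ez.
rewrite -(@esum_image _ _ _ _ g (fun=> 1%E))// esum_mkcond [leRHS]esum_mkcond.
apply: le_esum => x _; case: ifPn => [/set_mem[y /gP[Agy _] <-]|_].
  by rewrite mem_set.
by case: ifP.
Qed.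

End countable_sums.

(** * Sums over a level of the bridge *)

Section level_sums.
Context (R : realType) (X : ptopologicalType) (dS : measure_display) (S : measurableType dS).
Hypothesis S_countable : countable [set: S].
Hypothesis S_discrete : forall A : set S, measurable A.
Variables (h : S * borel X -> S) (xstar : S).
Hypothesis h_measurable : measurable_fun setT h.
Context (M : completeMetricType R) (iv : S * borel X -> borel M) (ie : bool -> M).
Hypothesis iv_measurable : measurable_fun setT iv.

Notation SB e := (spined_bridge h e xstar (iv : S * borel X -> M) ie).
Notation SW e := (spined_window h e xstar (iv : S * borel X -> M) ie).

Lemma enc_injective : exists enc : int * S -> nat, injective enc.
Proof.
have /countable_injP[enc encI] := countable_int_prod S_countable.
by exists enc => a b; apply: encI; rewrite inE.
Qed.

Lemma repr_netclass (X' : rooted (int * S) M) : is_rooted_network X' ->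
  rooted_iso eq (repr (netclass X' : Gstar M) : natnet M) X'.
Proof. by move=> Xn; have [enc enc_inj] := enc_injective; exact: (netclassP enc_inj Xn). Qed.

Definition net_measurable_fun (g : Gstar M -> R) :=
  forall B : set R, measurable B -> net_measurable (int * S) (g @^-1` B).

Lemma measurable_netclass (d : measure_display) (T : measurableType d)
    (G : T -> networkM (int * S) M) (v : int * S) (D : set T) (g : Gstar M -> R) :
  measurable_fun setT G -> (D `<=` [set w | is_rooted_network (G w, v)]) ->
  net_measurable_fun g -> measurable_fun D (fun w => g (netclass (G w, v))).
Proof.
move=> mG DG mg mD B mB; have [E mE EP] := mg B mB v.
rewrite (_ : _ `&` _ = D `&` G @^-1` E).
  by apply: measurableI => //; rewrite -[_ @^-1` _]setTI; exact: mG.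
apply/seteqP; split => w /= [Dw]; first by move=> ?; split=> //; apply/(EP _ (DG _ Dw)).
by move=> ?; split=> //; apply/(EP _ (DG _ Dw)).
Qed.

Lemma netclass_not_network e v : bridge h e xstar v ->
  ~ is_rooted_network (SB e, v) -> netclass (SB e, v) = point :> Gstar M.
Proof.
move=> bv nN; apply: netclass_point => -[c cB]; apply: nN.
apply: spined_bridge_networkP => // u bu.
have [cN _] := repr_rooted_network c.
case: cB => phi [[f1 f2 f3] fr fa fv fe].
have [x cx xu] := f3 _ bu.
apply: (@sub_finite_set _ _ (phi @` [set w | adj (natnet_val (repr c : natnet M)).1 x w])).
  move=> w uw; have [_ bw] := @spined_bridge_adj _ _ h xstar _ iv ie e u w uw.
  have [y cy yw] := f3 _ bw; exists y => //=.
  by apply/(fa _ _ cx cy); rewrite xu yw.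
by apply: finite_image; exact: network_locfin.
Qed.

Definition vertex_val (g : Gstar M -> R) (s : int) (y : S) (e : traj X) : R :=
  if `[< bridge h e xstar (s, y) >] then g (netclass (SB e, (s, y))) else 0.

Lemma measurable_vertex_val g s y : net_measurable_fun g ->
  measurable_fun setT (vertex_val g s y).
Proof.
move=> mg.
pose N := [set e : traj X | is_rooted_network (SB e, (s, y))].
pose B := [set e : traj X | bridge h e xstar (s, y)].
have mN : measurable N by exact: measurable_spined_bridge_network.
have mB : measurable B by exact: measurable_bridge.
rewrite (_ : vertex_val g s y = fun e => if `[< B e >] then
   (if `[< N e >] then g (netclass (SB e, (s, y))) else g point) else 0); last first.
  apply/funext => e; rewrite /vertex_val /B/=; case: asboolP => // be.
  by case: asboolP => // nN; rewrite netclass_not_network.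
have mas (A : set (traj X)) : measurable A -> measurable_fun setT (fun e => `[< A e >]).
  by move=> mA; apply: (@measurable_fun_bool _ _ _ _ true); rewrite setTI
    (_ : _ @^-1` _ = A)//; apply/seteqP; split => e /=; move/asboolP.
apply: measurable_fun_ifT; [exact: mas| |exact: measurable_cst].
apply: measurable_fun_if => //; first exact: mas.
  apply: measurable_netclass => //; first exact: measurable_spined_bridge.
  by move=> e [_ /asboolP].
Qed.

Definition level_sum (g : Gstar M -> R) (s : int) (e : traj X) : \bar R :=
  \esum_(y in [set: S]) (vertex_val g s y e)%:E.

Lemma level_sumE g s e : level_sum g s e =
  \esum_(y in bridge_states h e xstar s) (g (netclass (SB e, (s, y))))%:E.
Proof.
rewrite /level_sum [RHS]esum_mkcond; apply: eq_esum => y _.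
rewrite /vertex_val; case: ifPn => [/asboolP by'|/asboolP nb]; first by rewrite mem_set.
by rewrite memNset.
Qed.

Lemma vertex_val_ge0 g s y e : (forall c, 0 <= g c) -> 0 <= vertex_val g s y e.
Proof. by move=> g0; rewrite /vertex_val; case: ifP. Qed.

Lemma level_sum_ge0 g s e : (forall c, 0 <= g c) -> (0 <= level_sum g s e)%E.
Proof. by move=> g0; apply: esum_ge0 => y _; rewrite lee_fin vertex_val_ge0. Qed.

Lemma measurable_level_sum g s : net_measurable_fun g -> (forall c, 0 <= g c) ->
  measurable_fun setT (level_sum g s).
Proof.
move=> mg g0; apply: (measurable_esum point) => //.
- by move=> y e; rewrite lee_fin vertex_val_ge0.
- by move=> y; apply/measurable_EFinP; exact: measurable_vertex_val.
Qed.

Lemma vertex_val_iter_shift g k y e :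
  vertex_val g 0 y (iter k (@Defs.shift X) e) = vertex_val g k y e.
Proof.
have bE : bridge h (iter k (@Defs.shift X) e) xstar (0, y) <-> bridge h e xstar (k%:Z, y).
  by rewrite bridge_iter_shift add0r.
rewrite /vertex_val (asbool_equiv_eq bE); case: asboolP => // be; congr g.
have := spined_bridge_iter_shift h xstar iv ie e k (0, y); rewrite /= add0r.
by apply: netclass_eq; apply/bE.
Qed.

Lemma level_sum_iter_shift g k e :
  level_sum g 0 (iter k (@Defs.shift X) e) = level_sum g k e.
Proof. by apply: eq_esum => y _; rewrite vertex_val_iter_shift. Qed.

Lemma net_measurable_fun_cst (r : R) : net_measurable_fun (cst r).
Proof.
move=> B _ v; have [Br|nBr] := pselect (B r).
  by exists setT.
by exists set0.
Qed.

Lemma level_sum_finite g s e : finite_set (bridge_states h e xstar s) ->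
  (forall c, 0 <= g c) ->
  level_sum g s e =
  (\sum_(y \in bridge_states h e xstar s) g (netclass (SB e, (s, y))))%:E.
Proof.
move=> fin g0; rewrite level_sumE esum_fset//; last by move=> y _; rewrite lee_fin.
by rewrite -fsumEFin.
Qed.

Lemma level_sum1 s e : level_sum (cst 1) s e = \esum_(y in bridge_states h e xstar s) 1%E.
Proof. exact: level_sumE. Qed.

Lemma level_sum_le (g : Gstar M -> R) (C : R) s e : finite_set (bridge_states h e xstar s) ->
  (forall c, 0 <= g c) -> (forall c, g c <= C) ->
  (level_sum g s e <= C%:E * level_sum (cst 1%R) s e)%E.
Proof.
move=> fin g0 gC; rewrite !level_sum_finite// -EFinM lee_fin !fsbig_finite//=.
by rewrite mulr_sumr; apply: ler_sum => y _; rewrite mulr1.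
Qed.

End level_sums.

Lemma ge0_le_integralT (d : measure_display) (T : measurableType d) (R : realType)
    (mu : {measure set T -> \bar R}) (f g : T -> \bar R) :
  (forall x, 0 <= f x)%E -> (forall x, f x <= g x)%E ->
  (\int[mu]_x f x <= \int[mu]_x g x)%E.
Proof.
move=> f0 fg; have g0 x : (0 <= g x)%E by apply: le_trans (fg x).
rewrite !ge0_integralTE//; apply: le_ereal_sup => _ [u uf <-].
by exists u => // x; apply: le_trans (fg x).
Qed.

Section mean_level.
Context (R : realType) (X : ptopologicalType) (dS : measure_display) (S : measurableType dS).
Hypothesis S_countable : countable [set: S].
Hypothesis S_discrete : forall A : set S, measurable A.
Variables (h : S * borel X -> S) (xstar : S).
Hypothesis h_measurable : measurable_fun setT h.
Variable mu : probability (traj X) R.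
Hypothesis mu_inv : forall A : set (traj X), measurable A -> mu (@Defs.shift X @^-1` A) = mu A.

Lemma measurable_iter_shift k :
  measurable_fun setT (iter k (@Defs.shift X) : traj X -> traj X).
Proof.
elim: k => [|k IH]; first exact: measurable_id.
by apply: measurableT_comp IH; exact: measurable_shift.
Qed.

Lemma mu_iter_shift k (A : set (traj X)) : measurable A -> mu (iter k (@Defs.shift X) @^-1` A) = mu A.
Proof.
move=> mA; elim: k => [//|k IH].
rewrite -IH -(mu_inv (A := iter k (@Defs.shift X) @^-1` A)).
  by congr (mu _); apply/seteqP; split => e; rewrite /preimage/mkset iterSr.
by rewrite -[X in measurable X]setTI; exact: measurable_iter_shift.
Qed.

Definition no_return (t : int) (k : nat) : set (traj X) :=
  [set e | forall s, t < s <= t + k%:Z -> flow h e (t, xstar) s <> xstar].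

Lemma measurable_no_return t k : measurable (no_return t k).
Proof.
apply: measurable_pred_forall; first exact: countableP.
move=> s; have [ts|ts] := boolP (t < s <= t + k%:Z).
  apply: measurable_pred_imp; first exact: measurable_pred_cst.
  by apply: measurable_pred_not; apply: measurable_flow => //; lia.
by rewrite (_ : mkset _ = setT)//; apply/seteqP; split.
Qed.

Lemma mu_no_return k : mu (no_return (- k%:Z) k) = mu (no_return 0 k).
Proof.
rewrite -(@mu_iter_shift k (no_return _ k)); last exact: measurable_no_return.
congr (mu _); apply/seteqP; split => e /= nr s /andP[ks s0].
  have := nr (s - k%:Z); rewrite flow_iter_shift; last lia.
  by rewrite addNr subrK; apply; lia.
have := nr (s + k%:Z); rewrite flow_iter_shift; last lia.
by rewrite addNr; apply; lia.
Qed.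

Lemma sum_no_return_le_return_time e :
  (\sum_(k <oo) (\1_(no_return 0 k) e)%:E <= return_time h e R xstar)%E.
Proof.
apply: le_ereal_inf_tmp => _ [s [s0 sE] <-].
apply: lime_le; first by apply: is_cvg_nneseries => n _ _; rewrite lee_fin.
apply: nearW => n; rewrite sumEFin lee_fin.
apply: (@le_trans _ _ (\sum_(0 <= k < n) (k < `|s|)%N%:R)).
  apply: ler_sum => k _; rewrite indicE; have [ks|ks] := ltnP k `|s|%N.
    by case: (_ \in _).
  rewrite memNset// => nr; apply: (nr s) => //; lia.
rewrite (_ : \sum_(_ <= k < n) _ = (minn n `|s|)%:R).
  by rewrite (_ : s%:~R = `|s|%N%:R) ?ler_nat ?geq_minr// -[in LHS](gtz0_abs s0).
elim: n => [|n IH]; first by rewrite big_geq// min0n.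
by rewrite big_nat_recr//= IH -natrD; congr (_%:R); lia.
Qed.

Context (M : completeMetricType R) (iv : S * borel X -> borel M) (ie : bool -> M).
Hypothesis iv_measurable : measurable_fun setT iv.
Notation LS := (@level_sum R X dS S h xstar M iv ie).

Lemma level_sum1_le e :
  (LS (cst 1%R) 0 e <= \sum_(k <oo) (\1_(no_return (- k%:Z) k) e)%:E)%E.
Proof.
rewrite level_sum1 nneseries_esumT; last by move=> k; rewrite lee_fin.
pose K := [set k : nat | no_return (- k%:Z) k e].
apply: (@le_trans _ _ (\esum_(k in K) 1%E)).
  apply: le_trans (esum1_image_le R K (fun k : nat => flow h e (- k%:Z, xstar) 0)).
  rewrite esum_mkcond [leRHS]esum_mkcond; apply: le_esum => y _.
  case: ifPn => [/set_mem /bridge_states_last_visit[k nr <-]|_]; last by case: ifP.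
  rewrite mem_set//; exists k => // s /=.
  by rewrite addNr => /nr.
rewrite esum_mkcond; apply: le_esum => k _; rewrite indicE.
by case: ifPn => [/set_mem Kk|_]; [rewrite mem_set|rewrite lee_fin].
Qed.

Hypothesis recurrent : (\int[mu]_e return_time h e R xstar < +oo)%E.

Lemma mean_level_lty : (\int[mu]_e LS (cst 1%R) 0 e < +oo)%E.
Proof.
have m1 t k : measurable_fun setT (fun e : traj X => (\1_(no_return t k) e)%:E : \bar R).
  by apply/measurable_EFinP; apply: measurable_indic; exact: measurable_no_return.
apply: le_lt_trans recurrent.
apply: (@le_trans _ _ (\int[mu]_e \sum_(k <oo) (\1_(no_return (- k%:Z) k) e)%:E)%E).
  apply: ge0_le_integralT; last exact: level_sum1_le.
  by move=> e; exact: level_sum_ge0.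
apply: (@le_trans _ _ (\int[mu]_e \sum_(k <oo) (\1_(no_return 0 k) e)%:E)%E).
  rewrite !integral_nneseries// (_ : (fun _ => _) =
    (fun n => \sum_(0 <= k < n) \int[mu]_x (\1_(no_return 0 k) x)%:E)%E)//.
  apply/funext => n; apply: eq_bigr => k _.
  have iE t : (\int[mu]_x (\1_(no_return t k) x)%:E = mu (no_return t k))%E.
    by rewrite integral_indic// ?setIT//; exact: measurable_no_return.
  by rewrite !iE mu_no_return.
apply: ge0_le_integralT; last exact: sum_no_return_le_return_time.
by move=> e; apply: nneseries_ge0 => k _ _; rewrite lee_fin.
Qed.

Lemma ae_finite_levels :
  {ae mu, forall e : traj X, forall s, finite_set (bridge_states h e xstar s)}.
Proof.
pose A s := [set e : traj X | finite_set (bridge_states h e xstar s)].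
have mL s : measurable_fun setT (LS (cst 1%R) s).
  by apply: measurable_level_sum => //; exact: net_measurable_fun_cst.
have AE s : A s = setT `&` [set e | (LS (cst 1%R) s e < +oo)%E].
  rewrite setTI; apply/seteqP; split => e; rewrite /A /= level_sum1.
    by move=> fin; rewrite finite_esum1// ltry.
  exact: esum1_lty_finite.
have mA s : measurable (A s) by rewrite AE; exact: emeasurable_fun_infty_o.
have Ashift s k : iter k (@Defs.shift X) @^-1` A s = A (s + k%:Z).
  rewrite /A; apply/seteqP; split => e /=; apply: sub_finite_set => y.
    by move=> ?; apply/bridge_iter_shift.
  by move=> /bridge_iter_shift.
have A0 : mu (~` A 0) = 0%E.
  have Li : mu.-integrable setT (LS (cst 1%R) 0).
    apply/integrableP; split=> //; under eq_integral do rewrite gee0_abs ?level_sum_ge0//.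
    exact: mean_level_lty.
  have [N [mN N0 AN]] := integrable_ae measurableT Li.
  apply/eqP; rewrite eq_le measure_ge0 andbT -N0; apply: le_measure; rewrite ?inE//.
    exact: measurableC.
  move=> e nA; apply: AN => /= /(_ I) Lfin; apply: nA; rewrite AE; split=> //=.
  by rewrite ltey_eq Lfin.
have Ak s : mu (~` A s) = 0%E.
  have [k [sk|sk]] : exists k : nat, s = k%:Z \/ s = - k%:Z by exists `|s|%N; lia.
    rewrite sk -[k%:Z]add0r -Ashift preimage_setC mu_iter_shift//; exact: measurableC.
  rewrite -(@mu_iter_shift k) ?sk; last exact: measurableC.
  by rewrite -preimage_setC Ashift addNr.
have : {ae mu, forall e : traj X, forall k : nat, A (if @choice.unpickle int k is Some s then s else 0) e}.
  apply: ae_foralln => k; set s := (s in A s).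
  by exists (~` A s); split; [exact: measurableC|exact: Ak|].
apply: filterS => e eA s; by have := eA (choice.pickle s); rewrite choice.pickleK.
Qed.

End mean_level.

(** * Averages over the window *)

Section ratio_of_averages.
Variable R : realType.

Lemma cvg_ratio_addn (N : nat) : j%:R / (j + N)%:R @[j --> \oo] --> (1 : R).
Proof.
have -> : (1 : R) = 1 - N%:R * 0 by rewrite mulr0 subr0.
apply: (@cvg_trans _ ((1 - N%:R * (j + N).+1.-1%:R^-1) @[j --> \oo])).
  apply: near_eq_cvg; near=> j.
  have j0 : (0 < j)%N by near: j; exists 1%N.
  rewrite /= natrD; have : (j%:R + N%:R : R) != 0 by rewrite -natrD pnatr_eq0; lia.
  by move=> jN; field.
apply: cvgB; first exact: cvg_cst.
apply: cvgM; first exact: cvg_cst.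
apply/cvgrPdist_le => e e0; near=> j.
rewrite sub0r normrN ger0_norm ?invr_ge0//= invf_ple ?posrE//; last first.
  by rewrite ltr0n; near: j; exists 1%N => //; move=> n /= ?; lia.
apply: (@le_trans _ _ j%:R); last by rewrite ler_nat leq_addr.
near: j; exists (Num.truncn e^-1).+1 => // n /= kn.
by rewrite ltW// (lt_le_trans (truncnS_gt _))// ler_nat.
Unshelve. all: by end_near. Qed.

Lemma average_window_cvg0 (U : nat -> R) (N : nat) (c : R) :
  U n / n%:R @[n --> \oo] --> c ->
  (U n - U (n - N)%N) / n%:R @[n --> \oo] --> 0.
Proof.
move=> Uc; rewrite -(cvg_shiftn N) /=.
apply: (@cvg_trans _ ((U (j + N)%N / (j + N)%:R - U j / j%:R * (j%:R / (j + N)%:R)) @[j --> \oo])).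
  apply: near_eq_cvg; near=> j.
  have j0 : (0 < j)%N by near: j; exists 1%N.
  rewrite addnK natrD; have : (j%:R + N%:R : R) != 0 by rewrite -natrD pnatr_eq0; lia.
  have : (j%:R : R) != 0 by rewrite pnatr_eq0; lia.
  by move=> ? ?; field; apply/andP; split.
have UcN : U (j + N)%N / (j + N)%:R @[j --> \oo] --> c.
  by rewrite (cvg_shiftn N (fun j => U j / j%:R)).
have := cvgB UcN (cvgM Uc (cvg_ratio_addn N)); rewrite mulr1 subrr; apply; exact: eventually_filter.
Unshelve. all: by end_near. Qed.

(* Averages over [0, m n) do not see a bounded number of terms at either end. *)
Lemma ratio_of_averages (u p : nat -> R) (q : nat -> nat -> R) (m : nat -> nat)
    (N : nat) (C c d : R) :
  0 <= C -> (forall k, 0 <= u k) -> 0 < c ->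
  (\sum_(0 <= k < n) u k) / n%:R @[n --> \oo] --> c ->
  (\sum_(0 <= k < n) p k) / n%:R @[n --> \oo] --> d ->
  {homo m : i j / (i < j)%N} ->
  (\forall n \near \oo, forall k, (k < m n)%N ->
     `|q n k - p k| <= if (k < N)%N || (m n <= k + N)%N then C * u k else 0) ->
  (\sum_(0 <= k < m n) u k)^-1 * (\sum_(0 <= k < m n) q n k) @[n --> \oo] --> c^-1 * d.
Proof.
move=> C0 u0 c0 Uc Pd mh qp.
pose U n := \sum_(0 <= k < n) u k.
have mge n : (n <= m n)%N by elim: n => // n IH; apply: leq_ltn_trans IH (mh _ _ _).
have moo : m n @[n --> \oo] --> \oo.
  move=> A [n0 _ nA]; exists n0 => // n /= nn; apply: nA => /=; exact: leq_trans (mge n).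
have Umc : U (m n) / (m n)%:R @[n --> \oo] --> c by exact: cvg_comp moo Uc.
have Pmd : (\sum_(0 <= k < m n) p k) / (m n)%:R @[n --> \oo] --> d by exact: cvg_comp moo Pd.
pose err n := C * (U N * n%:R^-1 + (U n - U (n - N)%N) / n%:R).
have err0 : err n @[n --> \oo] --> 0.
  rewrite -(mulr0 C); apply: cvgM; first exact: cvg_cst.
  rewrite -(addr0 0); apply: cvgD; last exact: average_window_cvg0 Uc.
  rewrite -(mulr0 (U N)); apply: cvgM; first exact: cvg_cst.
  rewrite -(cvg_shiftn 1); under eq_fun do rewrite addn1; exact: cvg_harmonic.
have errm : err (m n) @[n --> \oo] --> 0 by exact: cvg_comp moo err0.
have Umono i j : (i <= j)%N -> U i <= U j.
  move=> ij; rewrite /U (big_cat_nat (leq0n i) ij)/= lerDl; apply: sumr_ge0 => *; exact: u0.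
have bound n : (forall k, (k < m n)%N ->
     `|q n k - p k| <= if (k < N)%N || (m n <= k + N)%N then C * u k else 0) ->
   `|\sum_(0 <= k < m n) q n k - \sum_(0 <= k < m n) p k| <= C * (U N + (U (m n) - U (m n - N)%N)).
  move=> qpn; rewrite -sumrB (le_trans (ler_norm_sum _ _ _))//.
  apply: (@le_trans _ _ (\sum_(0 <= k < m n) (C * (if (k < N)%N then u k else 0) +
     C * (if (m n - N <= k)%N then u k else 0)))).
    rewrite !big_mkord; apply: ler_sum => -[k km] _ /=.
    apply: le_trans (qpn k km) _; rewrite leq_subLR addnC.
    have Cu := mulr_ge0 C0 (u0 k).
    by case: ifP; case: ifP => //=; case: ifP => //=; rewrite ?mulr0 ?addr0 ?add0r ?lerDl.
  have lo j : \sum_(0 <= k < j) (if (k < N)%N then u k else 0) = U (minn j N).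
    elim: j => [|j IH]; first by rewrite min0n /U !big_geq.
    rewrite big_nat_recr//= IH; case: ifPn => jN.
      have -> : minn j.+1 N = j.+1 by lia.
      have -> : minn j N = j by lia.
      by rewrite /U big_nat_recr.
    have -> : minn j.+1 N = minn j N by lia.
    by rewrite addr0.
  have hi j K : \sum_(0 <= k < j) (if (K <= k)%N then u k else 0) = U j - U (minn j K).
    elim: j => [|j IH]; first by rewrite min0n /U !big_geq// subrr.
    rewrite big_nat_recr//= IH; case: ifPn => jN.
      rewrite (_ : minn j.+1 K = minn j K); last lia.
      by rewrite /U big_nat_recr//= addrAC.
    have -> : minn j K = j by lia.
    have -> : minn j.+1 K = j.+1 by lia.
    by rewrite !subrr addr0.
  rewrite big_split/= -!mulr_sumr -mulrDr lo hi ler_wpM2l// lerD//.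
    by apply: Umono; lia.
  by rewrite (_ : minn _ _ = (m n - N)%N)//; lia.
have Qmd : (\sum_(0 <= k < m n) q n k) / (m n)%:R @[n --> \oo] --> d.
  have diff0 : (\sum_(0 <= k < m n) q n k) / (m n)%:R -
      (\sum_(0 <= k < m n) p k) / (m n)%:R @[n --> \oo] --> 0.
    have errN : - err (m n) @[n --> \oo] --> 0 by rewrite -oppr0; exact: cvgN.
    apply: squeeze_cvgr errN errm; near=> n.
    rewrite -ler_norml -mulrBl normrM /err -mulrDl mulrA.
    rewrite (ger0_norm (x := (m n)%:R^-1)) ?invr_ge0// ler_wpM2r ?invr_ge0//.
    by apply: bound; near: n.
  rewrite -[d]add0r; apply: cvg_trans (cvgD diff0 Pmd).
  by apply: near_eq_cvg; near=> n; rewrite /= subrK.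
apply: cvg_trans (cvgM (cvgV (lt0r_neq0 c0) Umc) Qmd).
apply: near_eq_cvg; near=> n.
have m0 : (m n)%:R != 0 :> R.
  rewrite pnatr_eq0 -lt0n; apply: leq_trans (mge n); near: n; exists 1%N => //.
by rewrite /= invfM invrK mulrACA [_%:R * _]mulrC mulVf// mulr1.
Unshelve. all: by end_near. Qed.

End ratio_of_averages.

Section level_decomposition.
Variables (R : realType) (S : choiceType) (B : int -> set S).
Hypothesis B_finite : forall s, finite_set (B s).

Definition levels (m : nat) : set (int * S) := [set v | 0 <= v.1 < m%:Z /\ B v.1 v.2].

Lemma levelsS m : levels m.+1 = levels m `|` pair m%:Z @` B m%:Z.
Proof.
apply/seteqP; split=> [[s y] [/= sm By]|[s y] [[/= sm By]|[z Bz [<- <-]]]].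
- have [sm1|sm1] := boolP (s < m%:Z); first by left; split=> //=; lia.
  right; have sE : s = m%:Z by lia.
  by exists y; rewrite -?sE.
- by split=> //=; lia.
- by split=> //=; lia.
Qed.

Lemma levels_finite m : finite_set (levels m).
Proof.
elim: m => [|m IH].
  rewrite (_ : levels 0 = set0); first exact: finite_set0.
  by apply/seteqP; split=> [[s y] [/=]|//]; lia.
by rewrite levelsS finite_setU; split=> //; exact: finite_image.
Qed.

Lemma sum_levels (G : int * S -> R) m :
  \sum_(v \in levels m) G v = \sum_(0 <= k < m) \sum_(y \in B k%:Z) G (k%:Z, y).
Proof.
elim: m => [|m IH].
  rewrite big_geq// (_ : levels 0 = set0) ?fsbig_set0//.
  by apply/seteqP; split=> [[s y] [/=]|//]; lia.
rewrite big_nat_recr//= -IH levelsS fsbigU//=.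
- rewrite fsbig_image//=; by move=> y z _ _ [].
- exact: levels_finite.
- exact: finite_image.
- by move=> [s y] [[/= sm _] [z _ [sE _]]]; lia.
Qed.

Lemma card_levels m :
  #|` fset_set (levels m)|%:R = \sum_(0 <= k < m) #|` fset_set (B k%:Z)|%:R :> R.
Proof.
have cardE (T : choiceType) (A : set T) : finite_set A ->
    #|` fset_set A|%:R = \sum_(x \in A) (1 : R).
  by move=> fA; rewrite fsbig_finite//= card_fset_sum1 natr_sum.
rewrite cardE ?sum_levels; last exact: levels_finite.
by apply: eq_bigr => k _; rewrite cardE.
Qed.

End level_decomposition.

Section window_averages.
Context (R : realType) (X : ptopologicalType) (dS : measure_display) (S : measurableType dS).
Hypothesis S_countable : countable [set: S].
Hypothesis S_discrete : forall A : set S, measurable A.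
Variables (h : S * borel X -> S) (xstar : S).
Hypothesis h_measurable : measurable_fun setT h.
Context (M : completeMetricType R) (iv : S * borel X -> borel M) (ie : bool -> M).
Hypothesis iv_measurable : measurable_fun setT iv.
Variables (a b : nat -> int).
Hypothesis I_contains0 : forall n, - a n <= 0 <= b n.
Hypothesis a_infty : forall K : int, \forall n \near \oo, K <= a n.
Hypothesis b_increasing : {homo b : m n / (m < n)%N >-> m < n}.

Notation SB e := (spined_bridge h e xstar (iv : S * borel X -> M) ie).
Notation SW e := (spined_window h e xstar (iv : S * borel X -> M) ie).
Notation LS := (@level_sum R X dS S h xstar M iv ie).

Definition half_window n (e : traj X) : set (int * S) :=
  bridge_window h e xstar (- a n) (b n) `&` [set v | 0 <= v.1 <= b n].

Definition window_average (g : Gstar M -> R) n (e : traj X) : R :=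
  #|` fset_set (half_window n e)|%:R^-1 *
  \sum_(v \in half_window n e) g (netclass (SW e (- a n) (b n), v)).

Lemma half_window_levels e : (forall s, finite_set (bridge_states h e xstar s)) ->
  \forall n \near \oo, half_window n e =
    levels (bridge_states h e xstar) `|b n|%N.+1 /\
    (forall w, 0 <= w.1 <= b n -> bridge h e xstar w ->
       bridge_window h e xstar (- a n) (b n) w).
Proof.
move=> fin; have [K KP] := bridge_window_ge0 (fin 0).
have := a_infty K; apply: filterS => n Kan.
have full w : 0 <= w.1 <= b n -> bridge h e xstar w ->
    bridge_window h e xstar (- a n) (b n) w.
  by apply: KP; lia.
split=> //; have b0 := I_contains0 n; apply/seteqP; split=> -[s y] /=.
  move=> [/window_bridge by' /= sb]; split=> //=; lia.
move=> [/= sb by']; have sb' : 0 <= s <= b n by lia.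
by split=> //; exact: full.
Qed.

Lemma window_average_cvg (g : Gstar M -> R) (C c d : R) (N : nat) e :
  (forall x, 0 <= g x) -> (forall x, g x <= C) ->
  (forall x y : Gstar M, rooted_iso eq (rball (natnet_val (repr x)) N) (rball (natnet_val (repr y)) N) ->
     g x = g y) ->
  (forall s, finite_set (bridge_states h e xstar s)) -> 0 < c ->
  @birkhoff_sum R _ (traj X) (@Defs.shift X) (fun e => fine (LS (cst 1) 0 e)) n e / n%:R @[n --> \oo] --> c ->
  @birkhoff_sum R _ (traj X) (@Defs.shift X) (fun e => fine (LS g 0 e)) n e / n%:R @[n --> \oo] --> d ->
  window_average g n e @[n --> \oo] --> c^-1 * d.
Proof.
move=> g0 gC gN fin c0 cc cd.
pose B := bridge_states h e xstar.
have bE g' n : (forall x, 0 <= g' x) ->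
   @birkhoff_sum R _ (traj X) (@Defs.shift X) (fun e => fine (LS g' 0 e)) n e =
   \sum_(0 <= k < n) \sum_(y \in B k%:Z) g' (netclass (SB e, (k%:Z, y))).
  move=> g'0; apply: eq_bigr => k _.
  by rewrite level_sum_iter_shift level_sum_finite.
have C0 : 0 <= C by apply: le_trans (gC point).
have gdist (x z : Gstar M) : `|g x - g z| <= C.
  rewrite ler_norml; have := g0 x; have := g0 z; have := gC x; have := gC z.
  by move=> *; apply/andP; split; lra.
pose u k : R := \sum_(y \in B k%:Z) (1 : R).
pose p k : R := \sum_(y \in B k%:Z) g (netclass (SB e, (k%:Z, y))).
pose q n k : R := \sum_(y \in B k%:Z) g (netclass (SW e (- a n) (b n), (k%:Z, y))).
pose m n := `|b n|%N.+1.
have mh : {homo m : i j / (i < j)%N}.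
  move=> i j /b_increasing; have := I_contains0 i; have := I_contains0 j; rewrite /m; lia.
have uE k : u k = #|` fset_set (B k%:Z)|%:R.
  by rewrite /u fsbig_finite//= card_fset_sum1 natr_sum.
have : (\sum_(0 <= k < m n) u k)^-1 * (\sum_(0 <= k < m n) q n k) @[n --> \oo] --> c^-1 * d.
  apply: (@ratio_of_averages R u p q m N C) => //.
  - by move=> k; rewrite uE.
  - by move: cc; apply: cvg_trans; apply: near_eq_cvg; near=> n; rewrite bE.
  - by move: cd; apply: cvg_trans; apply: near_eq_cvg; near=> n; rewrite bE.
  have := half_window_levels fin; apply: filterS => n [Wn full] k km.
  case: ifPn => [_|].
    rewrite /q /p /u !fsbig_finite//= -sumrB mulr_sumr (le_trans (ler_norm_sum _ _ _))//.
    by apply: ler_sum => y _; rewrite mulr1 gdist.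
  rewrite negb_or -leqNgt -ltnNge => /andP[Nk kN].
  rewrite normr_le0 subr_eq0; apply/eqP; apply: eq_fsbigr => y /set_mem By.
  have b0 := I_contains0 n.
  have kb : 0 <= k%:Z <= b n by move: km; rewrite /m; clear full; lia.
  have SWn : is_rooted_network (SW e (- a n) (b n), (k%:Z, y)).
    by apply: spined_window_network; apply: full.
  have SBn : is_rooted_network (SB e, (k%:Z, y)) by exact: spined_bridge_network.
  have SWc := rooted_network_adj_closed SWn; have SBc := rooted_network_adj_closed SBn.
  apply: gN.
  have h1 := rooted_iso_rball N (repr_adj_closed _) SWc (repr_netclass S_countable SWn).
  have h2 : rooted_iso eq (rball (SW e (- a n) (b n), (k%:Z, y)) N) (rball (SB e, (k%:Z, y)) N).
    apply: spined_window_rball => //=.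
    by move: km kN; rewrite /m; clear full; lia.
  have h3 := rooted_iso_rball N (repr_adj_closed _) SBc (repr_netclass S_countable SBn).
  apply: rooted_iso_eq_trans h1 _; apply: rooted_iso_eq_trans h2 _.
  by apply: rooted_iso_eq_sym h3; exact: (rball_adj_closed N (repr_adj_closed _)).1.
apply: cvg_trans; apply: near_eq_cvg.
have := half_window_levels fin; apply: filterS => n [Wn _].
rewrite /window_average Wn card_levels// sum_levels//.
by congr (_^-1 * _); apply: eq_bigr => k _; rewrite uE.
Unshelve. all: by end_near. Qed.
End window_averages.

Section ae_window_averages.
Context (R : realType) (X : ptopologicalType) (dS : measure_display) (S : measurableType dS).
Hypothesis S_countable : countable [set: S].
Hypothesis S_discrete : forall A : set S, measurable A.
Variables (h : S * borel X -> S) (xstar : S).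
Hypothesis h_measurable : measurable_fun setT h.
Context (M : completeMetricType R) (iv : S * borel X -> borel M) (ie : bool -> M).
Hypothesis iv_measurable : measurable_fun setT iv.
Variable mu : probability (traj X) R.
Hypothesis mu_inv : forall A : set (traj X), measurable A ->
  mu (@Defs.shift X @^-1` A) = mu A.
Hypothesis recurrent : (\int[mu]_e return_time h e R xstar < +oo)%E.
Notation LS := (@level_sum R X dS S h xstar M iv ie).

Let ae_fin : {ae mu, forall e : traj X, forall s, finite_set (bridge_states h e xstar s)} :=
  ae_finite_levels S_countable S_discrete h_measurable mu_inv ie iv_measurable recurrent.

Lemma level_sum1_ge1 s e : (1 <= LS (cst 1%R) s e)%E.
Proof.
rewrite level_sum1; apply: esum_ge; exists [set xstar].
  by split=> // _ ->; exact: bridge_star.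
by rewrite fsbig_set1.
Qed.

Lemma integrable_level_sum1 : mu.-integrable setT (LS (cst 1%R) 0).
Proof.
apply/integrableP; split.
  by apply: measurable_level_sum => //; exact: net_measurable_fun_cst.
under eq_integral do rewrite gee0_abs ?level_sum_ge0//.
exact: mean_level_lty.
Qed.

Lemma mean_level_gt0 : 0 < fine (\int[mu]_e LS (cst 1%R) 0 e).
Proof.
rewrite -lte_fin fineK; last exact: (integrable_fin_num measurableT integrable_level_sum1).
apply: (@lt_le_trans _ _ (\int[mu]_e cst 1 e)%E).
  by rewrite integral_cst// [X in (_ * X)%E]probability_setT mule1 lte_fin.
apply: ge0_le_integralT => // e; exact: level_sum1_ge1.
Qed.

Section bounded_function.
Variables (g : Gstar M -> R) (C : R).
Hypotheses (mg : net_measurable_fun S g) (g0 : forall x, 0 <= g x) (gC : forall x, g x <= C).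

Lemma integrable_level_sum : mu.-integrable setT (LS g 0).
Proof.
have C0 : 0 <= C by apply: le_trans (gC point).
have mL : measurable_fun setT (LS g 0) by exact: measurable_level_sum.
apply/integrableP; split=> //.
under eq_integral do rewrite gee0_abs ?level_sum_ge0//.
have Ci := integrableZl measurableT C integrable_level_sum1.
apply: le_lt_trans (integrable_lty measurableT Ci).
apply: ae_ge0_le_integral => //.
- by move=> e _; exact: level_sum_ge0.
- by move=> e _; rewrite mule_ge0 ?lee_fin// level_sum_ge0.
- exact: measurable_int Ci.
- by apply: filterS ae_fin => e fin _; exact: level_sum_le.
Qed.

Lemma ae_fine_level_sum : ae_eq mu setT (LS g 0) (fun e => (fine (LS g 0 e))%:E).
Proof.
apply: filterS ae_fin => e fin _; rewrite fineK//.
by rewrite level_sum_finite.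
Qed.

Lemma integrable_fine_level_sum :
  mu.-integrable setT (EFin \o (fun e => fine (LS g 0 e))).
Proof.
have mL := measurable_int mu integrable_level_sum.
have mfL : measurable_fun setT (fun e => fine (LS g 0 e)).
  exact: measurableT_comp mL.
apply: (le_integrable measurableT _ _ integrable_level_sum).
  exact/measurable_EFinP.
by move=> e _ /=; case: (LS g 0 e) => [r| |] //=; rewrite normr0 leey.
Qed.

Lemma integral_fine_level_sum :
  (\int[mu]_e (fine (LS g 0 e))%:E = \int[mu]_e LS g 0 e)%E.
Proof.
apply/esym/ae_eq_integral => //; last exact: ae_fine_level_sum.
- exact: measurable_int integrable_level_sum.
- exact: measurable_int integrable_fine_level_sum.
Qed.

End bounded_function.

Hypothesis mu_erg : forall A : set (traj X), measurable A ->
  @Defs.shift X @^-1` A = A -> mu A = 0%E \/ mu A = 1%E.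
Variables (a b : nat -> int).
Hypothesis I_contains0 : forall n, - a n <= 0 <= b n.
Hypothesis a_infty : forall K : int, \forall n \near \oo, K <= a n.
Hypothesis b_increasing : {homo b : m n / (m < n)%N >-> m < n}.

Theorem ae_window_average_cvg (g : Gstar M -> R) (C : R) (N : nat) :
  net_measurable_fun S g -> (forall x, 0 <= g x) -> (forall x, g x <= C) ->
  (forall x y : Gstar M, rooted_iso eq (rball (natnet_val (repr x)) N) (rball (natnet_val (repr y)) N) ->
     g x = g y) ->
  {ae mu, forall e, window_average h xstar iv ie a b g n e @[n --> \oo] -->
    (fine (\int[mu]_e LS (cst 1%R) 0 e))^-1 * fine (\int[mu]_e LS g 0 e)}.
Proof.
move=> mg g0 gC gN.
have m1 : net_measurable_fun S (cst 1 : Gstar M -> R) by exact: net_measurable_fun_cst.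
have i1 := integrable_fine_level_sum m1 (fun=> ler01) (fun=> lexx 1).
have ig := integrable_fine_level_sum mg g0 gC.
have b1 := birkhoff (@measurable_shift X) mu_inv mu_erg i1.
have bg := birkhoff (@measurable_shift X) mu_inv mu_erg ig.
apply: filterS3 ae_fin b1 bg => e fin c1 cg.
rewrite -(integral_fine_level_sum m1 (fun=> ler01) (fun=> lexx 1)).
rewrite -(integral_fine_level_sum mg g0 gC).
apply: window_average_cvg => //; try eassumption.
rewrite (integral_fine_level_sum m1 (fun=> ler01) (fun=> lexx 1)).
exact: mean_level_gt0.
Qed.

End ae_window_averages.

(** * The law of the driving sequence and the box measure *)

Section eq_setfun_integral.
Import HBNNSimple.

Lemma eq_setfun_integral (d : measure_display) (T : measurableType d) (R : realType)
    (m1 m2 : set T -> \bar R) (f : T -> \bar R) :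
  (forall A, measurable A -> m1 A = m2 A) ->
  (\int[m1]_x f x = \int[m2]_x f x)%E.
Proof.
move=> m12; have sE (u : {nnsfun T >-> R}) : sintegral m1 u = sintegral m2 u.
  by apply: eq_fsbigr => r _; rewrite m12.
rewrite /integral; congr (ereal_sup _ - ereal_sup _)%E.
  by apply/seteqP; split=> _ [u uf <-]; exists u.
by apply/seteqP; split=> _ [u uf <-]; exists u.
Qed.

End eq_setfun_integral.

Section partial_image.
Context (d d' : measure_display) (T : measurableType d) (Y : measurableType d') (R : realType).
Variables (mu : {measure set T -> \bar R}) (D : set T) (f : T -> Y).

Definition partial_image (mD : measurable D) (mf : measurable_fun setT f) :
  set Y -> \bar R := pushforward (mrestr mu mD) f.

Hypotheses (mD : measurable D) (mf : measurable_fun setT f).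

Let partial_image0 : partial_image mD mf set0 = 0%E.
Proof. by rewrite /partial_image /pushforward preimage_set0 measure0. Qed.

Let mpre A : measurable A -> measurable (f @^-1` A).
Proof. by move=> mA; rewrite -[X in measurable X]setTI; exact: mf. Qed.

Let partial_image_ge0 A : (0 <= partial_image mD mf A)%E.
Proof. exact: measure_ge0. Qed.

Let partial_image_sigma_additive : semi_sigma_additive (partial_image mD mf).
Proof.
move=> F mF tF mUF; rewrite /partial_image /pushforward preimage_bigcup.
apply: measure_semi_sigma_additive.
- by move=> n; exact: mpre.
- apply/trivIsetP => /= i j _ _ ij; rewrite -preimage_setI.
  by move/trivIsetP : tF => /(_ _ _ _ _ ij) ->//; rewrite preimage_set0.
- by rewrite -preimage_bigcup; exact: mpre.
Qed.

HB.instance Definition _ := isMeasure.Build _ _ _ (partial_image mD mf)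
  partial_image0 partial_image_ge0 partial_image_sigma_additive.

Lemma ge0_integral_partial_image (g : Y -> \bar R) :
  measurable_fun setT g -> (forall y, 0 <= g y)%E ->
  (\int[partial_image mD mf]_y g y = \int[mu]_(x in D) g (f x))%E.
Proof.
move=> mg g0; rewrite /partial_image ge0_integral_pushforward// preimage_setT.
have mgf : measurable_fun setT (g \o f) by exact: measurableT_comp.
rewrite (@ge0_negligible_integral _ _ _ (mrestr mu mD) setT (~` D))//.
- rewrite setTD setCK; apply: eq_measure_integral => A mA AD.
  by rewrite /= /mrestr setIidl.
- exact: measurableC.
- by move=> x _; exact: g0.
- by transitivity (mu set0); [congr (mu _); exact: setICl|exact: measure0].
Qed.

End partial_image.

Section law.
Import HBNNSimple.
Context (R : realType) (d : measure_display) (Omega : measurableType d).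
Variables (P : probability Omega R) (X : ptopologicalType).
Variable xi : int -> {RV P >-> borel X}.

Definition trajectory (w : Omega) : traj X := fun t => xi t w.

Lemma measurable_trajectory : measurable_fun setT trajectory.
Proof. by apply: measurable_path => t; exact: measurable_funP. Qed.

HB.instance Definition _ := isMeasurableFun.Build _ _ _ _ trajectory measurable_trajectory.

Definition law : probability (traj X) R := distribution P (trajectory : {RV P >-> traj X}).

Lemma law_shift : stationary P (xi : int -> Omega -> X) ->
  forall A : set (traj X), measurable A -> law (@Defs.shift X @^-1` A) = law A.
Proof. by move=> xi_stat A mA; exact: xi_stat. Qed.

Lemma law_ergodic : ergodic P (xi : int -> Omega -> X) ->
  forall A : set (traj X), measurable A -> @Defs.shift X @^-1` A = A ->
  law A = 0%E \/ law A = 1%E.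
Proof. by move=> xi_erg A mA; exact: xi_erg. Qed.

Lemma integral_law (f : traj X -> \bar R) :
  measurable_fun setT f -> (forall e, 0 <= f e)%E ->
  (\int[law]_e f e = \int[P]_w f (trajectory w))%E.
Proof. by move=> mf f0; rewrite ge0_integral_distribution. Qed.

Lemma law_integral_le (f : traj X -> \bar R) : (forall e, 0 <= f e)%E ->
  (\int[law]_e f e <= \int[P]_w f (trajectory w))%E.
Proof.
move=> f0; rewrite ge0_integralTE//; apply: ge_ereal_sup => _ [u uf <-].
rewrite -integralT_nnsfun integral_law//.
- by apply: ge0_le_integralT => w; [rewrite lee_fin fun_ge0|exact: uf].
- exact/measurable_EFinP/measurable_funP.
- by move=> e; rewrite lee_fin fun_ge0.
Qed.

Lemma ae_law (Q : traj X -> Prop) : {ae law, forall e, Q e} ->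
  {ae P, forall w, Q (trajectory w)}.
Proof.
move=> [N [mN N0 QN]]; exists (trajectory @^-1` N); split.
- by rewrite -[X in measurable X]setTI; exact: measurable_trajectory.
- exact: N0.
- by move=> w nQ; apply: QN.
Qed.

End law.

Section network_measurability.
Context (R : realType) (dS : measure_display) (S : measurableType dS).
Hypothesis S_countable : countable [set: S].
Context (M : completeMetricType R).
Hypothesis M_separable : separable M.

Lemma decodable_vertices : exists (enc : int * S -> nat) dec, cancel enc dec.
Proof.
have [enc enc_inj] := enc_injective S_countable; exists enc.
exists (fun i => xget (0 : int, point : S) [set v | enc v = i]) => v.
by case: xgetP => [w _ /enc_inj//|/(_ v)[]].
Qed.

Lemma net_measurable_borel_set (A : set (borel (Gstar M))) : measurable A ->
  net_measurable (int * S) A.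
Proof.
move=> mA; have [enc [dec encK]] := decodable_vertices.
have [D D_dense] := separable_dense_seq M_separable.
exact: (net_measurable_borel D_dense encK mA).
Qed.

Lemma net_measurable_pattern (D : nat -> M) q : net_measurable (int * S) (pat_set D q).
Proof.
have [enc [dec encK]] := decodable_vertices.
exact: (net_measurable_pat_set D encK).
Qed.

Lemma net_measurable_fun_borel (g : Gstar M -> R) :
  measurable_fun setT (g : borel (Gstar M) -> R) -> net_measurable_fun S g.
Proof.
move=> mg B mB; apply: net_measurable_borel_set.
by rewrite -[X in measurable X]setTI; exact: mg.
Qed.

Lemma net_measurable_fun_indic (A : set (Gstar M)) :
  net_measurable (int * S) A -> net_measurable_fun S (\1_A : Gstar M -> R).
Proof.
move=> mA B mB v; have [E mE EA] := mA v.
exists [set G | (E G /\ B 1) \/ (~ E G /\ B 0)].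
  apply: measurable_pred_or; apply: measurable_pred_and => //;
    try exact: measurable_pred_cst.
  exact: measurable_pred_not.
move=> G Gn; rewrite /preimage /= indicE; split.
  by move=> [[/(EA _ Gn) /mem_set -> //]|[nE]]; rewrite memNset// => /(EA _ Gn).
case: (boolP (_ \in A)) => [/set_mem /(EA _ Gn)|]; first by left.
by rewrite notin_setE => nA B0; right; split=> // /(EA _ Gn).
Qed.

End network_measurability.

Section pbox.
Context (R : realType) (d : measure_display) (Omega : measurableType d).
Variable P : probability Omega R.
Context (dS : measure_display) (S : measurableType dS).
Hypotheses (S_countable : countable [set: S]) (S_discrete : forall A : set S, measurable A).
Context (Xi : completeMetricType R).
Variable h : S * borel Xi -> S.
Hypothesis h_measurable : measurable_fun setT h.
Variable xi : int -> {RV P >-> borel Xi}.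
Hypothesis xi_stationary : stationary P (xi : int -> Omega -> Xi).
Variable xstar : S.
Hypothesis xstar_recurrent : positive_recurrent P h xi xstar.
Context (M : completeMetricType R).
Hypothesis M_separable : separable M.
Variables (iv : S * borel Xi -> borel M) (ie : bool -> M).
Hypothesis iv_measurable : measurable_fun setT iv.

Notation SB e := (spined_bridge h e xstar (iv : S * borel Xi -> M) ie).
Notation LS := (@level_sum R Xi dS S h xstar M iv ie).
Notation mu := (law xi).
Notation PB := (Pbox P h xi xstar iv ie).

Lemma law_recurrent : (\int[mu]_e return_time h e R xstar < +oo)%E.
Proof.
apply: le_lt_trans xstar_recurrent; apply: law_integral_le => e.
by apply: le_ereal_inf_tmp => _ [s [s0 _] <-]; rewrite lee_fin ler0z ltW.
Qed.

Let mean : R := fine (\int[mu]_e LS (cst 1%R) 0 e).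

Let i1 : mu.-integrable setT (LS (cst 1%R) 0) :=
  integrable_level_sum1 S_countable S_discrete h_measurable ie iv_measurable
    (law_shift xi_stationary) law_recurrent.

Let meanE : (\int[mu]_e LS (cst 1%R) 0 e = mean%:E)%E.
Proof. by rewrite fineK//; exact: (integrable_fin_num measurableT i1). Qed.

Let mean_gt0 : 0 < mean.
Proof.
exact: (mean_level_gt0 S_countable S_discrete h_measurable ie iv_measurable
    (law_shift xi_stationary) law_recurrent).
Qed.

Lemma mean_bridge_cardE : mean_bridge_card P h xi xstar = mean%:E.
Proof.
rewrite -meanE integral_law//; last by move=> e; exact: level_sum_ge0.
  by apply: eq_integral => w _; rewrite level_sum1.
by apply: measurable_level_sum => //; exact: net_measurable_fun_cst.
Qed.

Lemma bridge_level_sum (g : Gstar M -> R) w :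
  (\esum_(v in bridge_level h (xi^~ w) xstar 0) (g (netclass (SB (xi^~ w), v)))%:E =
  LS g 0 (trajectory xi w))%E.
Proof.
rewrite level_sumE (reindex_esum (bridge_states h (xi^~ w) xstar 0) _ (pair 0))//.
split=> [y by'|y z _ _ [->]//|[s y] [/= by' s0]]; first by split.
by exists y; rewrite /bridge_states/= -?s0.
Qed.

Lemma PboxE (A : set (borel (Gstar M))) : measurable A ->
  PB A = ((mean^-1)%:E * \int[mu]_e LS (\1_A : Gstar M -> R) 0 e)%E.
Proof.
move=> mA; rewrite /Pbox mean_bridge_cardE inver gt_eqF//; congr (_ * _)%E.
have mg := net_measurable_fun_indic (net_measurable_borel_set S_countable M_separable mA).
rewrite integral_law.
- by apply: eq_integral => w _; rewrite -bridge_level_sum.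
- exact: measurable_level_sum.
- by move=> e; exact: level_sum_ge0.
Qed.

Lemma Pbox_measure : exists2 m : {measure set (borel (Gstar M)) -> \bar R},
  (forall A, measurable A -> PB A = m A) &
  forall g : Gstar M -> R,
    measurable_fun setT (g : borel (Gstar M) -> R) -> (forall c, 0 <= g c) ->
    (\int[m]_c (g c)%:E = (mean^-1)%:E * \int[mu]_e LS g 0 e)%E.
Proof.
have [I [dec decb]] := countable_enum point S_countable.
pose nc y e : borel (Gstar M) :=
  if `[< bridge h e xstar (0, y) >] then netclass (SB e, (0, y)) else point.
have mvv (f : Gstar M -> R) y : net_measurable_fun S f ->
  measurable_fun setT (vertex_val h xstar iv ie f 0 y) by exact: measurable_vertex_val.
have mbr y : measurable [set e : traj Xi | bridge h e xstar (0, y)].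
  exact: measurable_bridge.
have mnc y : measurable_fun setT (nc y : traj Xi -> _).
  move=> _ A mA; rewrite setTI.
  have mg1 := net_measurable_fun_indic (net_measurable_borel_set S_countable M_separable mA).
  rewrite (_ : _ @^-1` A = (vertex_val h xstar iv ie (\1_A) 0 y @^-1` [set 1]) `|`
     [set e | ~ bridge h e xstar (0, y) /\ A point]).
    apply: measurableU.
      by rewrite -[X in measurable X]setTI; apply: mvv.
    apply: measurable_pred_and; last exact: measurable_pred_cst.
    by apply: measurable_pred_not; exact: mbr.
  apply/seteqP; split => e; rewrite /preimage /mkset /nc /vertex_val /=.
    case: asboolP => be ncA; last by right.
    by left; rewrite indicE mem_set.
  case: asboolP => be; last by case=> [/esym/eqP|[_]//]; rewrite oner_eq0.
  case=> [|[]//]; rewrite indicE; case: (boolP (_ \in A)) => [/set_mem//|_ /esym/eqP].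
  by rewrite oner_eq0.
pose D i : set (traj Xi) := if i \in I then [set e | bridge h e xstar (0, dec i)] else set0.
have mD i : measurable (D i) by rewrite /D; case: ifP => // _; exact: mbr.
pose part i := partial_image mu (mD i) (mnc (dec i)).
have mean0 : 0 <= mean^-1 by rewrite invr_ge0 ltW.
pose m := mscale (NngNum mean0) (mseries part 0).
have partE (f : Gstar M -> R) i : (forall c, 0 <= f c) ->
   measurable_fun setT (f : borel (Gstar M) -> R) ->
   (\int[part i]_c (f c)%:E = if i \in I then \int[mu]_e (vertex_val h xstar iv ie f 0 (dec i) e)%:E else 0)%E.
  move=> f0 mf; rewrite ge0_integral_partial_image//.
  - rewrite /D; case: ifPn => _; last by rewrite integral_set0.
    rewrite integral_mkcond; apply: eq_integral => e _; rewrite patchE /vertex_val /nc.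
    case: asboolP => be; first by rewrite mem_set.
    by rewrite memNset.
  - exact/measurable_EFinP.
have LSE (f : Gstar M -> R) : (forall c, 0 <= f c) ->
   measurable_fun setT (f : borel (Gstar M) -> R) ->
   (\int[mu]_e LS f 0 e = \sum_(0 <= i <oo) \int[part i]_c (f c)%:E)%E.
  move=> f0 mf; rewrite /level_sum (integral_esum point)//.
  - rewrite (reindex_esum I _ dec)// -{1}(set_mem_set I) -nneseries_esum//; last first.
      by move=> i _; apply: integral_ge0 => e _; rewrite lee_fin vertex_val_ge0.
    by rewrite [LHS]eseries_mkcond; apply: eq_eseriesr => i _; rewrite partE.
  - by move=> y e; rewrite lee_fin vertex_val_ge0.
  - by move=> y; apply/measurable_EFinP; apply: mvv; exact: net_measurable_fun_borel.
exists m.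
  move=> A mA; rewrite PboxE// /m /mscale /= /mseries; congr (_ * _)%E.
  rewrite LSE//.
  by apply: eq_eseriesr => i _; rewrite integral_indic// setIT.
move=> g mg g0; rewrite ge0_integral_mscale//=; last 2 first.
- exact/measurable_EFinP.
- by move=> c _; rewrite lee_fin.
rewrite ge0_integral_measure_series//=; last 2 first.
- by move=> c _; rewrite lee_fin.
- exact/measurable_EFinP.
by rewrite LSE.
Qed.

Lemma integral_Pbox (g : Gstar M -> R) :
  measurable_fun setT (g : borel (Gstar M) -> R) -> (forall c, 0 <= g c) ->
  (\int[PB]_c (g c)%:E = (mean^-1)%:E * \int[mu]_e LS g 0 e)%E.
Proof.
move=> mg g0; have [m mE <-//] := Pbox_measure.
exact: eq_setfun_integral.
Qed.

Lemma Pbox_setT : PB setT = 1%E.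
Proof.
rewrite PboxE// (_ : LS _ 0 = LS (cst 1%R) 0) ?meanE; last first.
  by apply/funext => e; congr level_sum; rewrite indicT.
by rewrite -EFinM mulVf// gt_eqF.
Qed.

End pbox.

Lemma finite_set_code (V : choiceType) : countable [set: V] ->
  exists code : set V -> nat, forall A B, finite_set A -> finite_set B ->
    code A = code B -> A = B.
Proof.
move=> /countable_injP[enc encI].
have enc_inj : injective enc by move=> a b; apply: encI; rewrite inE.
exists (fun A => @choice.pickle (seq nat) (map enc (enum_fset (fset_set A)))) => A B fA fB.
move=> /(pcan_inj choice.pickleK)/(inj_map enc_inj) AB.
have : fset_set A = fset_set B.
  apply/fsetP => x.
  by change ((x \in enum_fset (fset_set A)) = (x \in enum_fset (fset_set B))); rewrite AB.
by move=> /(congr1 (fun F : {fset V} => [set` F])); rewrite !fset_setK.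
Qed.

(** * The random root *)

Section uniform_root.
Context (R : realType) (d : measure_display) (Omega : measurableType d).
Variable P : probability Omega R.
Context (dS : measure_display) (S : measurableType dS).
Hypothesis S_countable : countable [set: S].
Context (M : completeMetricType R).
Hypothesis M_separable : separable M.
Local Notation V := (int * S)%type.
Variables (W : Omega -> set V) (D : set V) (G : Omega -> networkM V M) (o : Omega -> V).
Hypothesis W_finite : forall w, finite_set (W w).
Hypothesis W_measurable : forall v, measurable [set w | W w v].
Hypothesis WD0 : forall w, (W w `&` D) !=set0.
Hypothesis G_measurable : measurable_fun setT G.
Hypothesis G_network : forall w v, W w v -> is_rooted_network (G w, v).
Hypothesis G_point : forall w v, ~ W w v -> netclass (G w, v) = point :> Gstar M.
Hypothesis o_uniform : cond_uniform_indep P W D G o.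

Let V_countable : countable [set: V] := countable_int_prod S_countable.

Let root_class v w : borel (Gstar M) := netclass (G w, v).

Lemma measurable_root_class v : measurable_fun setT (root_class v).
Proof.
move=> _ A mA; rewrite setTI.
have [E mE EA] := net_measurable_borel_set S_countable M_separable mA v.
rewrite (_ : _ @^-1` A = [set w | (W w v /\ (G @^-1` E) w) \/ (~ W w v /\ A point)]).
  apply: measurable_pred_or; apply: measurable_pred_and => //.
  - by rewrite -[X in measurable X]setTI; exact: G_measurable.
  - exact: measurable_pred_not.
  - exact: measurable_pred_cst.
apply/seteqP; split => w; rewrite /root_class /preimage /=.
  have [Wv|nWv] := pselect (W w v); last by rewrite G_point//; right.
  by move=> /(EA _ (G_network Wv)); left.
by move=> [[Wv /(EA _ (G_network Wv))//]|[nWv]]; rewrite G_point.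
Qed.

Lemma measurable_rooted : measurable_fun setT (fun w => netclass (G w, o w) : borel (Gstar M)).
Proof.
move=> _ A mA; rewrite setTI.
rewrite (_ : _ @^-1` A = [set w | exists v, (o @^-1` [set v]) w /\ (root_class v @^-1` A) w]).
  apply: measurable_pred_exists => // v; apply: measurable_pred_and.
    exact: cui_measurable o_uniform _.
  by rewrite -[X in measurable X]setTI; exact: measurable_root_class.
by apply/seteqP; split => w /=; [exists (o w)|move=> [v [<-]]].
Qed.

Lemma measurable_W_eq (W0 : set V) : measurable [set w | W w = W0].
Proof.
rewrite (_ : mkset _ = [set w | forall v, W w v <-> W0 v]).
  apply: measurable_pred_forall => // v; apply: measurable_pred_iff => //.
  exact: measurable_pred_cst.
by apply/seteqP; split => w /=;[move=> ->|move=> WW0; apply/seteqP; split => v /WW0].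
Qed.

Definition root_average (f : Gstar M -> R) w : R :=
  #|` fset_set (W w `&` D)|%:R^-1 * \sum_(v \in W w `&` D) f (netclass (G w, v)).

Section fixed_window.
Variables (W0 : set V) (f : Gstar M -> R).
Hypotheses (fW0 : finite_set W0) (W0D : (W0 `&` D) !=set0).
Hypotheses (mf : measurable_fun setT (f : borel (Gstar M) -> R)) (f0 : forall c, 0 <= f c).

Let E0 := [set w | W w = W0].
Let E1 v := [set w | W w = W0 /\ o w = v].
Let mE0 : measurable E0. Proof. exact: measurable_W_eq. Qed.
Let mE1 v : measurable (E1 v).
Proof. by apply: measurable_pred_and => //; exact: cui_measurable o_uniform _. Qed.
Let mf' : measurable_fun setT (EFin \o f : borel (Gstar M) -> \bar R).
Proof. exact/measurable_EFinP. Qed.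

Lemma integral_root_eq v : (W0 `&` D) v ->
  (\int[P]_(w in E1 v) (f (netclass (G w, o w)))%:E =
   (uniform_pmf R (W0 `&` D) v)%:E * \int[P]_(w in E0) (f (netclass (G w, v)))%:E)%E.
Proof.
move=> W0v.
have u0 : 0 <= uniform_pmf R (W0 `&` D) v by rewrite /uniform_pmf divr_ge0.
transitivity (\int[P]_(w in E1 v) (f (netclass (G w, v)))%:E)%E.
  by apply: eq_integral => w /set_mem[_ ->].
rewrite -(@ge0_integral_partial_image _ _ _ _ _ P _ _ (mE1 v) (measurable_root_class v) (EFin \o f))//.
rewrite -(@ge0_integral_partial_image _ _ _ _ _ P _ _ mE0 (measurable_root_class v) (EFin \o f))//.
rewrite -[u in (u%:E * _)%E]/((NngNum u0)%:num) -ge0_integral_mscale//.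
apply: eq_setfun_integral => A mA.
have [E mE EA] := net_measurable_borel_set S_countable M_separable mA v.
rewrite /= /mscale /partial_image /pushforward /mrestr /=.
have -> : root_class v @^-1` A `&` E1 v = [set w | [/\ W w = W0, o w = v & E (G w)]].
  apply/seteqP; split => w /=.
    by move=> [Aw [Ww ow]]; split=> //; apply/(EA _ _) => //; apply: G_network; rewrite Ww; case: W0v.
  by move=> [Ww ow Ew]; split=> //; apply/(EA _ _) => //; apply: G_network; rewrite Ww; case: W0v.
have -> : root_class v @^-1` A `&` E0 = [set w | W w = W0 /\ E (G w)].
  apply/seteqP; split => w /=.
    by move=> [Aw Ww]; split=> //; apply/(EA _ _) => //; apply: G_network; rewrite Ww; case: W0v.
  by move=> [Ww Ew]; split=> //; apply/(EA _ _) => //; apply: G_network; rewrite Ww; case: W0v.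
have := cui_indep o_uniform W0 v mE; rewrite (cui_uniform o_uniform).
have mWE : measurable [set w | W w = W0 /\ E (G w)].
  apply: measurable_pred_and => //.
  by rewrite -[X in measurable X](setTI (G @^-1` E)); exact: G_measurable.
have mEE : measurable [set w | [/\ W w = W0, o w = v & E (G w)]].
  rewrite (_ : mkset _ = E1 v `&` [set w | W w = W0 /\ E (G w)]); first exact: measurableI.
  by apply/seteqP; split => w /=; [move=> [? ? ?]|move=> [[? ?] [_ ?]]].
have [PW0|PW0] := eqVneq (P E0) 0%E.
  have z (A' : set Omega) : measurable A' -> A' `<=` E0 -> P A' = 0%E.
    by move=> mA' A'E; exact: (@subset_measure0 _ _ _ P A' E0).
  by move=> _; rewrite !z ?mule0// => w [].
have f1 := fin_num_measure P _ mE0; have f2 := fin_num_measure P _ mEE.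
have f3 := fin_num_measure P _ mWE.
move: PW0; rewrite -/E0 -(fineK f1) -(fineK f2) -(fineK f3) -!EFinM eqe => p0 [h].
by congr EFin; apply: (mulIf p0); rewrite h; ring.
by move=> c _; rewrite /= lee_fin.
Qed.

Lemma integral_rooted_fixed :
  (\int[P]_(w in E0) (f (netclass (G w, o w)))%:E =
   \int[P]_(w in E0) (root_average f w)%:E)%E.
Proof.
have fWD : finite_set (W0 `&` D) by exact: finite_setIl.
have mro : measurable_fun setT (fun w => (f (netclass (G w, o w)))%:E).
  exact: measurableT_comp mf' measurable_rooted.
have mrc v : measurable_fun setT (fun w => (f (netclass (G w, v)))%:E).
  exact: measurableT_comp mf' (measurable_root_class v).
pose N := [set w | W w = W0 /\ ~ (W0 `&` D) (o w)].
have mN : measurable N.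
  rewrite (_ : N = [set w | exists v, E1 v w /\ ~ (W0 `&` D) v]).
    apply: measurable_pred_exists => // v; apply: measurable_pred_and; first exact: mE1.
    exact: measurable_pred_cst.
  by apply/seteqP; split => w /=; [move=> [? ?]; exists (o w)|move=> [v [[? <-]]]].
have N0 : P N = 0%E.
  have [enc [dec encK]] := decodable_vertices S_countable.
  have : {ae P, forall w, forall i : nat, ~ (W0 `&` D) (dec i) -> ~ E1 (dec i) w}.
    apply: ae_foralln => i; have [W0v|W0v] := pselect ((W0 `&` D) (dec i)).
      by apply: aeW => w.
    exists (E1 (dec i)); split; first exact: mE1.
      have := cui_uniform o_uniform W0 (dec i).
      by rewrite /uniform_pmf indicE memNset// mul0r mule0.
    by move=> w /= /not_implyP[_ /contrapT].
  move=> [N' [mN' N'0 NN']]; apply: (subset_measure0 mN mN' _ N'0) => w [Ww oW].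
  apply: NN' => /= /(_ (enc (o w))); rewrite encK => /(_ oW); exact.
have -> : (\int[P]_(w in E0) (f (netclass (G w, o w)))%:E =
           \int[P]_(w in E0 `\` N) (f (netclass (G w, o w)))%:E)%E.
  apply: ge0_negligible_integral => //; first exact: measurable_funTS.
  by move=> w _; rewrite lee_fin.
pose s := enum_fset (fset_set (W0 `&` D)).
have sP v : v \in s -> (W0 `&` D) v.
  move=> vs; have : v \in fset_set (W0 `&` D) by [].
  by rewrite in_fset_set// => /set_mem.
have sP' v : (W0 `&` D) v -> v \in s.
  move=> Wv; suff : v \in fset_set (W0 `&` D) by [].
  by rewrite in_fset_set//; exact: mem_set.
have E0N : E0 `\` N = \big[setU/set0]_(v <- s) E1 v.
  rewrite -bigcup_seq; apply/seteqP; split => w /=.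
    move=> [Ww nN]; exists (o w) => //; apply: sP'; apply: contrapT => nW; exact: nN.
  by move=> [v /sP Wv [Ww ow]]; split=> // -[_]; rewrite ow.
rewrite E0N ge0_integral_bigsetU//=; last 4 first.
- exact: fset_uniq.
- by move=> v v' _ _ [w [[_ <-] [_ <-]]].
- exact: measurable_funTS.
- by move=> w _; rewrite lee_fin.
transitivity (\int[P]_(w in E0) \sum_(v <- s)
    ((#|` fset_set (W0 `&` D)|%:R^-1)%:E * (f (netclass (G w, v)))%:E))%E; last first.
  apply: eq_integral => w /set_mem Ww; rewrite /root_average Ww fsbig_finite//=.
  by rewrite mulr_sumr -sumEFin; apply: eq_bigr => v _; rewrite EFinM.
rewrite ge0_integral_sum//.
- rewrite big_seq [RHS]big_seq; apply: eq_bigr => v /sP Wv.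
  rewrite integral_root_eq// ge0_integralZl//.
  + by rewrite /uniform_pmf indicE mem_set// div1r.
  + exact: measurable_funTS.
  + by move=> w _; rewrite lee_fin.
- move=> v; apply: measurable_funeM; exact: measurable_funTS.
- by move=> v w _; rewrite mule_ge0// lee_fin// invr_ge0.
Qed.

End fixed_window.

Theorem integral_rooted (f : Gstar M -> R) :
  measurable_fun setT (f : borel (Gstar M) -> R) -> (forall c, 0 <= f c) ->
  measurable_fun setT (root_average f) ->
  (\int[P]_w (f (netclass (G w, o w)))%:E = \int[P]_w (root_average f w)%:E)%E.
Proof.
move=> mf f0 mA; have [code codeI] := finite_set_code V_countable.
have mro : measurable_fun setT (fun w => (f (netclass (G w, o w)))%:E).
  by apply/measurable_EFinP; exact: measurableT_comp mf measurable_rooted.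
pose F i := [set w | code (W w) = i].
have FE i : F i = set0 \/ exists2 W0, finite_set W0 /\ (W0 `&` D) !=set0 &
    F i = [set w | W w = W0].
  have [->|/set0P[w /= cw]] := eqVneq (F i) set0; [by left|right].
  exists (W w); first by split.
  by apply/seteqP; split=> w' /=; [rewrite /F /= -cw => /codeI; apply|move=> Ew; rewrite /F /= Ew].
have mF i : measurable (F i).
  by have [->//|[W0 _ ->]] := FE i; exact: measurable_W_eq.
have FT : \bigcup_i F i = setT by apply/seteqP; split=> // w _; exists (code (W w)).
have tF : trivIset setT F by move=> i j _ _ [w [/= <- <-]].
rewrite -FT !ge0_integral_bigcup// ?FT//.
- apply: eq_eseriesr => i _; have [->|[W0 [fW0 W0D] ->]] := FE i.
    by rewrite !integral_set0.
  exact: integral_rooted_fixed.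
- exact/measurable_EFinP.
- move=> w _; rewrite lee_fin mulr_ge0// ?invr_ge0//.
  by rewrite fsbig_finite//=; [apply: sumr_ge0|exact: finite_setIl].
- by move=> w _; rewrite lee_fin.
Qed.

End uniform_root.

Section measurable_window_average.
Context (R : realType) (X : ptopologicalType) (dS : measure_display) (S : measurableType dS).
Hypothesis S_countable : countable [set: S].
Hypothesis S_discrete : forall A : set S, measurable A.
Variables (h : S * borel X -> S) (xstar : S).
Hypothesis h_measurable : measurable_fun setT h.
Context (M : completeMetricType R) (iv : S * borel X -> borel M) (ie : bool -> M).
Hypothesis iv_measurable : measurable_fun setT iv.
Variables (a b : nat -> int).
Hypothesis I_contains0 : forall n, - a n <= 0 <= b n.

Notation SW e := (spined_window h e xstar (iv : S * borel X -> M) ie).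
Notation HW := (half_window h xstar a b).
Notation WA := (window_average h xstar iv ie a b).

Lemma half_window_finite n e : finite_set (HW n e).
Proof. by apply: finite_setIl; exact: window_finite. Qed.

Lemma half_window_star n e : HW n e (0, xstar).
Proof. by have n0 := I_contains0 n; split; [exact: window_star|rewrite /=; lia]. Qed.

Lemma half_window_card_gt0 n e : (0 < #|` fset_set (HW n e)|)%N.
Proof.
rewrite cardfs_gt0; apply/fset0Pn; exists (0, xstar).
by rewrite in_fset_set ?mem_set//; [exact: half_window_star|exact: half_window_finite].
Qed.

Lemma measurable_half_window n v : measurable [set e : traj X | HW n e v].
Proof.
apply: measurable_pred_and; first exact: measurable_window.
exact: measurable_pred_cst.
Qed.

Definition window_val (g : Gstar M -> R) n v (e : traj X) : R :=
  if `[< HW n e v >] then g (netclass (SW e (- a n) (b n), v)) else 0.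

Lemma measurable_window_val g n v : net_measurable_fun S g ->
  measurable_fun setT (window_val g n v).
Proof.
move=> mg; pose B := [set e : traj X | HW n e v].
have mB : measurable B by exact: measurable_half_window.
rewrite (_ : window_val g n v = (fun e => g (netclass (SW e (- a n) (b n), v))) \_ B).
  apply: (iffLR (measurable_restrictT _ mB)).
  apply: (measurable_netclass (G := fun e : traj X => SW e (- a n) (b n))) => //.
    exact: measurable_spined_window.
  by move=> e [We _]; exact: spined_window_network.
apply/funext => e; rewrite /window_val /patch; case: asboolP => eB; first by rewrite mem_set.
by rewrite memNset.
Qed.

Lemma window_sumE g n e : (forall c, 0 <= g c) ->
  \sum_(v \in HW n e) g (netclass (SW e (- a n) (b n), v)) =
  fine (\esum_(v in [set: int * S]) (window_val g n v e)%:E).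
Proof.
move=> g0; have fin := half_window_finite n e.
rewrite (_ : \esum_(v in _) _ =
  \esum_(v in HW n e) (g (netclass (SW e (- a n) (b n), v)))%:E).
  by rewrite esum_fset//; [rewrite fsumEFin|move=> v _; rewrite lee_fin].
rewrite [RHS]esum_mkcond; apply: eq_esum => v _.
rewrite /window_val; case: ifPn => [/asboolP Wv|/asboolP nW]; first by rewrite mem_set.
by rewrite memNset.
Qed.

Lemma measurable_window_sum g n : net_measurable_fun S g -> (forall c, 0 <= g c) ->
  measurable_fun setT (fun e : traj X =>
    \sum_(v \in HW n e) g (netclass (SW e (- a n) (b n), v))).
Proof.
move=> mg g0; rewrite (_ : (fun e => _) = (fun e : traj X =>
    fine (\esum_(v in [set: int * S]) (window_val g n v e)%:E))); last first.
  by apply/funext => e; rewrite window_sumE.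
apply: (measurableT_comp (f := fine)) => //.
apply: (measurable_esum (0, xstar)).
- exact: countable_int_prod.
- by move=> v e; rewrite lee_fin /window_val; case: ifP.
- by move=> v; apply/measurable_EFinP; exact: measurable_window_val.
Qed.

Lemma measurable_window_average g n : net_measurable_fun S g -> (forall c, 0 <= g c) ->
  measurable_fun setT (WA g n).
Proof.
move=> mg g0; apply: measurable_funM; last exact: measurable_window_sum.
rewrite (_ : (fun e => _) = (fun e : traj X => (\sum_(v \in HW n e) (1 : R)) `^ (-1))).
  have nm1 : net_measurable_fun S (cst 1 : Gstar M -> R) by exact: net_measurable_fun_cst.
  have m1 := measurable_window_sum n nm1 (fun=> ler01).
  exact: (measurableT_comp (measurable_powR (-1 : R)) m1).
apply/funext => e; have fin := half_window_finite n e.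
rewrite powR_inv1 fsbig_finite//=; last by apply: sumr_ge0.
by rewrite card_fset_sum1 natr_sum.
Qed.

Lemma window_average_ge0 g n e : (forall c, 0 <= g c) -> 0 <= WA g n e.
Proof.
move=> g0; rewrite mulr_ge0// ?invr_ge0//.
by rewrite fsbig_finite/=; [apply: sumr_ge0|exact: half_window_finite].
Qed.

Lemma window_average_le g g' n e : (forall c, g c <= g' c) -> WA g n e <= WA g' n e.
Proof.
move=> gg'; rewrite ler_wpM2l ?invr_ge0//.
by rewrite !fsbig_finite/=; [apply: ler_sum|exact: half_window_finite..].
Qed.

Lemma window_average_cst r n e : WA (cst r) n e = r.
Proof.
rewrite /window_average fsbig_finite/=; last exact: half_window_finite.
have c0 := half_window_card_gt0 n e.
rewrite (_ : \sum_(v <- _) r = #|` fset_set (HW n e)|%:R * r).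
  by rewrite mulKf// pnatr_eq0 -lt0n.
by rewrite card_fset_sum1 natr_sum mulr_suml; apply: eq_bigr => v _; rewrite mul1r.
Qed.

End measurable_window_average.

Lemma continuous_Gstar_open (R : realType) (M : completeMetricType R)
    (f : Gstar M -> R) r :
  continuous f -> Gstar_open [set c | r < f c].
Proof.
move=> /continuousP cf; exact: (cf _ (@open_gt R r)).
Qed.

Lemma continuous_Gstar_measurable (R : realType) (M : completeMetricType R)
    (f : Gstar M -> R) :
  continuous f -> measurable_fun setT (f : borel (Gstar M) -> R).
Proof.
move=> cf; apply: (measurability _ (RGenOInfty.measurableE R)).
move=> /= _ [_ [r ->] <-]; rewrite setTI; apply: sub_sigma_algebra.
rewrite (_ : _ @^-1` _ = [set c | r < f c]); first exact: continuous_Gstar_open.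
by apply/seteqP; split => c; rewrite /= in_itv/= andbT.
Qed.

(** * Weak convergence *)

Section lower_approximation.
Context (R : realType) (dS : measure_display) (S : measurableType dS).
Hypothesis S_countable : countable [set: S].
Context (M : completeMetricType R).
Variable D : nat -> M.
Hypothesis D_dense : forall (m : M) (e : R), 0 < e -> exists i, mdist m (D i) < e.
Variable f : Gstar M -> R.
Hypotheses (f_continuous : continuous f) (f_ge0 : forall c, 0 <= f c).

Definition lower_piece (k : nat) (c : Gstar M) : R :=
  if @choice.unpickle (rat * pattern)%type k is Some (r, q) then
    if `[< 0 <= r /\ pat_set D q `<=` [set c' | ratr r < f c'] >] then
      ratr r * \1_(pat_set D q) c else 0
  else 0.

Fixpoint lower_approx (k : nat) (c : Gstar M) : R :=
  if k is k'.+1 then Num.max (lower_approx k' c) (lower_piece k' c) else 0.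

Lemma lower_piece_le k c : lower_piece k c <= f c.
Proof.
rewrite /lower_piece; case: (choice.unpickle k) => [[r q]|//].
case: asboolP => [[r0 qf]|//]; rewrite indicE; case: (boolP (_ \in _)) => [/set_mem/qf /ltW|_].
  by rewrite mulr1.
by rewrite mulr0.
Qed.

Lemma lower_approx_le k c : lower_approx k c <= f c.
Proof. by elim: k => //= k IH; rewrite ge_max IH lower_piece_le. Qed.

Lemma lower_approx_ge0 k c : 0 <= lower_approx k c.
Proof. by elim: k => //= k IH; rewrite le_max IH. Qed.

Lemma lower_approx_mono m n c : (m <= n)%N -> lower_approx m c <= lower_approx n c.
Proof.
move=> mn; apply: (homo_leq (f := lower_approx^~ c) (@lexx _ _) (@le_trans _ _)) mn.
by move=> k /=; rewrite le_max lexx.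
Qed.

Lemma lower_approx_cvg c : lower_approx k c @[k --> \oo] --> f c.
Proof.
apply/cvgrPdist_le => e e0.
have [k kP] : exists k, f c - e <= lower_approx k c.
  have [fe|fe] := ltP (f c - e) 0; first by exists 0%N; exact: ltW.
  have : f c - e < f c by rewrite ltrBlDr ltrDl.
  move=> /rat_in_itvoo[r]; rewrite in_itv/= => /andP[er rf].
  have r0 : 0 <= r by rewrite -(ler0q R) (le_trans fe)// ltW.
  have [q [qc qU]] := pat_set_open D_dense (continuous_Gstar_open f_continuous) rf.
  exists (@choice.pickle (rat * pattern)%type (r, q)).+1.
  rewrite /= le_max /lower_piece choice.pickleK asboolT//.
  by rewrite indicE mem_set// mulr1 (ltW er) orbT.
near=> n; rewrite ger0_norm ?subr_ge0 ?lower_approx_le//.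
rewrite lerBlDr -lerBlDl (le_trans kP)//; apply: lower_approx_mono.
by near: n; exists k.
Unshelve. all: by end_near. Qed.

Lemma net_measurable_lower_approx k : net_measurable_fun S (lower_approx k).
Proof.
have sig := @net_measurable_sigma R M (int * S)%type.
pose Y := g_sigma_algebraType (@net_measurable R M (int * S)%type).
have mY (A : set Y) : measurable A <-> net_measurable (int * S) A.
  split=> [mA|nA]; last exact: sub_sigma_algebra.
  move: mA; rewrite /measurable/=; exact: smallest_sub.
suff mk : measurable_fun setT (lower_approx k : Y -> R).
  move=> B mB; apply/mY; rewrite -[X in measurable X]setTI; exact: mk.
elim: k => [|k IH]; first exact: measurable_cst.
apply: measurable_maxr => //; rewrite /lower_piece.
case: (choice.unpickle k) => [[r q]|]; last exact: measurable_cst.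
case: asboolP => _; last exact: measurable_cst.
apply: measurable_funM; first exact: measurable_cst.
by apply: measurable_indic; apply/mY; exact: net_measurable_pattern.
Qed.

Lemma lower_approx_local k : exists N, forall c c' : Gstar M,
  rooted_iso eq (rball (natnet_val (repr c)) N) (rball (natnet_val (repr c')) N) ->
  lower_approx k c = lower_approx k c'.
Proof.
elim: k => [|k [N IH]]; first by exists 0%N.
have [N' N'P] : exists N, forall c c' : Gstar M,
    rooted_iso eq (rball (natnet_val (repr c)) N) (rball (natnet_val (repr c')) N) ->
    lower_piece k c = lower_piece k c'.
  rewrite /lower_piece; case: (choice.unpickle k) => [[r q]|]; last by exists 0%N.
  case: asboolP => _; last by exists 0%N.
  exists (pat_radius q) => c c' cc'; congr (_ * _); rewrite !indicE; congr (_%:R).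
  have cc := repr_adj_closed c; have cc'c := repr_adj_closed c'.
  have c'c := rooted_iso_eq_sym (rball_adj_closed _ cc).1 cc'.
  congr nat_of_bool; apply/idP/idP => /set_mem; rewrite /pat_set /= => qc; apply/mem_set => /=.
    exact: pat_match_ball cc cc'c (leqnn _) cc' qc.
  exact: pat_match_ball cc'c cc (leqnn _) c'c qc.
exists (maxn N N') => c c' cc' /=.
have cc := repr_adj_closed c; have cc'c := repr_adj_closed c'.
rewrite (IH _ c') ?(N'P _ c')//.
  by apply: rooted_iso_rball_le cc'; rewrite ?leq_maxr.
by apply: rooted_iso_rball_le cc'; rewrite ?leq_maxl.
Qed.

End lower_approximation.

Section bounded_integrals.
Context (R : realType) (d : measure_display) (T : measurableType d).
Variables (nu : {measure set T -> \bar R}) (nu1 : nu setT = 1%E).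
Variables (f : T -> R) (C : R).
Hypotheses (mf : measurable_fun setT f) (fC : forall x, `|f x| <= C).

Lemma integrable_bounded : nu.-integrable setT (EFin \o f).
Proof.
apply: measurable_bounded_integrable => //; first by rewrite nu1 ltry.
exists C; split; first exact: num_real.
by move=> r Cr x _; exact: le_trans (fC x) (ltW Cr).
Qed.

Lemma integrable_const r : nu.-integrable setT (EFin \o cst r).
Proof.
apply: measurable_bounded_integrable => //; first by rewrite nu1 ltry.
exists `|r|; split; first exact: num_real.
by move=> s rs x _; exact: ltW.
Qed.

Lemma Rintegral_addc r :
  (\int[nu]_x (f x + r) = \int[nu]_x f x + r)%R.
Proof.
rewrite (RintegralD measurableT integrable_bounded (integrable_const r)).
by rewrite Rintegral_cst// nu1 mulr1.
Qed.

Lemma Rintegral_csub r :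
  (\int[nu]_x (r - f x) = r - \int[nu]_x f x)%R.
Proof.
rewrite (RintegralB measurableT (integrable_const r) integrable_bounded).
by rewrite Rintegral_cst// nu1 mulr1.
Qed.

End bounded_integrals.

Section weak_limit.
Context (R : realType) (d : measure_display) (Omega : measurableType d).
Variable P : probability Omega R.
Context (dS : measure_display) (S : measurableType dS).
Hypotheses (S_countable : countable [set: S]) (S_discrete : forall A : set S, measurable A).
Context (Xi : completeMetricType R).
Variable h : S * borel Xi -> S.
Hypothesis h_measurable : measurable_fun setT h.
Variable xi : int -> {RV P >-> borel Xi}.
Hypothesis xi_stationary : stationary P (xi : int -> Omega -> Xi).
Hypothesis xi_ergodic : ergodic P (xi : int -> Omega -> Xi).
Variable xstar : S.
Hypothesis xstar_recurrent : positive_recurrent P h xi xstar.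
Context (M : completeMetricType R).
Hypothesis M_separable : separable M.
Variables (iv : S * borel Xi -> borel M) (ie : bool -> M).
Hypothesis iv_measurable : measurable_fun setT iv.
Variables (a b : nat -> int).
Hypothesis I_contains0 : forall n, - a n <= 0 <= b n.
Hypothesis a_infty : forall K : int, \forall n \near \oo, K <= a n.
Hypothesis b_increasing : {homo b : m n / (m < n)%N >-> m < n}.

Notation SB e := (spined_bridge h e xstar (iv : S * borel Xi -> M) ie).
Notation SW e := (spined_window h e xstar (iv : S * borel Xi -> M) ie).
Notation LS := (@level_sum R Xi dS S h xstar M iv ie).
Notation WA := (window_average h xstar iv ie a b).
Notation mu := (law xi).
Notation PB := (Pbox P h xi xstar iv ie).

Let mean : R := fine (\int[mu]_e LS (cst 1%R) 0 e).
Let rec := law_recurrent xstar_recurrent.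
Let inv := law_shift xi_stationary.
Let erg := law_ergodic xi_ergodic.

Let ae_fin : {ae mu, forall e : traj Xi, forall s, finite_set (bridge_states h e xstar s)} :=
  ae_finite_levels S_countable S_discrete h_measurable inv ie iv_measurable rec.
Let i1 : mu.-integrable setT (LS (cst 1%R) 0) :=
  integrable_level_sum1 S_countable S_discrete h_measurable ie iv_measurable inv rec.
Let mean_gt0 : 0 < mean :=
  mean_level_gt0 S_countable S_discrete h_measurable ie iv_measurable inv rec.

Let limit_value (g : Gstar M -> R) : R := mean^-1 * fine (\int[mu]_e LS g 0 e).

Lemma ae_window_average (g : Gstar M -> R) (C : R) (N : nat) :
  net_measurable_fun S g -> (forall x, 0 <= g x) -> (forall x, g x <= C) ->
  (forall x y : Gstar M,
     rooted_iso eq (rball (natnet_val (repr x)) N) (rball (natnet_val (repr y)) N) ->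
     g x = g y) ->
  {ae mu, forall e, WA g n e @[n --> \oo] --> limit_value g}.
Proof. exact: ae_window_average_cvg. Qed.

Lemma integral_Pbox_limit (g : Gstar M -> R) (C : R) :
  measurable_fun setT (g : borel (Gstar M) -> R) ->
  (forall x, 0 <= g x) -> (forall x, g x <= C) ->
  (\int[PB]_c (g c)%:E = (limit_value g)%:E)%E.
Proof.
move=> mg g0 gC; rewrite integral_Pbox// /limit_value EFinM fineK//.
apply: (integrable_fin_num measurableT).
apply: (integrable_level_sum S_countable S_discrete h_measurable ie iv_measurable
  inv rec _ g0 gC).
exact: net_measurable_fun_borel.
Qed.

Lemma mean_window_average_cvg (g : Gstar M -> R) (C : R) (N : nat) :
  net_measurable_fun S g -> (forall x, 0 <= g x) -> (forall x, g x <= C) ->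
  (forall x y : Gstar M,
     rooted_iso eq (rball (natnet_val (repr x)) N) (rball (natnet_val (repr y)) N) ->
     g x = g y) ->
  (\int[mu]_e (WA g n e)%:E @[n --> \oo] --> (limit_value g)%:E)%E.
Proof.
move=> mg g0 gC gN.
have mW n : measurable_fun setT (WA g n) by exact: measurable_window_average.
have := @dominated_convergence _ _ _ mu setT measurableT
  (fun n => EFin \o WA g n) (cst (limit_value g)%:E) (cst C%:E).
case.
- by move=> n; exact/measurable_EFinP.
- exact: measurable_cst.
- have := ae_window_average mg g0 gC gN; apply: filterS => e We _.
  by apply: cvg_EFin => //; exact: nearW.
- exact: finite_measure_integrable_cst.
- apply: aeW => e n _ /=; rewrite lee_fin ger0_norm; last exact: window_average_ge0.
  have -> : C = WA (cst C) n e by rewrite window_average_cst.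
  exact: window_average_le.
move=> _ _; rewrite integral_cst// [X in (_ * X)%E]probability_setT mule1.
exact.
Qed.

Section lower_bound.
Variables (f : Gstar M -> R) (C : R).
Hypotheses (f_continuous : continuous f) (f0 : forall c, 0 <= f c) (fC : forall c, f c <= C).

Let mf : net_measurable_fun S f.
Proof. by apply: net_measurable_fun_borel => //; exact: continuous_Gstar_measurable. Qed.

Lemma limit_value_lower_approx (D : nat -> M) :
  (forall (m : M) (e : R), 0 < e -> exists i, mdist m (D i) < e) ->
  limit_value (lower_approx D f k) @[k --> \oo] --> limit_value f.
Proof.
move=> D_dense; apply: cvgM; first exact: cvg_cst.
have L0 k := @lower_approx_ge0 R M D f k.
have Lf k := @lower_approx_le R M D f f0 k.
have mL k : net_measurable_fun S (lower_approx D f k) by exact: net_measurable_lower_approx.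
have Ci := integrableZl measurableT C i1.
apply: fine_cvg; rewrite fineK; last first.
  apply: (integrable_fin_num measurableT).
  exact: (integrable_level_sum S_countable S_discrete h_measurable ie iv_measurable
    inv rec mf f0 fC).
have := @dominated_convergence _ _ _ mu setT measurableT
  (fun k => LS (lower_approx D f k) 0) (LS f 0) (fun e => C%:E * LS (cst 1%R) 0 e)%E.
case=> //.
- by move=> k; exact: measurable_level_sum.
- exact: measurable_level_sum.
- apply: filterS ae_fin => e fin _.
  have -> : (fun k => LS (lower_approx D f k) 0 e) = (fun k =>
    (\sum_(y <- fset_set (bridge_states h e xstar 0))
       lower_approx D f k (netclass (SB e, (0, y))))%:E).
    by apply/funext => k; rewrite level_sum_finite// fsbig_finite.
  rewrite level_sum_finite// fsbig_finite//=.
  apply: cvg_EFin; first exact: nearW.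
  apply: cvg_big; first exact: add_continuous.
  by move=> y _; exact: lower_approx_cvg.
- apply: filterS ae_fin => e fin k _.
  rewrite gee0_abs; last exact: level_sum_ge0.
  by apply: level_sum_le => // c; exact: le_trans (Lf k c) (fC c).
Qed.

Lemma mean_window_average_ge e : 0 < e ->
  \forall n \near \oo, limit_value f - e <= \int[mu]_e (WA f n e).
Proof.
move=> e0; have [D D_dense] := separable_dense_seq M_separable.
have L0 k := @lower_approx_ge0 R M D f k.
have Lf k := @lower_approx_le R M D f f0 k.
have mL k : net_measurable_fun S (lower_approx D f k) by exact: net_measurable_lower_approx.
have e20 : 0 < e / 2 by rewrite divr_gt0.
have [k kP] : exists k, limit_value f - e / 2 <= limit_value (lower_approx D f k).
  have /cvgrPdist_le /(_ _ e20) [k _ kP] := limit_value_lower_approx D_dense.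
  by exists k; have := kP k (leqnn k); rewrite ler_distlC => /andP[].
have [N NP] := lower_approx_local D f k.
have LC c : lower_approx D f k c <= C by exact: le_trans (Lf k c) (fC c).
have := mean_window_average_cvg (mL k) (L0 k) LC NP.
move=> /fine_cvg /= /cvgrPdist_le /(_ _ e20); apply: filterS => n.
rewrite ler_distlC => /andP[nk _].
apply: (@le_trans _ _ (\int[mu]_e WA (lower_approx D f k) n e)).
  by apply: le_trans nk; lra.
have W0 g x : (forall c, 0 <= g c) -> 0 <= WA g n x by exact: window_average_ge0.
have WC g x : (forall c, g c <= C) -> WA g n x <= C.
  move=> gC; have -> : C = WA (cst C) n x by rewrite window_average_cst.
  exact: window_average_le.
have mu1 : mu setT = 1%E by exact: probability_setT.
have Wi g : net_measurable_fun S g -> (forall c, 0 <= g c) -> (forall c, g c <= C) ->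
    mu.-integrable setT (EFin \o WA g n).
  move=> mg g0 gC; apply: (integrable_bounded mu1 (C := C)).
    exact: measurable_window_average.
  by move=> x; rewrite ger0_norm ?W0// WC.
apply: le_Rintegral => //; try exact: Wi.
by move=> x _; exact: window_average_le.
Qed.

End lower_bound.

Section random_root.
Variable o : nat -> Omega -> int * S.
Notation VI n w := (bridge_window h (xi^~ w) xstar (- a n) (b n)).
Notation J n := [set v : int * S | 0 <= v.1 <= b n].
Notation BI n w := (SW (xi^~ w) (- a n) (b n)).
Hypothesis o_uniform : forall n,
  cond_uniform_indep P (fun w => VI n w) (J n) (fun w => BI n w : network (int * S) M) (o n).

Let G n (w : Omega) : networkM (int * S) M := BI n w.

Let mG n : measurable_fun setT (G n).
Proof.
exact: (measurableT_comp (measurable_spined_window S_countable S_discrete xstar h_measurable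
  ie iv_measurable (- a n) (b n)) (measurable_trajectory xi)).
Qed.

Let mVI n v : measurable [set w | VI n w v].
Proof.
have mt := @measurable_trajectory _ _ _ P _ xi.
have := mt measurableT _ (measurable_window S_countable S_discrete xstar h_measurable (- a n) (b n) v).
by rewrite setTI.
Qed.

Let G_network n w v : VI n w v -> is_rooted_network (G n w, v).
Proof. exact: spined_window_network. Qed.

Let G_point n w v : ~ VI n w v -> netclass (G n w, v) = point :> Gstar M.
Proof.
move=> nV; apply: netclass_point => -[c [phi [[f1 _ _] fr _ _ _]]]; apply: nV.
have [_ co] := repr_rooted_network c.
by have [_] := f1 _ co; rewrite fr.
Qed.

Let VI_finite n w : finite_set (VI n w). Proof. exact: window_finite. Qed.

Let VIJ0 n w : (VI n w `&` J n) !=set0.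
Proof. by exists (0, xstar); exact: (half_window_star S_countable h xstar I_contains0 n (trajectory xi w)). Qed.

Lemma measurable_rooted_window n :
  measurable_fun setT (fun w => netclass (BI n w, o n w) : borel (Gstar M)).
Proof.
apply: (@measurable_rooted _ _ _ P _ _ S_countable M M_separable _ _ (G n) (o n)) => //.
- exact: mVI.
- exact: G_network.
- exact: G_point.
- exact: o_uniform.
Qed.

Lemma integral_rooted_window (f : Gstar M -> R) n :
  measurable_fun setT (f : borel (Gstar M) -> R) -> (forall c, 0 <= f c) ->
  (\int[P]_w (f (netclass (BI n w, o n w)))%:E = \int[mu]_e (WA f n e)%:E)%E.
Proof.
move=> mf f0; have mWA : measurable_fun setT (WA f n).
  by apply: measurable_window_average => //; exact: net_measurable_fun_borel.
rewrite integral_law; last 2 first.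
- exact/measurable_EFinP.
- by move=> e; rewrite lee_fin window_average_ge0.
have mt := @measurable_trajectory _ _ _ P _ xi.
have := @integral_rooted _ _ _ P _ _ S_countable M M_separable
  (fun w => VI n w) (J n) (G n) (o n) (VI_finite n) (mVI n) (VIJ0 n) (mG n)
  (@G_network n) (@G_point n) (o_uniform n) f mf f0.
by apply; exact: (measurableT_comp mWA mt).
Qed.

Theorem rooted_window_weak_cvg :
  weak_cvg (fun n => pushforward P (fun w => netclass (BI n w, o n w) : borel (Gstar M))) PB.
Proof.
move=> f fc [C fC].
have mf := continuous_Gstar_measurable fc.
have [m mE mI] := Pbox_measure S_countable S_discrete h_measurable xi_stationary
  xstar_recurrent M_separable ie iv_measurable.
have m1 : m setT = 1%E.
  by rewrite -mE// (Pbox_setT S_countable S_discrete h_measurable xi_stationary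
    xstar_recurrent M_separable ie iv_measurable).
have P1 : P setT = 1%E by exact: probability_setT.
pose phi n w : borel (Gstar M) := netclass (BI n w, o n w).
have mphi n : measurable_fun setT (phi n) by exact: measurable_rooted_window.
have mfphi n : measurable_fun setT (f \o phi n) by exact: measurableT_comp (mphi n).
have fphiC n w : `|(f \o phi n) w| <= C by exact: fC.
have lower (g : Gstar M -> R) K : continuous g -> (forall c, 0 <= g c) -> (forall c, g c <= K) ->
    forall e, 0 < e -> \forall n \near \oo,
      \int[m]_c g c - e <= \int[P]_w g (phi n w).
  move=> gc g0 gK e e0; have mg := continuous_Gstar_measurable gc.
  have := mean_window_average_ge gc g0 gK e0; apply: filterS => n.
  have -> : \int[m]_c g c = limit_value g.
    rewrite /Rintegral mI// -/mean /limit_value fineM//.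
    apply: (integrable_fin_num measurableT).
    apply: (integrable_level_sum S_countable S_discrete h_measurable ie iv_measurable
      inv rec _ g0 gK).
    exact: net_measurable_fun_borel.
  by rewrite /Rintegral -integral_rooted_window.
have intP n : (\int[pushforward P (phi n)]_x (f x)%:E = (\int[P]_w f (phi n w))%:E)%E.
  have fi := integrable_bounded P1 (mfphi n) (fphiC n).
  rewrite /Rintegral fineK; last exact: (integrable_fin_num measurableT fi).
  rewrite (@integral_pushforward _ _ _ _ _ (phi n) (mphi n) P setT (EFin \o f))//.
  exact/measurable_EFinP.
have -> : (\int[PB]_x (f x)%:E = (\int[m]_x f x)%:E)%E.
  rewrite (eq_setfun_integral _ mE) /Rintegral fineK//.
  exact: (integrable_fin_num measurableT (integrable_bounded m1 mf fC)).
under eq_cvg do rewrite intP.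
apply: cvg_EFin; first exact: nearW.
have fle c : - C <= f c <= C by rewrite -ler_norml.
apply/cvgrPdist_le => e e0.
have c1 : continuous (fun c => f c + C) by move=> c; exact: (cvgD (fc c) (cvg_cst C)).
have c2 : continuous (fun c => C - f c) by move=> c; exact: (cvgB (cvg_cst C) (fc c)).
have l1 : \forall n \near \oo,
    \int[m]_c (f c + C) - e <= \int[P]_w (f (phi n w) + C).
  by apply: (lower (fun c => f c + C) (C + C)) => // c; have /andP[] := fle c; lra.
have l2 : \forall n \near \oo,
    \int[m]_c (C - f c) - e <= \int[P]_w (C - f (phi n w)).
  by apply: (lower (fun c => C - f c) (C + C)) => // c; have /andP[] := fle c; lra.
near=> n.
have h1 : \int[m]_c (f c + C) - e <= \int[P]_w (f (phi n w) + C) by near: n.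
have h2 : \int[m]_c (C - f c) - e <= \int[P]_w (C - f (phi n w)) by near: n.
move: h1 h2; rewrite (Rintegral_addc m1 mf fC) (Rintegral_csub m1 mf fC).
rewrite (Rintegral_addc P1 (mfphi n) (fphiC n)) (Rintegral_csub P1 (mfphi n) (fphiC n)).
rewrite /comp; set x := Rintegral m _ _; set y := Rintegral P _ _ => h1 h2.
by rewrite /= ler_norml; apply/andP; split; lra.
Unshelve. all: by end_near. Qed.

End random_root.
End weak_limit.

Theorem proposition4p16
  (R : realType)
  (d : measure_display) (Omega : measurableType d) (P : probability Omega R)
  (* the countable state space, with the discrete sigma-algebra *)
  (dS : measure_display) (S : measurableType dS)
  (S_countable : countable [set: S]) (S_discrete : forall A : set S, measurable A)
  (Xi : completeMetricType R) (Xi_separable : separable Xi)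
  (h : S * borel Xi -> S) (h_measurable : measurable_fun setT h)
  (xi : int -> {RV P >-> borel Xi})
  (xi_stationary : stationary P (xi : int -> Omega -> Xi))
  (xi_ergodic : ergodic P (xi : int -> Omega -> Xi))
  (xstar : S) (xstar_recurrent : positive_recurrent P h xi xstar)
  (* the mark space, and the embeddings of vertex marks and edge marks into it *)
  (M : completeMetricType R) (M_separable : separable M)
  (M_uncountable : ~ countable [set: M])
  (iv : S * borel Xi -> borel M) (iv_measurable : measurable_fun setT iv)
  (iv_injective : injective iv)
  (ie : bool -> M) (ie_injective : injective ie)
  (* the intervals I_n = [- a n, b n] *)
  (a b : nat -> int)
  (I_increasing : forall m n, (m <= n)%N ->
     [set t | - a m <= t <= b m] `<=` [set t | - a n <= t <= b n])
  (I_contains0 : forall n, - a n <= 0 <= b n)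
  (a_infty : forall K : int, \forall n \near \oo, K <= a n)
  (b_increasing : {homo b : m n / (m < n)%N >-> m < n}) :
  let BI n w := spined_window h (xi^~ w) xstar iv ie (- a n) (b n) in
  let VI n w := bridge_window h (xi^~ w) xstar (- a n) (b n) in
  let J n := [set v : int * S | 0 <= v.1 <= b n] in
  let PB := Pbox P h xi xstar iv ie in
  (forall g : Gstar M -> R,
     measurable_fun setT (g : borel (Gstar M) -> R) ->
     (forall c, 0 <= g c) -> (exists C, forall c, g c <= C) ->
     depends_on_bounded_distance g ->
     {ae P, forall w,
       (#|` fset_set (VI n w `&` J n)|%:R^-1 *
          \sum_(v \in VI n w `&` J n) g (netclass (BI n w, v)))%:E
         @[n --> \oo] --> (\int[PB]_c (g c)%:E)%E})
  /\
  (forall o : nat -> Omega -> int * S,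
     (forall n, cond_uniform_indep P (VI n) (J n) (BI n) (o n)) ->
     weak_cvg
       (fun n => pushforward P
          (fun w => netclass (BI n w, o n w) : borel (Gstar M)))
       PB).
Proof.
move=> BI VI J PB; split=> [g mg g0 [C gC] [N gN]|o o_uniform]; last first.
  exact: (rooted_window_weak_cvg S_countable S_discrete h_measurable xi_stationary
    xi_ergodic xstar_recurrent M_separable iv_measurable I_contains0 a_infty
    b_increasing o_uniform).
rewrite (integral_Pbox_limit S_countable S_discrete h_measurable xi_stationary
  xstar_recurrent M_separable ie iv_measurable mg g0 gC).
have mg' := net_measurable_fun_borel S_countable M_separable mg.
have := ae_law (ae_window_average S_countable S_discrete h_measurable
  xi_stationary xi_ergodic xstar_recurrent ie iv_measurable I_contains0 a_infty
  b_increasing mg' g0 gC gN).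
by apply: filterS => w Ww; apply: cvg_EFin; first exact: nearW.
Qed.
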